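(* Let $d\in\mathbb N$, $\alpha\in(0,2)$, $m\ge0$, and $v,a>0$ be such that $\Phi_{m,\alpha}(-\Delta)-v\mathbf 1_{B_a}$ has a ground state. For every $\varepsilon>0$, the ground state $\varphi_\varepsilon$ of $\mathcal H^\varepsilon_{m,\alpha}=\Phi_{m,\alpha}(-\Delta)-v\eta_\varepsilon$ satisfies $\varphi_\varepsilon\in C^\infty(\mathbb R^d)\cap L^\infty(\mathbb R^d)$.
   Context: $B_r$ is the ball of radius $r$ centred at the origin in $\mathbb R^d$. $\Phi_{m,\alpha}(z)=(z+m^{2/\alpha})^{\alpha/2}-m$, $z>0$, and $\Phi_{m,\alpha}(-\Delta)$ is the self-adjoint operator on $L^2(\mathbb R^d)$ given by the Fourier multiplier $\Phi_{m,\alpha}(|\xi|^2)$. Let $\varrho(x)=C_\varrho e^{-1/(1-|x|^2)}$ for $|x|<1$, $\varrho(x)=0$ otherwise, with $\int\varrho=1$; $\varrho_{\varepsilon/2}(x)=(2/\varepsilon)^d\varrho(2x/\varepsilon)$; $\eta_\varepsilon=\varrho_{\varepsilon/2}*\mathbf 1_{B_{a+\varepsilon/2}}$, a smooth radially non-increasing cutoff equal to $1$ on $B_a$ and $0$ outside $B_{a+\varepsilon}$. The operators $\Phi_{m,\alpha}(-\Delta)-v\mathbf 1_{B_a}$ and $\mathcal H^\varepsilon_{m,\alpha}$ are self-adjoint on $L^2(\mathbb R^d)$ with essential spectrum $[0,\infty)$. Such an operator has a ground state if its discrete spectrum is non-empty; the minimum of the discrete spectrum is then a simple eigenvalue (ground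 state eigenvalue) and the ground state is the unique corresponding strictly positive eigenfunction with $L^2$-norm 1, taken in its continuous version. Standing assumption: $v$ is such that $\Phi_{m,\alpha}(-\Delta)-v\mathbf 1_{B_a}$ and every $\mathcal H^\varepsilon_{m,\alpha}$ have ground states. *)

(* Defs.v *)
From HB Require Import structures.
From mathcomp Require Import all_boot all_order all_algebra complex.
From mathcomp Require Import all_classical all_reals all_analysis.
Import Order.TTheory GRing.Theory Num.Theory.
Import numFieldNormedType.Exports.

Set Implicit Arguments.
Unset Strict Implicit.
Unset Printing Implicit Defensive.

Local Open Scope classical_set_scope.
Local Open Scope complex_scope.
Local Open Scope ring_scope.

(* R^d is 'rV[R]_d, with the sigma-algebra generated by the coordinates, i.e.
   the Borel one.  The library has no measure on it: lebesgue_rV d is the d-fold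
   product of the one-dimensional Lebesgue measure. *)

Section measurable_rV.
Context {disp : measure_display} {T : sigmaRingType disp}.
Variable n : nat.

Let coors : 'I_n -> 'rV[T]_n -> T := fun i x => x ord0 i.

Let rV_set0 : g_sigma_preimage coors set0.
Proof. exact: sigma_algebra0. Qed.

Let rV_setC A : g_sigma_preimage coors A -> g_sigma_preimage coors (~` A).
Proof. exact: sigma_algebraC. Qed.

Let rV_bigcup (F : _^nat) : (forall i, g_sigma_preimage coors (F i)) ->
  g_sigma_preimage coors (\bigcup_i (F i)).
Proof. exact: sigma_algebra_bigcup. Qed.

HB.instance Definition _ := @isMeasurable.Build (measure_tuple_display disp)
  'rV[T]_n (g_sigma_preimage coors) rV_set0 rV_setC rV_bigcup.

Lemma measurable_coord (i : 'I_n) :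
  measurable_fun [set: 'rV[T]_n] (fun x : 'rV[T]_n => x ord0 i).
Proof.
move=> _ Y mY; rewrite setTI; apply: sub_sigma_algebra => /=.
rewrite -bigcup_seq/=; exists i => /=; first by rewrite mem_index_enum.
by exists Y => //; rewrite setTI.
Qed.

End measurable_rV.

Lemma measurable_fun_rV d1 d2 (T1 : measurableType d1) (T2 : measurableType d2)
    n (f : T1 -> 'rV[T2]_n) :
  (forall i, measurable_fun [set: T1] (fun x => f x ord0 i)) ->
  measurable_fun [set: T1] f.
Proof.
move=> mf _ A mA; rewrite setTI.
suff : g_sigma_preimage (fun i (x : 'rV[T2]_n) => x ord0 i) `<=`
    [set B | measurable (f @^-1` B)] by apply.
apply: smallest_sub.
  split=> [|B mB|F mF] /=.
  - by rewrite preimage_set0.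
  - by rewrite setTD preimage_setC; exact: measurableC.
  - by rewrite preimage_bigcup; apply: bigcup_measurable => k _; exact: mF.
rewrite -bigcup_seq; apply: bigcup_sub => i _ B [C mC <-] /=.
by rewrite setTI; have := mf i measurableT _ mC; rewrite setTI.
Qed.

Section lebesgue_rV.
Context {R : realType}.

Definition rV_cons n (p : measurableTypeR R * 'rV[R]_n) : 'rV[R]_n.+1 :=
  \row_i (if unlift ord0 i is Some j then p.2 ord0 j else p.1).

Lemma measurable_rV_cons n : measurable_fun setT (@rV_cons n).
Proof.
apply: measurable_fun_rV => i.
under eq_fun do rewrite mxE.
case: unliftP => [j _|_]; last exact: measurable_fst.
by apply: (measurableT_comp (measurable_coord j)); exact: measurable_snd.
Qed.

Definition rV_uncons n (x : 'rV[R]_n.+1) : measurableTypeR R * 'rV[R]_n :=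
  (x ord0 ord0, \row_j x ord0 (lift ord0 j)).

Lemma measurable_rV_uncons n : measurable_fun setT (@rV_uncons n).
Proof.
apply: measurable_fun_pair; first exact: measurable_coord.
apply: measurable_fun_rV => i.
by under eq_fun do rewrite mxE; exact: measurable_coord.
Qed.

Lemma rV_consK n : cancel (@rV_cons n) (@rV_uncons n).
Proof.
move=> [x y]; rewrite /rV_uncons mxE unlift_none; congr pair.
by apply/rowP => j; rewrite !mxE liftK.
Qed.

Section step.
Variables (n : nat) (mu : {sigma_finite_measure set 'rV[R]_n -> \bar R}).

Let prod : {measure set (measurableTypeR R * 'rV[R]_n)%type -> \bar R} :=
  (@lebesgue_measure R \x mu)%E.

Definition lebesgue_rVS : set 'rV[R]_n.+1 -> \bar R :=
  pushforward prod (@rV_cons n).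

Let lebesgue_rVS0 : lebesgue_rVS set0 = 0%E.
Proof. by rewrite /lebesgue_rVS /pushforward preimage_set0 measure0. Qed.

Let lebesgue_rVS_ge0 A : (0 <= lebesgue_rVS A)%E.
Proof. by rewrite /lebesgue_rVS /pushforward measure_ge0. Qed.

Let lebesgue_rVS_sigma_additive : semi_sigma_additive lebesgue_rVS.
Proof.
move=> F mF tF mUF; rewrite /lebesgue_rVS /pushforward preimage_bigcup.
apply: measure_semi_sigma_additive.
- by move=> k; rewrite -[X in measurable X]setTI; exact: measurable_rV_cons.
- apply/trivIsetP => /= i j _ _ ij; rewrite -preimage_setI.
  by move/trivIsetP : tF => /(_ _ _ _ _ ij) ->//; rewrite preimage_set0.
- by rewrite -preimage_bigcup -[X in measurable X]setTI;
    exact: measurable_rV_cons.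
Qed.

HB.instance Definition _ := isMeasure.Build _ _ _ lebesgue_rVS
  lebesgue_rVS0 lebesgue_rVS_ge0 lebesgue_rVS_sigma_additive.

Let lebesgue_rVS_sigma_finite : sigma_finite setT lebesgue_rVS.
Proof.
have /sigma_finiteP[F [TF ndF Foo]] := sigma_finiteT (@lebesgue_measure R).
have /sigma_finiteP[G [TG ndG Goo]] := sigma_finiteT mu.
exists (fun k => @rV_uncons n @^-1` (F k `*` G k)).
  rewrite -preimage_bigcup (_ : \bigcup_k _ = setT) ?preimage_setT//.
  rewrite -subTset -setXTT TF TG => -[x y] /= [[i _ Fix] [j _ Gjy]].
  exists (maxn i j) => //; split => /=.
  - by move: x Fix; exact/subsetPset/ndF/leq_maxl.
  - by move: y Gjy; exact/subsetPset/ndG/leq_maxr.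
move=> k; have [mF Fk] := Foo k; have [mG Gk] := Goo k; split.
  rewrite -[X in measurable X]setTI.
  by apply: measurable_rV_uncons => //; exact: measurableX.
rewrite /lebesgue_rVS /pushforward -comp_preimage.
rewrite (_ : _ \o _ = id); last by apply/funext => p /=; rewrite rV_consK.
by rewrite preimage_id /prod/= product_measure1E// lte_mul_pinfty// ge0_fin_numE.
Qed.

HB.instance Definition _ := Measure_isSigmaFinite.Build _ _ _ lebesgue_rVS
  lebesgue_rVS_sigma_finite.

End step.

Fixpoint lebesgue_rV d : {sigma_finite_measure set 'rV[R]_d -> \bar R} :=
  match d with
  | 0 => @dirac _ 'rV[R]_0 0 R
  | n.+1 => lebesgue_rVS (lebesgue_rV n)
  end.

End lebesgue_rV.

Section L2.
Context {R : realType} {d : nat}.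
Local Notation mu := (@lebesgue_rV R d).
Implicit Types u v : 'rV[R]_d -> R[i].

Definition dotp (x y : 'rV[R]_d) : R := \sum_(i < d) x ord0 i * y ord0 i.

(* The norm of 'rV[R]_d provided by the library is the sup norm. *)
Definition enorm (x : 'rV[R]_d) : R := Num.sqrt (dotp x x).

Definition eball (r : R) : set 'rV[R]_d := [set x | enorm x < r].

Definition L2 u : Prop :=
  (fun x => complex.Re (u x)) \in Lfun mu 2%:E /\
  (fun x => complex.Im (u x)) \in Lfun mu 2%:E.

Definition L2norm u : \bar R := Lnorm mu 2%:E (fun x => (Normc.normc (u x))%:E).

Definition ae_eqC u v : Prop := {ae mu, forall x, u x = v x}.

Definition cintegral u : R[i] :=
  (\int[mu]_x complex.Re (u x)) +i* (\int[mu]_x complex.Im (u x)).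

(* Unitary normalization: (2 pi)^(-d/2) \int u(x) e^(- i x.xi) dx. *)
Definition fourier1 u (xi : 'rV[R]_d) : R[i] :=
  ((2 * pi) `^ (- (d%:R / 2)))%:C *
  cintegral (fun x => u x * (cos (dotp x xi) -i* sin (dotp x xi))).

(* The Fourier transform on L^2, as the limit in L^2 of the transforms of the
   truncations of u to balls.  Elements of L^2 are handled through
   representatives, so the transform is a relation, functional up to almost
   everywhere equality. *)
Definition fourier2 u v : Prop :=
  [/\ L2 u, L2 v &
    (fun n : nat => L2norm (fun xi =>
       v xi - fourier1 (fun x => u x * (\1_(eball n%:R) x)%:C) xi))
      @ \oo --> 0%E].

(* An unbounded operator on L^2 is given by its graph: T u w means that u is in
   the domain of T and that T u = w in L^2. *)
Definition fourier_multiplier (g : 'rV[R]_d -> R) u w : Prop :=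
  exists2 v, fourier2 u v & fourier2 w (fun xi => (g xi)%:C * v xi).

(* The sum of the operator T and the multiplication by a bounded potential V;
   its domain is the one of T. *)
Definition add_potential (T : ('rV[R]_d -> R[i]) -> ('rV[R]_d -> R[i]) -> Prop)
    (V : 'rV[R]_d -> R) u w : Prop :=
  L2 w /\ exists2 w0, T u w0 & ae_eqC w (fun x => w0 x + (V x)%:C * u x).

Section spectrum.
Variable T : ('rV[R]_d -> R[i]) -> ('rV[R]_d -> R[i]) -> Prop.

(* (T - z) u = f reads T u (f + z u); z is in the resolvent set when T - z is
   onto, one-to-one, and has a bounded inverse. *)
Definition resolvent_set : set R[i] := [set z |
  [/\ forall f, L2 f -> exists u, T u (fun x => f x + z * u x),
      forall u, T u (fun x => z * u x) -> ae_eqC u (fun=> 0) &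
      exists C : R, forall u f, L2 f -> T u (fun x => f x + z * u x) ->
        (L2norm u <= C%:E * L2norm f)%E] ].

Definition spectrum : set R[i] := ~` resolvent_set.

Definition eigenvalue_of (z : R[i]) : Prop :=
  exists2 u, T u (fun x => z * u x) & ~ ae_eqC u (fun=> 0).

Definition finite_multiplicity (z : R[i]) : Prop :=
  exists (n : nat) (e : 'I_n -> 'rV[R]_d -> R[i]),
    forall u, T u (fun x => z * u x) ->
      exists c : 'I_n -> R[i], ae_eqC u (fun x => \sum_(j < n) c j * e j x).

Definition discrete_spectrum : set R[i] := [set z |
  [/\ spectrum z,
      exists2 r : R, 0 < r &
        forall z', spectrum z' -> z' != z -> r <= Normc.normc (z' - z),
      eigenvalue_of z & finite_multiplicity z] ].

Definition has_ground_state : Prop := discrete_spectrum !=set0.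

(* In the order of R[i], z <= z' means that z' - z is real and nonnegative. *)
Definition ground_state_eigenvalue (z : R[i]) : Prop :=
  discrete_spectrum z /\ forall z', discrete_spectrum z' -> z <= z'.

(* phi is the continuous version of a normalized, strictly positive eigenfunction
   at the bottom of the discrete spectrum; positivity is a property of the
   L^2 class, hence holds almost everywhere. *)
Definition is_ground_state (phi : 'rV[R]_d -> R) : Prop :=
  [/\ exists2 z, ground_state_eigenvalue z &
        T (fun x => (phi x)%:C) (fun x => z * (phi x)%:C),
      {ae mu, forall x, 0 < phi x},
      L2norm (fun x => (phi x)%:C) = 1%E &
      continuous phi].

End spectrum.

Fixpoint Ck (k : nat) (f : 'rV[R]_d -> R) : Prop :=
  continuous f /\
  match k with
  | 0 => True
  | k'.+1 => forall i : 'I_d,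
      (forall x, derivable f x (delta_mx ord0 i)) /\
      Ck k' (fun x => 'D_(delta_mx ord0 i) f x)
  end.

Definition Cinfty (f : 'rV[R]_d -> R) : Prop := forall k, Ck k f.

End L2.

Section model.
Context {R : realType} {d : nat}.
Local Notation mu := (@lebesgue_rV R d).
Implicit Types x : 'rV[R]_d.

Definition Phi (m alpha z : R) : R :=
  (z + m `^ (2 / alpha)) `^ (alpha / 2) - m.

Definition Phi_laplacian (m alpha : R) :=
  fourier_multiplier (fun xi : 'rV[R]_d => Phi m alpha (enorm xi ^+ 2)).

Definition schrodinger (m alpha : R) (V : 'rV[R]_d -> R) :=
  add_potential (Phi_laplacian m alpha) V.

Definition bump x : R :=
  if enorm x < 1 then expR (- (1 - enorm x ^+ 2)^-1) else 0.

Definition rho x : R := (\int[mu]_y bump y)^-1 * bump x.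

Definition rho_scaled (delta : R) x : R :=
  delta^-1 ^+ d * rho (delta^-1 *: x).

Definition eta (a eps : R) x : R :=
  \int[mu]_y (rho_scaled (eps / 2) (x - y) * \1_(eball (a + eps / 2)) y).

End model.

(* Main.v *)
Require Import Defs.
From mathcomp Require Import all_boot all_order all_algebra complex.
From mathcomp Require Import all_classical all_reals all_analysis.
From mathcomp Require Import measurable_realfun ess_sup_inf.
From mathcomp Require Import ring lra.
Import Order.TTheory GRing.Theory Num.Theory.
Import numFieldNormedType.Exports.

(** Write [u^] for the Fourier transform of [u].  On the Fourier side the
    eigenvalue equation reads [(Phi(|xi|^2) - z) phi^ = v (eta phi)^].  The
    symbol grows like [|xi|^alpha], so that the constant [z] is negligible at
    high frequency, where [phi^] decays better than [(eta phi)^] by the factor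
    [|xi|^-alpha] (Phi_elliptic).  Conversely [(eta phi)^] is a convolution of
    [phi^] with the transform of a smooth compactly supported function, which
    decays faster than any power, so that it inherits the decay of [phi^]
    (ft_mollified_le).  Alternating the two estimates improves the decay by
    [alpha] each time, starting from the boundedness of [(eta phi)^], and all
    moments of [phi^] are integrable (bootstrap_moments).  As [phi] is
    continuous, it equals everywhere the inverse transform of [phi^]
    (fourier2_inversion), which is bounded, and smooth because each derivative
    only multiplies [phi^] by a linear function (Ck_ft).

    The transform on [L^2] is given as a relation, by limits of truncations.
    What connects it with integrals is the pairing
    [int phi^ g = int phi g^] for rapidly decreasing [g] (fourier2_pairing),
    which is Fubini's theorem followed by a passage to the limit.  With [g] a
    modulated wide Gaussian it gives the inversion formula; with [g] a
    translate of the transform of a bump it gives the convolution estimate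
    (ft_localised), where the inversion formula is applied to the bump.

    Two explicit computations are needed.  The transform of a Gaussian solves
    a linear differential equation along every line (ft_gauss).  The bump
    [exp (-1 / (1 - |x|^2))] lies in a class of functions that is stable under
    differentiation and whose members are compactly supported (bump_class), so
    that repeated integration by parts gives the decay of its transform
    (bump_class_ft_decay).  Integration by parts rests on translation
    invariance alone (cintegral_derivative). *)

Set Implicit Arguments.
Unset Strict Implicit.
Unset Printing Implicit Defensive.

Local Open Scope classical_set_scope.
Local Open Scope complex_scope.
Local Open Scope ring_scope.

(** * Translation invariance and tensor products for Lebesgue measure *)

Section measure.
Context {R : realType}.

Lemma pushforward_lebesgue_shift (c : R) (A : set R) : measurable A ->
  pushforward (@lebesgue_measure R) (fun x : measurableTypeR R => x + c :
    measurableTypeR R) A =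
  lebesgue_measure A.
Proof.
move=> mA.
have ms : measurable_fun setT (fun x : measurableTypeR R => x + c : measurableTypeR R).
  exact: measurable_funD.
pose s := MeasurableFun.Pack (MeasurableFun.Class (isMeasurableFun.Build _ _ _ _ _ ms)).
suff H : forall X, ocitv X -> lebesgue_measure X = pushforward
  (@lebesgue_measure R) s X.
  by apply/esym; exact: (lebesgue_measure_unique H).
move=> _ [[a b]] _ <-.
rewrite /pushforward.
have -> : (fun x : measurableTypeR R => x + c : measurableTypeR R) @^-1` `]a,
  b] = [set` `]a - c, b - c]].
  by apply/seteqP; split => x /=; rewrite !in_itv/= => /andP[h1 h2];
    apply/andP; split; lra.
rewrite !lebesgue_measure_itv/= !lte_fin ltrD2r.
by case: ifP => // _; rewrite -!EFinB; congr EFin; ring.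
Qed.

Lemma ge0_integral_shift1 (c : R) (f : R -> \bar R) :
  measurable_fun [set: R] f -> (forall x, 0 <= f x)%E ->
  (\int[lebesgue_measure]_x f (x + c)%R = \int[lebesgue_measure]_x f x)%E.
Proof.
move=> mf f0.
have ms : measurable_fun setT (fun x : measurableTypeR R => x + c : measurableTypeR R).
  exact: measurable_funD.
have := @ge0_integral_pushforward _ _ _ _ R _ ms (@lebesgue_measure R) setT f
  measurableT mf.
rewrite preimage_setT => <-; last by move=> x _; exact: f0.
apply: eq_measure_integral => A mA _.
exact: pushforward_lebesgue_shift.
Qed.

(** Integrals over [R^n.+1] are reduced to iterated ones here, and everything
    about the measure is then an induction on the dimension. *)
Lemma ge0_integral_rVS n (f : 'rV[R]_n.+1 -> \bar R) :
  measurable_fun [set: 'rV[R]_n.+1] f -> (forall x, 0 <= f x)%E ->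
  (\int[@lebesgue_rV R n.+1]_x f x =
   \int[lebesgue_measure]_t \int[@lebesgue_rV R n]_y f (rV_cons (t, y)))%E.
Proof.
move=> mf f0 /=.
have mc := @measurable_rV_cons R n.
have := @ge0_integral_pushforward _ _ _ _ R _ mc
  (@lebesgue_measure R \x @lebesgue_rV R n)%E setT f measurableT mf.
rewrite preimage_setT => /(_ (fun x _ => f0 x)) ih.
transitivity (\int[(lebesgue_measure \x lebesgue_rV n)%E]_x
  (f \o @rV_cons R n) x)%E; first exact: ih.
by rewrite fubini_tonelli1//=; exact: measurableT_comp.
Qed.

Lemma rV_consD n (t c : R) (y z : 'rV[R]_n) :
  rV_cons (t + c, y + z) = rV_cons (t, y) + rV_cons (c, z).
Proof. by apply/rowP => i; rewrite !mxE; case: unliftP => [j|] _ //=; rewrite mxE. Qed.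

Lemma rV_unconsK n : cancel (@rV_uncons R n) (@rV_cons R n).
Proof.
move=> x; apply/rowP => i; rewrite mxE.
by case: unliftP => [j ->|->] /=; rewrite ?mxE.
Qed.

Lemma measurable_shift d (c : 'rV[R]_d) :
  measurable_fun [set: 'rV[R]_d] (fun x => x + c).
Proof.
apply: measurable_fun_rV => i; under eq_fun do rewrite mxE.
by apply: measurable_funD => //; exact: measurable_coord.
Qed.

Lemma ge0_integral_shift d (c : 'rV[R]_d) (f : 'rV[R]_d -> \bar R) :
  measurable_fun [set: 'rV[R]_d] f -> (forall x, 0 <= f x)%E ->
  (\int[lebesgue_rV d]_x f (x + c)%R = \int[lebesgue_rV d]_x f x)%E.
Proof.
elim: d => [|n ih] in c f * => mf f0.
  by apply: eq_integral => x _; congr (f _); apply/rowP => -[].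
have mfc : measurable_fun setT (fun x : 'rV[R]_n.+1 => f (x + c)).
  by apply: measurableT_comp => //; exact: measurable_shift.
rewrite (ge0_integral_rVS mfc (fun x => f0 _)) (ge0_integral_rVS mf f0).
rewrite -(rV_unconsK c); case: (rV_uncons c) => t0 y0.
under eq_integral => t _.
  under eq_integral => y _ do rewrite -rV_consD.
  over.
pose F t := (\int[lebesgue_rV n]_y f (rV_cons (t, y)))%E.
have mF : measurable_fun setT F.
  apply: (measurable_fun_fubini_tonelli_F (f \o @rV_cons R n)) => [|x] //=.
  by apply: measurableT_comp => //; exact: measurable_rV_cons.
rewrite -[RHS](ge0_integral_shift1 t0 mF); last by move=> x; exact: integral_ge0.
apply: eq_integral => t _; rewrite /F.
rewrite -[RHS](ih y0)//.
apply: measurableT_comp => //.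
apply: (measurableT_comp (@measurable_rV_cons R n)).
exact: measurable_fun_pair.
Qed.

Lemma ge0_integral_prod d (f : R -> R) (c : R) :
  measurable_fun [set: R] f -> (forall t, 0 <= f t) ->
  (\int[lebesgue_measure]_t (f t)%:E = c%:E)%E ->
  (\int[lebesgue_rV d]_x (\prod_(i < d) f (x ord0 i))%:E = (c ^+ d)%:E)%E.
Proof.
move=> mf f0 fc; elim: d => [|n ih].
  rewrite /= integral_dirac//=; last by apply/measurable_EFinP; under eq_fun do
    rewrite big_ord0; exact: measurable_cst.
  by rewrite diracT mul1e big_ord0 expr0.
have mp : forall n, measurable_fun setT (fun x : 'rV[R]_n => (\prod_(i < n) f
  (x ord0 i))%:E).
  move=> k; apply/measurable_EFinP; apply: measurable_prod => i _.
  by apply: measurableT_comp => //; exact: measurable_coord.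
have p0 k (x : 'rV[R]_k) : 0 <= \prod_(i < k) f (x ord0 i).
  by apply: prodr_ge0 => i _.
rewrite ge0_integral_rVS//; last by move=> x; rewrite lee_fin.
transitivity (\int[lebesgue_measure]_t ((f t)%:E * (c ^+ n)%:E))%E.
  apply: eq_integral => t _; rewrite -ih -ge0_integralZl_EFin//; [|by move=> y
    _; rewrite lee_fin|exact: mp].
  apply: eq_integral => y _; rewrite big_ord_recl !mxE unlift_none /= EFinM.
  by congr (_ * _%:E)%E; apply: eq_bigr => i _; rewrite mxE liftK.
have c0 : 0 <= c.
  by rewrite -lee_fin -fc integral_ge0// => t _; rewrite lee_fin.
rewrite ge0_integralZr//; last by rewrite lee_fin exprn_ge0.
all: try by move=> t _; rewrite lee_fin.
all: try exact/measurable_EFinP.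
by rewrite fc -EFinM -exprS.
Qed.

End measure.

(** * Weights on the space *)

Section weight.
Context {R : realType} {d : nat}.
Implicit Types x y z : 'rV[R]_d.

(** The [l^1] norm is preferred to the Euclidean one because it is a sum of
    coordinates: the decay of a transform is obtained one coordinate at a
    time. *)
Definition norm1 x : R := \sum_(i < d) `|x ord0 i|.
Definition wt x : R := 1 + norm1 x.
(** Twice the dimension is an exponent that makes the inverse of the weight
    integrable.  A bound by a multiple of [wt_int] is the notion of rapid
    decay used throughout. *)
Definition wt_int x : R := (wt x ^+ (2 * d))^-1.

Lemma norm1_ge0 x : 0 <= norm1 x.
Proof. exact: sumr_ge0. Qed.

Lemma norm1D x y : norm1 (x + y) <= norm1 x + norm1 y.
Proof. by rewrite /norm1 -big_split ler_sum// => i _; rewrite mxE ler_normD. Qed.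

Lemma norm1N x : norm1 (- x) = norm1 x.
Proof. by apply: eq_bigr => i _; rewrite mxE normrN. Qed.

Lemma norm1Z (t : R) x : norm1 (t *: x) = `|t| * norm1 x.
Proof. by rewrite /norm1 mulr_sumr; apply: eq_bigr => i _; rewrite mxE normrM. Qed.

Lemma norm1_le_norm x : norm1 x <= d%:R * `|x|.
Proof.
have -> : d%:R * `|x| = \sum_(i < d) `|x| by rewrite sumr_const card_ord mulr_natl.
apply: ler_sum => i _.
by rewrite [leRHS]/Num.norm /= mx_normrE; apply/bigmax_geP; right; exists (ord0, i).
Qed.

Lemma wt_ge1 x : 1 <= wt x.
Proof. by rewrite lerDl norm1_ge0. Qed.

Lemma wt_gt0 x : 0 < wt x.
Proof. exact: lt_le_trans (wt_ge1 x). Qed.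

Lemma wtN x : wt (- x) = wt x.
Proof. by rewrite /wt norm1N. Qed.

Lemma wtD x y : wt (x + y) <= wt x * wt y.
Proof.
rewrite /wt; have := norm1D x y.
have := mulr_ge0 (norm1_ge0 x) (norm1_ge0 y); lra.
Qed.

(** Peetre's inequality: translations change the weight by a bounded factor. *)
Lemma wt_shift x y : wt x <= wt (x + y) * wt y.
Proof. by have := wtD (x + y) (- y); rewrite addrK wtN. Qed.

Lemma coord_le_wt x i : `|x ord0 i| <= wt x.
Proof.
rewrite /wt /norm1 (bigD1 i)//=.
have : 0 <= \sum_(j < d | j != i) `|x ord0 j| by apply: sumr_ge0.
lra.
Qed.

Lemma dotpC x y : dotp x y = dotp y x.
Proof. by apply: eq_bigr => i _; rewrite mulrC. Qed.

Lemma dotpDl x y z : dotp (x + y) z = dotp x z + dotp y z.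
Proof. by rewrite /dotp -big_split; apply: eq_bigr => i _; rewrite mxE mulrDl. Qed.

Lemma dotpDr x y z : dotp z (x + y) = dotp z x + dotp z y.
Proof. by rewrite dotpC dotpDl !(dotpC _ z). Qed.

Lemma dotpZl (t : R) x y : dotp (t *: x) y = t * dotp x y.
Proof. by rewrite /dotp mulr_sumr; apply: eq_bigr => i _; rewrite mxE mulrA. Qed.

Lemma dotpZr (t : R) x y : dotp x (t *: y) = t * dotp x y.
Proof. by rewrite dotpC dotpZl dotpC. Qed.

Lemma dotpNl x y : dotp (- x) y = - dotp x y.
Proof. by rewrite -scaleN1r dotpZl mulN1r. Qed.

Lemma dotpNr x y : dotp x (- y) = - dotp x y.
Proof. by rewrite dotpC dotpNl dotpC. Qed.

Lemma dotp0l x : dotp 0 x = 0.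
Proof. by rewrite -(scale0r 0) dotpZl mul0r. Qed.

Lemma dotp_delta x i : dotp x (delta_mx ord0 i) = x ord0 i.
Proof.
rewrite /dotp (bigD1 i)//= big1 ?addr0; last first.
  by move=> j ji; rewrite mxE (negbTE ji) andbF mulr0.
by rewrite mxE !eqxx mulr1.
Qed.

Lemma dotp_ge0 x : 0 <= dotp x x.
Proof. by apply: sumr_ge0 => i _; rewrite -expr2 sqr_ge0. Qed.

Lemma abs_dotp_le x y : `|dotp x y| <= wt x * norm1 y.
Proof.
rewrite /dotp (le_trans (ler_norm_sum _ _ _))// /norm1 mulr_sumr ler_sum// => i _.
by rewrite normrM ler_wpM2r// coord_le_wt.
Qed.

Lemma sqr_enorm x : enorm x ^+ 2 = dotp x x.
Proof. by rewrite sqr_sqrtr ?dotp_ge0. Qed.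

Lemma enorm_ge0 x : 0 <= enorm x.
Proof. exact: sqrtr_ge0. Qed.

Lemma coord_le_enorm x i : `|x ord0 i| <= enorm x.
Proof.
rewrite -sqrtr_sqr ler_wsqrtr// /dotp (bigD1 i)//= expr2 lerDl.
by apply: sumr_ge0 => j _; rewrite -expr2 sqr_ge0.
Qed.

Lemma norm1_le_enorm x : norm1 x <= d%:R * enorm x.
Proof.
have -> : d%:R * enorm x = \sum_(i < d) enorm x by rewrite sumr_const card_ord
  mulr_natl.
by apply: ler_sum => i _; exact: coord_le_enorm.
Qed.

Lemma enorm_le_norm1 x : enorm x <= norm1 x.
Proof.
rewrite -(ler_pXn2r (_ : 0 < 2)%N)// ?nnegrE ?enorm_ge0 ?norm1_ge0//.
rewrite sqr_enorm /dotp expr2 {1}/norm1 mulr_suml ler_sum// => i _.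
rewrite (le_trans (ler_norm _))// normrM ler_wpM2l//.
rewrite /norm1 (bigD1 i)//= lerDl; exact: sumr_ge0.
Qed.

Lemma wt_int_gt0 x : 0 < wt_int x.
Proof. by rewrite invr_gt0 exprn_gt0// wt_gt0. Qed.

Lemma wt_int_ge0 x : 0 <= wt_int x.
Proof. exact/ltW/wt_int_gt0. Qed.

Lemma wt_int_coef_ge0 (r C : R) x : 0 <= r -> r <= C * wt_int x -> 0 <= C.
Proof.
by move=> r0 /(le_trans r0); rewrite pmulr_lge0// wt_int_gt0.
Qed.

Lemma wt_int_le1 x : wt_int x <= 1.
Proof. by rewrite invf_le1 ?exprn_gt0 ?wt_gt0// exprn_ege1// wt_ge1. Qed.

Lemma wt_int_shift x y : wt_int (x + y) <= wt y ^+ (2 * d) * wt_int x.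
Proof.
rewrite /wt_int ler_pdivlMr ?exprn_gt0 ?wt_gt0// mulrC.
rewrite ler_pdivrMr ?exprn_gt0 ?wt_gt0//.
rewrite -exprMn lerXn2r ?nnegrE ?mulr_ge0 ?(ltW (wt_gt0 _))//.
by rewrite mulrC; exact: wt_shift.
Qed.

Lemma measurable_norm1 : measurable_fun [set: 'rV[R]_d] norm1.
Proof.
apply: measurable_sum => i.
by apply: measurableT_comp => //; exact: measurable_coord.
Qed.

Lemma measurable_wt : measurable_fun [set: 'rV[R]_d] wt.
Proof. by apply: measurable_funD => //; exact: measurable_norm1. Qed.

Lemma measurable_dotp2 :
  measurable_fun setT (fun p : 'rV[R]_d * 'rV[R]_d => dotp p.1 p.2).
Proof.
apply: measurable_sum => i; apply: measurable_funM.
- by apply: (measurableT_comp (measurable_coord i)); exact: measurable_fst.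
- by apply: (measurableT_comp (measurable_coord i)); exact: measurable_snd.
Qed.

Lemma measurable_dotpl y : measurable_fun setT (fun x => dotp x y).
Proof.
apply: measurable_sum => i; apply: measurable_funM => //.
exact: measurable_coord.
Qed.

Lemma measurable_dotpp : measurable_fun setT (fun x => dotp x x).
Proof.
by apply: measurable_sum => i; apply: measurable_funM => //;
  exact: measurable_coord.
Qed.

Lemma measurable_wt_int : measurable_fun [set: 'rV[R]_d] wt_int.
Proof.
have -> : wt_int = (fun x => (wt x)`^ (- (2 * d)%:R)).
  by apply/funext => x; rewrite powRN powR_mulrn// ltW// wt_gt0.
by apply: (measurableT_comp (measurable_powR _)); exact: measurable_wt.
Qed.
End weight.

Section integrable_weight.
Context {R : realType}.

Lemma integral_cauchy_density :
  exists c : R, (\int[lebesgue_measure]_t ((1 + t ^+ 2)^-1 : R)%:E = c%:E)%E.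
Proof.
have p0 (x : R) : 0 < 1 + x ^+ 2 by have := sqr_ge0 x; lra.
have cf : continuous (fun x : R => (1 + x ^+ 2)^-1).
  move=> x; apply: cvgV; first by rewrite gt_eqF.
  apply: cvgD; first exact: cvg_cst.
  exact: exprn_continuous.
exists (2 * (pi / 2)).
rewrite ge0_symfun_integralT//; last 2 first.
- by move=> x; rewrite invr_ge0 ltW.
- by move=> x /=; rewrite sqrrN.
rewrite EFinM; congr (_ * _)%E.
rewrite -set_itvcy (@ge0_continuous_FTC2y _ _ (@atan R) 0 (pi / 2)).
- by rewrite atan0 sube0.
- by move=> x _; rewrite invr_ge0 ltW.
- exact: continuous_subspaceT.
- exact: cvgy_atan.
- by move=> x _; exact: derivable_atan.
- apply: cvg_at_right_filter; exact: continuous_atan.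
- by move=> x _; rewrite derive1_atan.
Qed.

(** [1 + x_i ^ 2 <= wt x ^ 2] for every [i], so that [wt_int] lies below the
    tensor power of the Cauchy density. *)
Lemma integrable_wt_int d :
  (@lebesgue_rV R d).-integrable setT (EFin \o @wt_int R d).
Proof.
have [c hc] := integral_cauchy_density.
have p0 (x : R) : 0 < 1 + x ^+ 2 by have := sqr_ge0 x; lra.
have mf : measurable_fun [set: R] (fun t : R => (1 + t ^+ 2)^-1).
  have -> : (fun t : R => (1 + t ^+ 2)^-1) = (fun t => (1 + t ^+ 2) `^ (- 1)).
    by apply/funext => x; rewrite powRN powRr1// ltW.
  apply: (measurableT_comp (measurable_powR _)).
  by apply: measurable_funD => //; exact: exprn_measurable.
have f0 (t : R) : 0 <= (1 + t ^+ 2)^-1 by rewrite invr_ge0 ltW.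
have := ge0_integral_prod d mf f0 hc.
set P := (fun x : 'rV_d => _) => hP.
have mP : measurable_fun setT P.
  apply/measurable_EFinP; apply: measurable_prod => i _.
  by apply: (measurableT_comp mf); exact: measurable_coord.
apply: (@le_integrable _ _ _ _ _ measurableT _ P).
- by apply/measurable_EFinP; exact: measurable_wt_int.
- move=> x _; rewrite /= !ger0_norm ?wt_int_ge0 ?prodr_ge0// lee_fin.
  rewrite /wt_int prodfV exprM.
  rewrite lef_pV2 ?posrE; [|by rewrite !exprn_gt0 ?wt_gt0|by apply: prodr_gt0 => i _].
  rewrite -[X in _ ^+ X](card_ord d) -prodr_const ler_prod// => i _.
  rewrite ltW//=.
  rewrite /wt /norm1 (bigD1 i)//=.
  set S := \sum_(_ < _ | _) _.
  have S0 : 0 <= S by apply: sumr_ge0.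
  have := normr_ge0 (x ord0 i); set a := `|_| => a0.
  have -> : x ord0 i ^+ 2 = a ^+ 2 by rewrite real_normK ?num_real.
  nra.
- apply/integrableP; split => //.
  under eq_integral => x _ do rewrite gee0_abs ?lee_fin ?prodr_ge0//.
  by rewrite hP ltry.
Qed.

End integrable_weight.

(** * Taylor estimates in one variable *)

Section taylor.
Context {R : realType}.
Implicit Types f df ddf : R -> R.

Lemma MVT_from0 f df (t : R) : (forall x : R, is_derive x (1 : R) f (df x)) ->
  exists2 c, `|c| <= `|t| & f t - f 0 = t * df c.
Proof.
move=> fdf.
have cf : continuous f by move=> x; apply/differentiable_continuous/derivable1_diffP.
case: (leP 0 t) => [t0|/ltW t0].
  have [c /itvP ct ->] := @MVT_segment R f df 0 t t0 (fun x _ => fdf x)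
    (continuous_subspaceT cf).
  by exists c; rewrite ?subr0 1?mulrC// !ger0_norm// ct.
have [c /itvP ct e] := @MVT_segment R f df t 0 t0 (fun x _ => fdf x)
  (continuous_subspaceT cf).
exists c; first by rewrite !ler0_norm ?lerN2 ?ct.
by rewrite -opprB e sub0r mulrN opprK mulrC.
Qed.

Lemma taylor2_le f df ddf (M t : R) : (forall x : R, is_derive x (1 : R) f (df x)) ->
  (forall x : R, is_derive x (1 : R) df (ddf x)) ->
  (forall s, `|s| <= `|t| -> `|ddf s| <= M) ->
  `|f t - f 0 - t * df 0| <= M * t ^+ 2.
Proof.
move=> fdf dfddf ddfM.
have [c ct ->] := MVT_from0 t fdf.
have [e ec] := MVT_from0 c dfddf.
rewrite -mulrBr => ->.
rewrite !normrM mulrA mulrC expr2.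
have -> : M * (t * t) = M * (`|t| * `|t|) by rewrite -normrM ger0_norm// -expr2 sqr_ge0.
rewrite ler_pM// ?mulr_ge0 ?ddfM ?(le_trans ec)//.
by rewrite ler_wpM2l.
Qed.

Lemma taylor1_le f df (M t : R) : (forall x : R, is_derive x (1 : R) f (df x)) ->
  (forall s, `|s| <= `|t| -> `|df s| <= M) ->
  `|f t - f 0| <= M * `|t|.
Proof.
move=> fdf dfM; have [c ct ->] := MVT_from0 t fdf.
by rewrite normrM mulrC ler_wpM2r// dfM.
Qed.

(** Transforms will be differentiated through quadratic remainders, which are
    simply integrated, instead of through limits under the integral sign. *)
Lemma is_derive_quadratic_dir (V : normedModType R) (f : V -> R) (x v : V) (D C : R) :
  (forall h : R, `|h| <= 1 -> `|f (x + h *: v) - f x - h * D| <= C * h ^+ 2) ->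
  is_derive x v f D.
Proof.
move=> H.
suff cv : h^-1 *: (f (h *: v + x) - f x) @[h --> 0^'] --> D.
  by apply: DeriveDef; [apply/cvg_ex; exists D|exact/cvg_lim].
have C0 : 0 <= C by have := H 1; rewrite normr1 expr1n mulr1 => /(_ (lexx _));
  apply: le_trans.
apply/cvgrPdist_le => e e0; near=> h.
have h0 : h != 0 by near: h; exact: nbhs_dnbhs_neq.
have h1 : `|h| <= 1.
  near: h; apply: dnbhs0_le; exact: ltr01.
have h2 : `|h| <= e / (C + 1).
  near: h; apply: dnbhs0_le; apply: divr_gt0 => //; lra.
rewrite distrC (addrC (h *: v)).
have -> : h^-1 *: (f (x + h *: v) - f x) - D = h^-1 * (f (x + h *: v) - f x - h * D).
  by rewrite [LHS]/(_ * _ - _) [RHS]mulrBr mulrA mulVf// mul1r.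
rewrite normrM normfV ler_pdivrMl ?normr_gt0//.
rewrite (le_trans (H _ h1))//.
have -> : h ^+ 2 = `|h| * `|h| by rewrite -normrM ger0_norm// -expr2 sqr_ge0.
rewrite mulrCA ler_wpM2l//.
move: h2; rewrite ler_pdivlMr; last by lra.
have := normr_ge0 h; nra.
Unshelve. all: by end_near. Qed.

Lemma is_derive_quadratic f (x D C : R) :
  (forall h, `|h| <= 1 -> `|f (x + h) - f x - h * D| <= C * h ^+ 2) ->
  is_derive x (1 : R) f D.
Proof.
move=> H; apply: (@is_derive_quadratic_dir R^o f x 1 D C) => h.
by rewrite [h *: _]mulr1; exact: H.
Qed.

Lemma abs_sin_le (t : R) : `|sin t| <= `|t|.
Proof.
have := @taylor1_le sin cos 1 t (fun x => is_derive_sin x).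
by rewrite sin0 subr0 mul1r; apply => s _; rewrite ler_norml cos_geN1 cos_le1.
Qed.

Lemma abs_cosB1_le (t : R) : `|cos t - 1| <= `|t|.
Proof.
have := @taylor1_le cos (fun x => - sin x) 1 t (fun x => is_derive_cos x).
by rewrite cos0 mul1r; apply => s _; rewrite normrN ler_norml sin_geN1 sin_le1.
Qed.

Lemma abs_cosB1_le2 (t : R) : `|cos t - 1| <= t ^+ 2.
Proof.
have := @taylor2_le cos (fun x => - sin x) (fun x => - cos x) 1 t (fun x =>
  is_derive_cos x).
rewrite cos0 sin0 oppr0 mulr0 subr0 mul1r; apply => s.
  by move=> _; rewrite normrN ler_norml cos_geN1 cos_le1.
Qed.

Lemma abs_sinBid_le2 (t : R) : `|sin t - t| <= t ^+ 2.
Proof.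
have := @taylor2_le sin cos (fun x => - sin x) 1 t (fun x => is_derive_sin x)
  (fun x => is_derive_cos x).
rewrite cos0 sin0 subr0 mulr1 mul1r; apply => s _.
by rewrite normrN ler_norml sin_geN1 sin_le1.
Qed.

End taylor.

(** * Complex-valued integrals *)

Section complex_facts.
Context {R : realType}.
Implicit Types z : R[i].

Lemma cReD z1 z2 : complex.Re (z1 + z2) = complex.Re z1 + complex.Re z2.
Proof. by case: z1 z2 => [? ?] [? ?]. Qed.
Lemma cImD z1 z2 : complex.Im (z1 + z2) = complex.Im z1 + complex.Im z2.
Proof. by case: z1 z2 => [? ?] [? ?]. Qed.
Lemma cReN z : complex.Re (- z) = - complex.Re z.
Proof. by case: z => [? ?]. Qed.
Lemma cImN z : complex.Im (- z) = - complex.Im z.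
Proof. by case: z => [? ?]. Qed.
Lemma cReM z1 z2 : complex.Re (z1 * z2) =
  complex.Re z1 * complex.Re z2 - complex.Im z1 * complex.Im z2.
Proof. by case: z1 z2 => [? ?] [? ?]. Qed.
Lemma cImM z1 z2 : complex.Im (z1 * z2) =
  complex.Re z1 * complex.Im z2 + complex.Im z1 * complex.Re z2.
Proof. by case: z1 z2 => [? ?] [? ?]. Qed.

Lemma cReJ z : complex.Re (z^*)%C = complex.Re z.
Proof. by case: z. Qed.
Lemma cImJ z : complex.Im (z^*)%C = - complex.Im z.
Proof. by case: z. Qed.

Lemma normc_sqr z :
  Normc.normc z ^+ 2 = complex.Re z ^+ 2 + complex.Im z ^+ 2.
Proof. by case: z => [a b] /=; rewrite sqr_sqrtr// addr_ge0 ?sqr_ge0. Qed.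

Lemma normc_ge0 z : 0 <= Normc.normc z.
Proof. by case: z => a b; exact: sqrtr_ge0. Qed.

Lemma normc_ge_absRe z : `|complex.Re z| <= Normc.normc z.
Proof.
rewrite -(ler_pXn2r (_ : 0 < 2)%N)// ?nnegrE ?normc_ge0//.
by rewrite normc_sqr real_normK ?num_real// lerDl sqr_ge0.
Qed.

Lemma normc_ge_absIm z : `|complex.Im z| <= Normc.normc z.
Proof.
rewrite -(ler_pXn2r (_ : 0 < 2)%N)// ?nnegrE ?normc_ge0//.
by rewrite normc_sqr real_normK ?num_real// lerDr sqr_ge0.
Qed.

Lemma normc_le_absD z : Normc.normc z <= `|complex.Re z| + `|complex.Im z|.
Proof.
rewrite -(ler_pXn2r (_ : 0 < 2)%N)// ?nnegrE ?normc_ge0 ?addr_ge0//.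
rewrite normc_sqr -(real_normK (num_real (complex.Re z))).
rewrite -(real_normK (num_real (complex.Im z))).
have := mulr_ge0 (normr_ge0 (complex.Re z)) (normr_ge0 (complex.Im z)); nra.
Qed.

Lemma normc_real (r : R) : Normc.normc r%:C = `|r|.
Proof. by rewrite /= expr0n addr0 sqrtr_sqr. Qed.

Lemma normc_conj z : Normc.normc (z^*)%C = Normc.normc z.
Proof. by case: z => a b /=; rewrite sqrrN. Qed.

Lemma conjcM z1 z2 : ((z1 * z2)^*)%C = (z1^*)%C * (z2^*)%C.
Proof.
case: z1 z2 => [a b] [a' b']; apply/eqP; rewrite eq_complex /=.
by apply/andP; split; apply/eqP; ring.
Qed.

Lemma normc_i : Normc.normc 'i%C = 1 :> R.
Proof. by rewrite /Normc.normc /= expr0n /= add0r expr1n sqrtr1. Qed.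

Lemma normcB_le z1 z2 : Normc.normc (z1 - z2) <= Normc.normc z1 + Normc.normc z2.
Proof. by rewrite (le_trans (le_normcD _ _))// normcN. Qed.

(** The character [t |-> exp (- i t)]. *)
Definition echar (t : R) : R[i] := cos t -i* sin t.

Lemma echarD (s t : R) : echar (s + t) = echar s * echar t.
Proof.
rewrite /echar cosD sinD; apply/eqP; rewrite eq_complex/=.
by apply/andP; split; apply/eqP; ring.
Qed.

Lemma echarN (t : R) : echar (- t) = ((echar t)^*)%C.
Proof. by rewrite /echar cosN sinN /= opprK. Qed.

Lemma echar0 : echar 0 = 1.
Proof. by rewrite /echar cos0 sin0 oppr0. Qed.

Lemma normc_echar (t : R) : Normc.normc (echar t) = 1.
Proof. by rewrite /= sqrrN cos2Dsin2 sqrtr1. Qed.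

Lemma echar_taylor1 (t : R) : Normc.normc (echar t - 1) <= 2 * `|t|.
Proof.
rewrite (le_trans (normc_le_absD _))// cReD cImD cReN cImN /= subr0 normrN.
have := abs_cosB1_le t; have := abs_sin_le t; lra.
Qed.

Lemma echar_taylor2 (t : R) :
  Normc.normc (echar t - 1 + 'i%C * t%:C) <= 2 * t ^+ 2.
Proof.
rewrite (le_trans (normc_le_absD _))// !cReD !cImD cReM cImM cReN cImN /=.
rewrite [X in `|X| + _](_ : _ = cos t - 1); last by ring.
rewrite [X in _ + `|X|](_ : _ = - (sin t - t)); last by ring.
rewrite normrN; have := abs_cosB1_le2 t; have := abs_sinBid_le2 t; lra.
Qed.

End complex_facts.

#[global] Arguments Normc.normc : simpl never.
#[global] Arguments echar : simpl never.

Section cmeasurable.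
Context {R : realType} {disp} {T : measurableType disp}.
Implicit Types u v : T -> R[i].

Definition cmeasurable u := measurable_fun setT (fun x => complex.Re (u x)) /\
  measurable_fun setT (fun x => complex.Im (u x)).

Lemma cmeasurable_real (f : T -> R) : measurable_fun setT f -> cmeasurable (fun
  x => (f x)%:C).
Proof. by move=> mf; split. Qed.

Lemma cmeasurable_cst (c : R[i]) : cmeasurable (fun=> c).
Proof. by split. Qed.

Lemma cmeasurableD u v : cmeasurable u -> cmeasurable v -> cmeasurable (fun x
  => u x + v x).
Proof.
move=> [ru iu] [rv iv]; split.
  by under eq_fun do rewrite cReD; exact: measurable_funD.
by under eq_fun do rewrite cImD; exact: measurable_funD.
Qed.

Lemma cmeasurableN u : cmeasurable u -> cmeasurable (fun x => - u x).
Proof.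
move=> [ru iu]; split.
  by under eq_fun do rewrite cReN; exact: measurable_funN.
by under eq_fun do rewrite cImN; exact: measurable_funN.
Qed.

Lemma cmeasurableB u v : cmeasurable u -> cmeasurable v -> cmeasurable (fun x
  => u x - v x).
Proof. by move=> mu mv; apply: cmeasurableD => //; exact: cmeasurableN. Qed.

Lemma cmeasurableM u v : cmeasurable u -> cmeasurable v -> cmeasurable (fun x
  => u x * v x).
Proof.
move=> [ru iu] [rv iv]; split.
  under eq_fun do rewrite cReM.
  by apply: measurable_funB; exact: measurable_funM.
under eq_fun do rewrite cImM.
by apply: measurable_funD; exact: measurable_funM.
Qed.

Lemma cmeasurable_conj u : cmeasurable u -> cmeasurable (fun x => (u x)^*%C).
Proof.
move=> [ru iu]; split.
  by under eq_fun do rewrite cReJ.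
under eq_fun do rewrite cImJ.
exact: measurable_funN.
Qed.

Lemma cmeasurable_echar (f : T -> R) : measurable_fun setT f -> cmeasurable
  (fun x => echar (f x)).
Proof.
move=> mf; split => /=.
  by apply: measurableT_comp => //; apply: continuous_measurable_fun; exact:
    continuous_cos.
apply: measurable_funN.
by apply: measurableT_comp => //; apply: continuous_measurable_fun; exact:
  continuous_sin.
Qed.

Lemma measurable_normc u : cmeasurable u -> measurable_fun setT (fun x =>
  Normc.normc (u x)).
Proof.
move=> [ru iu].
have -> : (fun x => Normc.normc (u x)) =
    (fun x => (complex.Re (u x) ^+ 2 + complex.Im (u x) ^+ 2) `^ 2^-1).
  by apply/funext => x; rewrite powR12_sqrt ?addr_ge0 ?sqr_ge0//; case: (u x).
apply: (measurableT_comp (measurable_powR _)).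
by apply: measurable_funD; exact: measurable_funX.
Qed.

Lemma measurable_sqr_normc u : cmeasurable u -> measurable_fun setT (fun x =>
  Normc.normc (u x) ^+ 2).
Proof. by move=> mu; apply: measurable_funX; exact: measurable_normc. Qed.

End cmeasurable.

Lemma cmeasurable_comp {R : realType} {d1 d2} {T1 : measurableType d1} {T2 :
  measurableType d2}
  (u : T2 -> R[i]) (f : T1 -> T2) :
  cmeasurable u -> measurable_fun setT f -> cmeasurable (u \o f).
Proof.
by move=> [ru iu] mf; split; [exact: (measurableT_comp ru)|exact:
  (measurableT_comp iu)].
Qed.

Section integrals.
Context {R : realType} {d : nat}.
Local Notation mu := (@lebesgue_rV R d).
Local Notation T := 'rV[R]_d.
Implicit Types (f g : T -> R) (u v : T -> R[i]).

Definition rintegrable f := mu.-integrable setT (EFin \o f).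

Lemma rintegrable_meas f : rintegrable f -> measurable_fun setT f.
Proof. by move=> /measurable_int/measurable_EFinP. Qed.

Lemma rintegrable_le f g : measurable_fun setT f -> rintegrable g -> (forall x,
  `|f x| <= g x) -> rintegrable f.
Proof.
move=> mf ig fg; apply: (@le_integrable _ _ _ _ _ measurableT _ (EFin \o g)) => //.
  exact/measurable_EFinP.
by move=> x _; rewrite /= lee_fin (le_trans (fg x))// ler_norm.
Qed.

Lemma rintegrableD f g : rintegrable f -> rintegrable g -> rintegrable (fun x
  => f x + g x).
Proof. by move=> hf hg; have := integrableD measurableT hf hg; apply:
  eq_integrable. Qed.

Lemma rintegrableZ (c : R) f : rintegrable f -> rintegrable (fun x => c * f x).
Proof. by move=> hf; have := integrableZl measurableT c hf; apply: eq_integrable. Qed.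

Lemma rintegrableN f : rintegrable f -> rintegrable (fun x => - f x).
Proof. by move=> /(rintegrableZ (-1)); apply: eq_integrable => // x _ /=;
  rewrite mulN1r. Qed.

Lemma rintegrable_wt_int : rintegrable (@wt_int R d).
Proof. exact: integrable_wt_int. Qed.

Lemma rintegrable_shift f (c : T) : rintegrable f -> rintegrable (fun x => f (x + c)).
Proof.
move=> hf; have mf := rintegrable_meas hf; apply/integrableP; split.
  by apply/measurable_EFinP; apply: measurableT_comp => //; exact: measurable_shift.
rewrite (ge0_integral_shift c (f := fun x => `|(f x)%:E|%E))//.
  by case/integrableP : hf.
by apply: measurableT_comp => //; exact/measurable_EFinP.
Qed.

Lemma Rintegral_shift f (c : T) : rintegrable f ->
  \int[mu]_x f (x + c) = \int[mu]_x f x.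
Proof.
move=> hf; rewrite /Rintegral; congr fine.
have mf : measurable_fun setT (EFin \o f) by exact: measurable_int hf.
rewrite [LHS]integralE [RHS]integralE; congr (_ - _)%E.
  rewrite -[RHS](ge0_integral_shift c (measurable_funepos mf) (fun x =>
    funepos_ge0 _ x)).
  by apply: eq_integral => x _; rewrite !funeposE.
rewrite -[RHS](ge0_integral_shift c (measurable_funeneg mf) (fun x => funeneg_ge0 _ x)).
by apply: eq_integral => x _; rewrite !funenegE.
Qed.

Lemma Rintegral_le f g : rintegrable f -> rintegrable g -> (forall x, f x <= g x) ->
  \int[mu]_x f x <= \int[mu]_x g x.
Proof. by move=> hf hg fg; apply: le_Rintegral. Qed.

Lemma abs_Rintegral_le f g : measurable_fun setT f -> rintegrable g ->
  (forall x, `|f x| <= g x) -> `|\int[mu]_x f x| <= \int[mu]_x g x.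
Proof.
move=> mf hg fg; have hf := rintegrable_le mf hg fg.
rewrite (le_trans (le_normr_Rintegral measurableT hf))//.
apply: Rintegral_le => //; apply: (rintegrable_le _ hg).
  exact: measurableT_comp.
by move=> x; rewrite normr_id.
Qed.

Definition cintegrable u := rintegrable (fun x => complex.Re (u x)) /\
  rintegrable (fun x => complex.Im (u x)).

Lemma cintegrable_meas u : cintegrable u -> cmeasurable u.
Proof. by move=> [/rintegrable_meas ? /rintegrable_meas ?]; split. Qed.

Lemma cintegrable_le u g : cmeasurable u -> rintegrable g -> (forall x,
  Normc.normc (u x) <= g x) -> cintegrable u.
Proof.
move=> [ru iu] ig ug; split; apply: (rintegrable_le _ ig) => // x.
  exact: le_trans (normc_ge_absRe _) (ug x).
exact: le_trans (normc_ge_absIm _) (ug x).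
Qed.

Lemma cintegrable_real f : rintegrable f -> cintegrable (fun x => (f x)%:C).
Proof.
move=> hf; split => //=; have := rintegrableZ 0 hf.
by apply: eq_integrable => // x _ /=; rewrite mul0r.
Qed.

Lemma rintegrable_normc u : cintegrable u -> rintegrable (fun x => Normc.normc (u x)).
Proof.
move=> [ru iu].
have h : rintegrable (fun x => `|complex.Re (u x)| + `|complex.Im (u x)|).
  apply: rintegrableD; [move: ru|move: iu] => /[dup] /rintegrable_meas m h.
  - apply/integrableP; split; first by apply/measurable_EFinP; exact: measurableT_comp.
    by under eq_integral do rewrite /= normr_id; case/integrableP : h.
  - apply/integrableP; split; first by apply/measurable_EFinP; exact: measurableT_comp.
    by under eq_integral do rewrite /= normr_id; case/integrableP : h.
apply: (rintegrable_le _ h) => [|x].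
  by apply: measurable_normc; exact: cintegrable_meas.
by rewrite ger0_norm ?normc_ge0// normc_le_absD.
Qed.

Lemma cintegrableP u : cmeasurable u -> rintegrable (fun x => Normc.normc (u
  x)) -> cintegrable u.
Proof. by move=> mu h; exact: (cintegrable_le mu h). Qed.

Lemma cintegrableD u v : cintegrable u -> cintegrable v -> cintegrable (fun x
  => u x + v x).
Proof.
move=> [ru iu] [rv iv]; split.
  by under eq_fun do rewrite cReD; exact: rintegrableD.
by under eq_fun do rewrite cImD; exact: rintegrableD.
Qed.

Lemma cintegrableZ (c : R[i]) u : cintegrable u -> cintegrable (fun x => c * u x).
Proof.
move=> hu; apply: cintegrableP.
  by apply: cmeasurableM; [exact: cmeasurable_cst|exact: cintegrable_meas].
under eq_fun do rewrite Normc.normcM; apply: rintegrableZ; exact: rintegrable_normc.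
Qed.

Lemma cintegrableB u v : cintegrable u -> cintegrable v -> cintegrable (fun x
  => u x - v x).
Proof.
move=> hu hv; have := cintegrableD hu (cintegrableZ (-1) hv).
by under eq_fun do rewrite mulN1r.
Qed.

Lemma cintegrable_shift u (c : T) : cintegrable u -> cintegrable (fun x => u (x + c)).
Proof. by move=> [/rintegrable_shift ru /rintegrable_shift iu]; split. Qed.

Lemma cintegralD u v : cintegrable u -> cintegrable v ->
  cintegral (fun x => u x + v x) = cintegral u + cintegral v.
Proof.
move=> [ru iu] [rv iv]; apply/eqP; rewrite eq_complex /=; apply/andP; split; apply/eqP.
  by under eq_Rintegral do rewrite cReD; rewrite RintegralD.
by under eq_Rintegral do rewrite cImD; rewrite RintegralD.
Qed.

Lemma cintegralZ (c : R[i]) u : cintegrable u ->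
  cintegral (fun x => c * u x) = c * cintegral u.
Proof.
move=> [ru iu]; case: c => a b.
apply/eqP; rewrite eq_complex /=; apply/andP; split; apply/eqP.
  under eq_Rintegral do rewrite cReM /=.
  rewrite RintegralB//; [|exact: rintegrableZ|exact: rintegrableZ].
  by rewrite !RintegralZl.
under eq_Rintegral do rewrite cImM /=.
rewrite RintegralD//; [|exact: rintegrableZ|exact: rintegrableZ].
by rewrite !RintegralZl.
Qed.

Lemma cintegralB u v : cintegrable u -> cintegrable v ->
  cintegral (fun x => u x - v x) = cintegral u - cintegral v.
Proof.
move=> hu hv; have -> : (fun x => u x - v x) = (fun x => u x + (-1) * v x).
  by apply/funext => x; rewrite mulN1r.
by rewrite cintegralD//; [rewrite cintegralZ// mulN1r|exact: cintegrableZ].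
Qed.

Lemma eq_cintegral u v : u =1 v -> cintegral u = cintegral v.
Proof. by move=> /funext ->. Qed.

Lemma cintegral_shift u (c : T) : cintegrable u ->
  cintegral (fun x => u (x + c)) = cintegral u.
Proof.
move=> [ru iu]; congr Complex.
  exact: (Rintegral_shift c ru).
exact: (Rintegral_shift c iu).
Qed.

Lemma cintegral_conj u : cintegrable u -> cintegral (fun x => (u x)^*%C) =
  ((cintegral u)^*)%C.
Proof.
move=> [ru iu]; congr Complex.
  by apply: eq_Rintegral => x _; case: (u x).
rewrite -mulN1r -RintegralZl//.
by apply: eq_Rintegral => x _; rewrite mulN1r; case: (u x).
Qed.

(** Bounding the two components separately costs a factor 2, which is harmless
    since only orders of magnitude matter below. *)
Lemma normc_cintegral_le u g : cmeasurable u -> rintegrable g ->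
  (forall x, Normc.normc (u x) <= g x) ->
  Normc.normc (cintegral u) <= 2 * \int[mu]_x g x.
Proof.
move=> [ru iu] ig ug; rewrite (le_trans (normc_le_absD _))//=.
have h1 := abs_Rintegral_le ru ig (fun x => le_trans (normc_ge_absRe _) (ug x)).
have h2 := abs_Rintegral_le iu ig (fun x => le_trans (normc_ge_absIm _) (ug x)).
by lra.
Qed.

Lemma cintegral_ae u v : cmeasurable u -> cmeasurable v -> ae_eqC u v ->
  cintegral u = cintegral v.
Proof.
move=> [ru iu] [rv iv] uv; congr Complex; rewrite /Rintegral; congr fine.
  apply: ae_eq_integral => //; [exact/measurable_EFinP|exact/measurable_EFinP|].
  by move: uv; apply: filterS => x /= -> _.
apply: ae_eq_integral => //; [exact/measurable_EFinP|exact/measurable_EFinP|].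
by move: uv; apply: filterS => x /= -> _.
Qed.

Lemma rintegrable_Fubini (h : T * T -> R) f g : measurable_fun setT h ->
  rintegrable f -> rintegrable g -> (forall x y, `|h (x, y)| <= f x * g y) ->
  \int[mu]_x \int[mu]_y h (x, y) = \int[mu]_y \int[mu]_x h (x, y).
Proof.
move=> mh hf hg hfg.
have mhx x : measurable_fun setT (fun y => h (x, y)).
  by apply: (measurableT_comp mh); exact: measurable_pair1.
have mhy y : measurable_fun setT (fun x => h (x, y)).
  by apply: (measurableT_comp mh); exact: measurable_pair2.
have ih : (mu \x mu)%E.-integrable setT (EFin \o h).
  apply/integrable12ltyP; first exact/measurable_EFinP.
  apply: (@le_lt_trans _ _ (\int[mu]_x (`|f x| * \int[mu]_y `|g y|)%:E)%E).
    apply: ge0_le_integral => //.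
    - by move=> x _; exact: integral_ge0.
    - apply: (measurable_fun_fubini_tonelli_F (fun p => `|(h p)%:E|%E)) => //.
      by apply: measurableT_comp => //; exact/measurable_EFinP.
    - apply/measurable_EFinP; apply: measurable_funM => //.
      by apply: measurableT_comp => //; exact: rintegrable_meas hf.
    - move=> x _; rewrite EFinM.
      have -> : (\int[mu]_y `|g y|)%:E = (\int[mu]_y `|g y|%:E)%E.
        by rewrite /Rintegral fineK//; apply: integrable_fin_num => //; exact:
          integrable_norm.
      rewrite -ge0_integralZl_EFin//; last first.
        by apply/measurable_EFinP; apply: measurableT_comp => //; exact:
          rintegrable_meas hg.
      apply: ge0_le_integral => //.
      + by apply: measurableT_comp => //; exact/measurable_EFinP.
      + apply/measurable_EFinP; apply: measurable_funM => //.
        by apply: measurableT_comp => //; exact: rintegrable_meas hg.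
      + move=> y _; rewrite /= lee_fin (le_trans (hfg x y))// (le_trans (ler_norm _))//.
        by rewrite normrM.
  rewrite (eq_integral (fun x => `|f x|%:E * (\int[mu]_y `|g y|)%:E)%E); last first.
    by move=> x _; rewrite EFinM.
  have f1 : measurable_fun setT (fun x => `|f x|%:E).
    by apply/measurable_EFinP; apply: measurableT_comp => //; exact:
      rintegrable_meas hf.
  rewrite ge0_integralZr// ?lee_fin ?Rintegral_ge0//.
  case/integrableP : hf => _ /= hf.
  apply: lte_mul_pinfty; first exact: integral_ge0.
    by rewrite ge0_fin_numE//; exact: integral_ge0.
  by rewrite ltry.
have := Fubini ih.
have bx x : rintegrable (fun y => h (x, y)).
  by apply: (rintegrable_le (mhx x) (rintegrableZ (f x) hg)).
have by' y : rintegrable (fun x => h (x, y)).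
  by apply: (rintegrable_le (mhy y) (rintegrableZ (g y) hf)) => x; rewrite mulrC.
have ex x : (\int[mu]_y (EFin \o h) (x, y) = (\int[mu]_y h (x, y))%:E)%E.
  by rewrite /Rintegral fineK//; exact: integrable_fin_num (bx x).
have ey y : (\int[mu]_x (EFin \o h) (x, y) = (\int[mu]_x h (x, y))%:E)%E.
  by rewrite /Rintegral fineK//; exact: integrable_fin_num (by' y).
move=> FU; rewrite /Rintegral; congr fine.
rewrite (eq_integral (fun x => (\int[mu]_y (EFin \o h) (x, y))%E)); last first.
  by move=> x _; rewrite ex.
rewrite [RHS](eq_integral (fun y => (\int[mu]_x (EFin \o h) (x, y))%E)); last first.
  by move=> y _; rewrite ey.
exact: FU.
Qed.

Lemma measurable_partial {disp} {S : measurableType disp} (h : S * T -> R) :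
  measurable_fun setT h -> (forall x, rintegrable (fun y => h (x, y))) ->
  measurable_fun setT (fun x => \int[mu]_y h (x, y)).
Proof.
move=> mh bx.
have -> : (fun x => \int[mu]_y h (x, y)) =
  fun x => fine (\int[mu]_y (EFin \o h)^\+ (x, y))%E - fine (\int[mu]_y (EFin
    \o h)^\- (x, y))%E.
  apply/funext => x; rewrite /Rintegral integralE.
  rewrite fineB; [|by apply: integrable_pos_fin_num => //; exact: bx|by apply:
    integrable_neg_fin_num => //; exact: bx].
  congr (fine _ - fine _); apply: eq_integral => y _.
    by rewrite !funeposE.
  by rewrite !funenegE.
have mh' : measurable_fun setT (EFin \o h) by exact/measurable_EFinP.
apply: measurable_funB.
- apply: (measurableT_comp (fine_measurable measurableT)).
  by apply: measurable_fun_fubini_tonelli_F => //; exact: measurable_funepos.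
- apply: (measurableT_comp (fine_measurable measurableT)).
  by apply: measurable_fun_fubini_tonelli_F => //; exact: measurable_funeneg.
Qed.

Lemma cmeasurable_partial {disp} {S : measurableType disp} (h : S * T -> R[i]) :
  cmeasurable h -> (forall x, cintegrable (fun y => h (x, y))) ->
  cmeasurable (fun x => cintegral (fun y => h (x, y))).
Proof.
move=> [rh ih] bx; split => /=.
  exact: (measurable_partial rh (fun x => (bx x).1)).
exact: (measurable_partial ih (fun x => (bx x).2)).
Qed.

Lemma cintegrable_Fubini (h : T * T -> R[i]) f g : cmeasurable h ->
  rintegrable f -> rintegrable g -> (forall x y, Normc.normc (h (x, y)) <= f x * g y) ->
  cintegral (fun x => cintegral (fun y => h (x, y))) =
  cintegral (fun y => cintegral (fun x => h (x, y))).
Proof.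
move=> [rh ih] hf hg hfg; apply/eqP; rewrite eq_complex /=.
apply/andP; split; apply/eqP.
  apply: (rintegrable_Fubini rh hf hg) => x y; exact: le_trans (normc_ge_absRe _) _.
apply: (rintegrable_Fubini ih hf hg) => x y; exact: le_trans (normc_ge_absIm _) _.
Qed.

Lemma rintegrable_cvg (h : nat -> T -> R) f g : (forall n, measurable_fun setT (h n)) ->
  measurable_fun setT f -> rintegrable g ->
  (forall n x, `|h n x| <= g x) ->
  (forall x, h n x @[n --> \oo] --> f x) ->
  \int[mu]_x h n x @[n --> \oo] --> \int[mu]_x f x.
Proof.
move=> mh mf ig hg hf.
have eh n : (\int[mu]_x (h n x)%:E = (\int[mu]_x h n x)%:E)%E.
  by rewrite /Rintegral fineK//; apply: integrable_fin_num => //; exact: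
    (rintegrable_le (mh n) ig).
have hfE x : (h n x)%:E @[n --> \oo] --> (f x)%:E.
  by apply: cvg_EFin; [exact: nearW|exact: hf].
have [if_ _] := @dominated_convergence _ _ _ mu setT measurableT
  (fun n x => (h n x)%:E) (EFin \o f) (EFin \o g)
  (fun n => (measurable_EFinP _ _).2 (mh n)) ((measurable_EFinP _ _).2 mf)
  (aeW _ (fun x _ => hfE x)) ig
  (aeW _ (fun x n _ => hg n x)).
have -> : (\int[mu]_x (EFin \o f) x = (\int[mu]_x f x)%:E)%E.
  by rewrite /Rintegral fineK//; exact: integrable_fin_num.
by move=> /fine_cvg; apply: cvg_trans; apply: near_eq_cvg; apply: nearW => n /=.
Qed.

Lemma cintegral_cvg (h : nat -> T -> R[i]) u g : (forall n, cmeasurable (h n)) ->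
  cmeasurable u -> rintegrable g ->
  (forall n x, Normc.normc (h n x) <= g x) -> (forall x, Normc.normc (u x) <= g x) ->
  (forall x, Normc.normc (h n x - u x) @[n --> \oo] --> 0) ->
  Normc.normc (cintegral (h n) - cintegral u) @[n --> \oo] --> 0.
Proof.
move=> mh mu' ig hg ug hu.
have ih n : cintegrable (h n) := cintegrable_le (mh n) ig (hg n).
have iu : cintegrable u := cintegrable_le mu' ig ug.
have i2 : rintegrable (fun x => 2 * g x) by exact: rintegrableZ.
have H : \int[mu]_x Normc.normc (h n x - u x) @[n --> \oo] --> \int[mu]_x (0 : R).
  apply: (rintegrable_cvg _ _ i2) => // [n|n x].
    by apply: measurable_normc; exact: cmeasurableB.
  rewrite ger0_norm ?normc_ge0// (le_trans (normcB_le _ _))//.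
  by have := hg n x; have := ug x; lra.
have {}H : 2 * \int[mu]_x Normc.normc (h n x - u x) @[n --> \oo] --> 0.
  rewrite -(mulr0 2); apply: cvgM; first exact: cvg_cst.
  move: H.
  by rewrite (_ : \int[mu]_x 0 = 0)// /Rintegral integral0.
apply: (squeeze_cvgr _ (cvg_cst 0) H); apply: nearW => n /=.
rewrite normc_ge0/= -cintegralB//.
apply: normc_cintegral_le => //; first exact: cmeasurableB.
by apply: rintegrable_normc; exact: cintegrableB.
Qed.

End integrals.

Section ae_facts.
Context {R : realType} {d : nat}.
Local Notation mu := (@lebesgue_rV R d).
Local Notation T := 'rV[R]_d.

Lemma rintegrable_ae (f g : T -> R) : measurable_fun setT f -> rintegrable g ->
  {ae mu, forall x, f x = g x} -> rintegrable f.
Proof.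
move=> mf ig fg; apply/integrableP; split; first exact/measurable_EFinP.
case/integrableP : (ig) => mg; apply: le_lt_trans.
rewrite le_eqVlt; apply/orP; left; apply/eqP; apply: ae_eq_integral => //.
- by apply: measurableT_comp => //; exact/measurable_EFinP.
- exact: measurableT_comp.
by move: fg; apply: filterS => x /= -> _.
Qed.

Lemma cintegrable_ae (u v : T -> R[i]) : cmeasurable u -> cintegrable v ->
  ae_eqC u v -> cintegrable u.
Proof.
move=> [ru iu] [rv iv] uv; split.
  by refine (rintegrable_ae ru rv _); move: uv; apply: filterS => x /= ->.
by refine (rintegrable_ae iu iv _); move: uv; apply: filterS => x /= ->.
Qed.

Lemma Rintegral_ae (f g : T -> R) : measurable_fun setT f -> measurable_fun setT g ->
  {ae mu, forall x, f x = g x} -> \int[mu]_x f x = \int[mu]_x g x.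
Proof.
move=> mf mg fg; rewrite /Rintegral; congr fine; apply: ae_eq_integral => //.
- exact/measurable_EFinP.
- exact/measurable_EFinP.
by move: fg; apply: filterS => x /= -> _.
Qed.

End ae_facts.

(** * Square-integrable functions and the Fourier pairing *)

Section L2_facts.
Context {R : realType} {d : nat}.
Local Notation mu := (@lebesgue_rV R d).
Local Notation T := 'rV[R]_d.
Implicit Types (u v w : T -> R[i]).

Lemma L2_cmeasurable u : L2 u -> cmeasurable u.
Proof. by move=> [/sub_Lfun_mfun + /sub_Lfun_mfun]; rewrite !inE. Qed.

Lemma L2_rintegrable u : L2 u -> rintegrable (fun x => Normc.normc (u x) ^+ 2).
Proof.
move=> [/Lfun2_integrable_sqr ru /Lfun2_integrable_sqr iu].
have := rintegrableD ru iu; apply: eq_integrable => // x _ /=.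
by rewrite normc_sqr.
Qed.

Lemma L2_of_rintegrableegrable u : cmeasurable u -> rintegrable (fun x =>
  Normc.normc (u x) ^+ 2) -> L2 u.
Proof.
move=> [ru iu] i2.
have H (f : T -> R) : measurable_fun setT f -> (forall x, `|f x| <= Normc.normc
  (u x)) ->
    f \in Lfun mu 2%:E.
  move=> mf fu; rewrite inE; apply/andP; split; rewrite inE//=.
  rewrite /finite_norm unlock /=; apply: poweR_lty.
  have if2 : rintegrable (fun x => f x ^+ 2).
    apply: (rintegrable_le _ i2); first exact: measurable_funX.
    by move=> x; rewrite normrX lerXn2r// ?nnegrE ?normc_ge0.
  case/integrableP : if2 => _; apply: le_lt_trans.
  apply: ge0_le_integral => //.
  - apply/measurable_EFinP; apply: (measurableT_comp (measurable_powR _)).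
    exact: measurableT_comp.
  - by apply/measurable_EFinP; apply: measurableT_comp => //; exact: measurable_funX.
  - by move=> x _; rewrite lee_fin powR_mulrn// normrX.
split; apply: H => // x; [exact: normc_ge_absRe|exact: normc_ge_absIm].
Qed.

Lemma L2norm_le u e : cmeasurable u -> 0 <= e -> (L2norm u <= e%:E)%E ->
  rintegrable (fun x => Normc.normc (u x) ^+ 2) /\
  \int[mu]_x (Normc.normc (u x) ^+ 2) <= e ^+ 2.
Proof.
move=> mu' e0 ue.
have : (\int[mu]_x ((Normc.normc (u x) ^+ 2)%:E) <= (e ^+ 2)%:E)%E.
  have -> : (\int[mu]_x ((Normc.normc (u x) ^+ 2)%:E) = L2norm u `^ 2)%E.
    rewrite /L2norm poweR_Lnorm//; apply: eq_integral => x _.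
    by rewrite /= powR_mulrn ?normr_ge0// ger0_norm ?normc_ge0.
  apply: (@le_trans _ _ (e%:E `^ 2)%E).
    by apply: gt0_ler_poweR => //; rewrite in_itv/= leey ?Lnorm_ge0// lee_fin e0.
  by rewrite poweR_EFin powR_mulrn.
move=> H.
have i2 : rintegrable (fun x => Normc.normc (u x) ^+ 2).
  apply/integrableP; split; first by apply/measurable_EFinP; exact:
    measurable_sqr_normc.
  under eq_integral => x _ do rewrite gee0_abs ?lee_fin ?sqr_ge0//.
  by rewrite (le_lt_trans H)// ltry.
split => //; rewrite -lee_fin (le_trans _ H)//.
rewrite /Rintegral fineK//; exact: integrable_fin_num.
Qed.

Lemma le_sqrD1 (a : R) : 0 <= a -> a <= a ^+ 2 + 1.
Proof. nra. Qed.

(** Since [|u| <= |u| ^ 2 + 1] and [wt_int <= 1]. *)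
Lemma rintegrable_normc_wt u : L2 u -> rintegrable (fun x => Normc.normc (u x)
  * wt_int x).
Proof.
move=> u2; have mu' := L2_cmeasurable u2.
apply: (rintegrable_le _ (rintegrableD (L2_rintegrable u2) (@rintegrable_wt_int
  R d))) => [|x].
  by apply: measurable_funM; [exact: measurable_normc|exact: measurable_wt_int].
have n0 := normc_ge0 (u x); have w0 := wt_int_ge0 x; have w1 := wt_int_le1 x.
rewrite ger0_norm ?mulr_ge0//.
nra.
Qed.

(** In particular balls have finite measure. *)
Lemma indic_eball_le (r : R) (x : T) : 0 <= r ->
  \1_(eball r) x <= (1 + d%:R * r) ^+ (2 * d) * wt_int x.
Proof.
move=> r0; rewrite indicE; case: (boolP (x \in _)) => [|]; last first.
  by move=> _; rewrite mulr_ge0 ?wt_int_ge0// exprn_ge0// addr_ge0// mulr_ge0.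
rewrite inE /eball/= => xr; rewrite /wt_int ler_pdivlMr ?exprn_gt0 ?wt_gt0// mul1r.
rewrite lerXn2r ?nnegrE ?(ltW (wt_gt0 _))//; first by rewrite addr_ge0// mulr_ge0.
rewrite lerD2l (le_trans (norm1_le_enorm x))// ler_wpM2l//; exact: ltW.
Qed.

Lemma measurable_eball (r : R) : measurable (eball r : set T).
Proof.
have -> : eball r = (fun x : T => dotp x x `^ 2^-1) @^-1` `]-oo, r[.
  apply/seteqP; split => x; rewrite /eball /= in_itv /= /enorm;
    by rewrite powR12_sqrt ?dotp_ge0.
rewrite -[X in measurable X]setTI.
apply: (measurableT_comp (measurable_powR _) measurable_dotpp) => //.
Qed.

Lemma measurable_indic_eball (r : R) : measurable_fun setT (\1_(eball r) : T -> R).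
Proof. by apply: measurable_indic; exact: measurable_eball. Qed.

Lemma rintegrable_indic_eball (r : R) : 0 <= r -> rintegrable (\1_(eball r) : T -> R).
Proof.
move=> r0; apply: (rintegrable_le _ (rintegrableZ ((1 + d%:R * r) ^+ (2 * d))
  (@rintegrable_wt_int R d))).
  exact: measurable_indic_eball.
by move=> x; rewrite ger0_norm// indic_eball_le.
Qed.

Lemma normc_indic_le (r : R) u x :
  Normc.normc (u x * (\1_(eball r) x)%:C) <= Normc.normc (u x).
Proof.
rewrite Normc.normcM normc_real ger0_norm// ler_piMr ?normc_ge0// indicE; case:
  (_ \in _) => /=; lra.
Qed.

Lemma cmeasurable_trunc (r : R) u : cmeasurable u -> cmeasurable (fun x => u x
  * (\1_(eball r) x)%:C).
Proof.
by move=> mu'; apply: cmeasurableM => //; apply: cmeasurable_real; exact: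
  measurable_indic_eball.
Qed.

Lemma cintegrable_trunc (r : R) u : 0 <= r -> L2 u -> cintegrable (fun x => u x
  * (\1_(eball r) x)%:C).
Proof.
move=> r0 u2; apply: (@cintegrable_le _ _ _ _ _ (rintegrableD (L2_rintegrable
  u2) (rintegrable_indic_eball r0))).
  by apply: cmeasurable_trunc; exact: L2_cmeasurable.
move=> x; rewrite Normc.normcM normc_real ger0_norm// indicE.
have := le_sqrD1 (normc_ge0 (u x)).
by case: (_ \in _) => /=; rewrite ?mulr1// mulr0 addr0 sqr_ge0.
Qed.

End L2_facts.

Section fourier.
Context {R : realType} {d : nat}.
Local Notation mu := (@lebesgue_rV R d).
Local Notation T := 'rV[R]_d.
Implicit Types (u v w g : T -> R[i]) (U : T -> R[i]).

(** The transform without its normalising constant, see [fourier1E]. *)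
Definition ft u (xi : T) : R[i] := cintegral (fun x => u x * echar (dotp x xi)).

Definition fourier_cst : R := (2 * pi) `^ (- (d%:R / 2)).

Lemma fourier_cst_gt0 : 0 < fourier_cst.
Proof. by rewrite powR_gt0// mulr_gt0// pi_gt0. Qed.

Lemma fourier1E u xi : fourier1 u xi = fourier_cst%:C * ft u xi.
Proof. by []. Qed.

Lemma normcM_echar (z : R[i]) t : Normc.normc (z * echar t) = Normc.normc z.
Proof. by rewrite Normc.normcM normc_echar mulr1. Qed.

Lemma cintegrable_char u xi : cintegrable u -> cintegrable (fun x => u x *
  echar (dotp x xi)).
Proof.
move=> iu; apply: (cintegrable_le _ (rintegrable_normc iu)) => [|x]; last by
  rewrite normcM_echar.
apply: cmeasurableM; first exact: cintegrable_meas.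
by apply: cmeasurable_echar; exact: measurable_dotpl.
Qed.

Lemma cmeasurable_ft u : cintegrable u -> cmeasurable (ft u).
Proof.
move=> iu; apply: (cmeasurable_partial (h := fun p : T * T => u p.2 * echar
  (dotp p.2 p.1))).
  apply: cmeasurableM; first by apply: (cmeasurable_comp (u := u)); [exact:
    cintegrable_meas|exact: measurable_snd].
  apply: cmeasurable_echar.
  by under eq_fun do rewrite dotpC; exact: measurable_dotp2.
by move=> x /=; exact: cintegrable_char.
Qed.

Lemma ft_bounded u xi : cintegrable u ->
  Normc.normc (ft u xi) <= 2 * \int[mu]_x Normc.normc (u x).
Proof.
move=> iu; apply: normc_cintegral_le; [exact: cintegrable_meas
  (cintegrable_char _ _)|exact: rintegrable_normc|].
by move=> x; rewrite normcM_echar.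
Qed.

Lemma ftZ (c : R[i]) u xi : cintegrable u -> ft (fun x => c * u x) xi = c * ft u xi.
Proof.
move=> iu; rewrite /ft -cintegralZ; last exact: cintegrable_char.
by apply: eq_cintegral => x; rewrite mulrA.
Qed.

Lemma ft_modulate u xi z :
  ft (fun x => u x * echar (dotp x z)) xi = ft u (xi + z).
Proof.
apply: eq_cintegral => x; rewrite -mulrA -echarD dotpDr addrC; congr (_ * _).
Qed.

(** By Fubini's theorem, the kernel [echar (dotp x xi)] being symmetric. *)
Lemma ft_pairing u v : cintegrable u -> cintegrable v ->
  cintegral (fun xi => ft u xi * v xi) = cintegral (fun x => u x * ft v x).
Proof.
move=> iu iv.
pose h (p : T * T) := u p.2 * v p.1 * echar (dotp p.2 p.1).
have mh : cmeasurable h.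
  apply: cmeasurableM; first apply: cmeasurableM.
  - by apply: (cmeasurable_comp (u := u)); [exact: cintegrable_meas|exact:
    measurable_snd].
  - by apply: (cmeasurable_comp (u := v)); [exact: cintegrable_meas|exact:
    measurable_fst].
  - by apply: cmeasurable_echar; under eq_fun do rewrite dotpC; exact: measurable_dotp2.
have hb x y : Normc.normc (h (x, y)) <= Normc.normc (v x) * Normc.normc (u y).
  by rewrite /h normcM_echar Normc.normcM mulrC.
have := cintegrable_Fubini mh (rintegrable_normc iv) (rintegrable_normc iu) hb.
rewrite /h /= => H; transitivity (cintegral (fun x => cintegral (fun y => u y *
  v x * echar (dotp y x)))).
  apply: eq_cintegral => x; rewrite mulrC /ft -cintegralZ; last exact: cintegrable_char.
  by apply: eq_cintegral => y; ring.
rewrite H; apply: eq_cintegral => y; rewrite /ft -cintegralZ; last exact: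
  cintegrable_char.
by apply: eq_cintegral => x; rewrite dotpC mulrA.
Qed.

(** For truncations this is [ft_pairing]; both sides converge because [g] and
    [ft g] decay rapidly, the left one by [L^2] convergence and the right one
    by dominated convergence. *)
Lemma fourier2_pairing u U g (C : R) : fourier2 u U -> cmeasurable g ->
  (forall x, Normc.normc (g x) <= C * wt_int x) ->
  (forall x, Normc.normc (ft g x) <= C * wt_int x) ->
  cintegral (fun xi => U xi * g xi) =
  fourier_cst%:C * cintegral (fun x => u x * ft g x).
Proof.
move=> [u2 U2 uU] mg gC fgC.
have ig : cintegrable g by apply: (cintegrable_le mg (rintegrableZ C
  (@rintegrable_wt_int R d)) gC).
have mfg := cmeasurable_ft ig.
have [mu' mU] := (L2_cmeasurable u2, L2_cmeasurable U2).
have C0 : 0 <= C := wt_int_coef_ge0 (normc_ge0 _) (gC 0).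
have c0 := fourier_cst_gt0.
pose un (n : nat) x := u x * (\1_(eball n%:R) x)%:C.
have iun n : cintegrable (un n) by exact: cintegrable_trunc.
have iufg : cintegrable (fun x => u x * ft g x).
  apply: (cintegrable_le _ (rintegrableZ C (rintegrable_normc_wt u2))) => [|x];
    first exact: cmeasurableM.
  rewrite Normc.normcM mulrCA ler_wpM2l ?normc_ge0//.
have iUg : cintegrable (fun x => U x * g x).
  apply: (cintegrable_le _ (rintegrableZ C (rintegrable_normc_wt U2))) => [|x];
    first exact: cmeasurableM.
  rewrite Normc.normcM mulrCA ler_wpM2l ?normc_ge0//.
have iunfg n : cintegrable (fun x => un n x * ft g x).
  apply: (cintegrable_le _ (rintegrable_normc iufg)) => [|x].
    by apply: cmeasurableM => //; exact: cmeasurable_trunc.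
  rewrite [leLHS]Normc.normcM [leRHS]Normc.normcM ler_wpM2r ?normc_ge0//.
  exact: normc_indic_le.
pose L := cintegral (fun xi => U xi * g xi) - fourier_cst%:C * cintegral (fun x
  => u x * ft g x).
suff : Normc.normc L <= 0.
  move=> L0; apply/eqP; rewrite -subr_eq0; apply/eqP/Normc.eq0_normc.
  by apply/eqP; rewrite eq_le L0 normc_ge0.
pose I := \int[mu]_x (@wt_int R d x).
have I0 : 0 <= I by apply: Rintegral_ge0 => x _; exact: wt_int_ge0.
have e2 : Normc.normc (cintegral (fun x => un n x * ft g x) - cintegral (fun x
  => u x * ft g x)) @[n --> \oo] --> 0.
  apply: (cintegral_cvg _ _ (rintegrable_normc iufg)) => //.
  - by move=> n; exact: cintegrable_meas (iunfg n).
  - exact: cintegrable_meas iufg.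
  - move=> n x; rewrite [leLHS]Normc.normcM [leRHS]Normc.normcM ler_wpM2r ?normc_ge0//.
    exact: normc_indic_le.
  move=> x; apply/cvgrPdist_le => e e0.
  exists (Num.truncn (enorm x)).+1 => // n /= xn.
  have xn' : enorm x < n%:R.
    by rewrite (lt_le_trans (truncnS_gt _))// ler_nat.
  rewrite /un indicE mem_set ?mulr1 ?subrr ?Normc.normc0 ?subrr ?normr0 ?ltW//.
apply/ler_addgt0Pl => e e0; rewrite addr0.
(* 2 C (1 + I) + c is the total error per unit of e1; K leaves some room. *)
pose K := 4 * C * (1 + I) + fourier_cst + 1.
have K0 : 0 < K.
  have : 0 <= C * (1 + I) by rewrite mulr_ge0// addr_ge0.
  rewrite /K; lra.
pose e1 := e / K.
have e10 : 0 < e1 by exact: divr_gt0.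
have e1K : e1 * K = e by rewrite /e1 divfK// gt_eqF.
have near1 : \forall n \near \oo, (L2norm (fun xi => U xi - fourier1 (un n)
  xi)%R < e1%:E)%E.
  by apply: (uU [set y | (y < e1%:E)%E]); apply: open_ereal_lt'; rewrite lte_fin.
have near2 : \forall n \near \oo, Normc.normc (cintegral (fun x => un n x * ft
  g x) - cintegral (fun x => u x * ft g x)) < e1.
  by move: e2 => /cvgr_lt; apply.
near \oo => n.
have h1 : (L2norm (fun xi => U xi - fourier1 (un n) xi)%R < e1%:E)%E by near: n.
have h2 : Normc.normc (cintegral (fun x => un n x * ft g x) - cintegral (fun x
  => u x * ft g x)) < e1 by near: n.
pose W xi := U xi - fourier1 (un n) xi.
have mW : cmeasurable W.
  by apply: cmeasurableB => //; apply: cmeasurableM; [exact: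
    cmeasurable_cst|exact: cmeasurable_ft].
have [iW2 W2] := L2norm_le mW (ltW e10) (ltW h1).
have ifg : cintegrable (fun xi => fourier_cst%:C * (ft (un n) xi * g xi)).
  apply: cintegrableZ; apply: (cintegrable_le _ (rintegrableZ (2 * \int[mu]_x
    Normc.normc (un n x)) (rintegrable_normc ig))).
    by apply: cmeasurableM => //; exact: cmeasurable_ft.
  by move=> x; rewrite Normc.normcM ler_wpM2r ?normc_ge0// ft_bounded.
have LE : L = cintegral (fun xi => W xi * g xi) +
   fourier_cst%:C * (cintegral (fun x => un n x * ft g x) - cintegral (fun x =>
     u x * ft g x)).
  rewrite mulrBr -ft_pairing// -cintegralZ; last first.
    apply: (cintegrable_le _ (rintegrableZ (2 * \int[mu]_x Normc.normc (un n
      x)) (rintegrable_normc ig))).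
      by apply: cmeasurableM => //; exact: cmeasurable_ft.
    by move=> x; rewrite Normc.normcM ler_wpM2r ?normc_ge0// ft_bounded.
  have -> : (fun xi => W xi * g xi) = (fun xi => U xi * g xi - fourier_cst%:C *
    (ft (un n) xi * g xi)).
    by apply/funext => x; rewrite /W mulrBl fourier1E mulrA.
  by rewrite cintegralB// /L; ring.
rewrite LE (le_trans (le_normcD _ _))// Normc.normcM normc_real gtr0_norm//.
have b1 : Normc.normc (cintegral (fun xi => W xi * g xi)) <= 2 * (C * (e1 + e1 * I)).
  have iB : rintegrable (fun x => C * (e1^-1 * Normc.normc (W x) ^+ 2 + e1 * wt_int x)).
    by apply: rintegrableZ; apply: rintegrableD; apply: rintegrableZ => //;
      exact: rintegrable_wt_int.
  apply: (le_trans (normc_cintegral_le _ iB _)).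
  - exact: cmeasurableM.
  - move=> x; rewrite Normc.normcM (le_trans (ler_wpM2l (normc_ge0 _) (gC x)))//.
    rewrite mulrCA ler_wpM2l//.
    (* a b <= a^2 / e1 + e1 b^2, with b = wt_int x <= 1: the first term has an
       integral of order e1 because the norm of W is at most e1. *)
    have n0 := normc_ge0 (W x); have w0 := wt_int_ge0 x; have w1 := wt_int_le1 x.
    set a := Normc.normc (W x); set b := wt_int x.
    have qe : e1 * (e1^-1 * a ^+ 2) = a ^+ 2 by rewrite mulrA mulfV ?gt_eqF// mul1r.
    rewrite -(ler_pM2l e10) mulrDr qe.
    have h := sqr_ge0 (a - e1 * b).
    have h3 : e1 ^+ 2 * (b * (1 - b)) >= 0 by rewrite mulr_ge0 ?sqr_ge0//
      mulr_ge0// subr_ge0.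
    have h4 : 0 <= e1 * (a * b) by apply: mulr_ge0; [exact: ltW|exact: mulr_ge0].
    lra.
  - rewrite RintegralZl//; last by apply: rintegrableD; apply: rintegrableZ =>
    //; exact: rintegrable_wt_int.
    rewrite ler_wpM2l// ler_wpM2l// RintegralD//; [|exact: rintegrableZ|by
      apply: rintegrableZ; exact: rintegrable_wt_int].
    rewrite !RintegralZl//; last exact: rintegrable_wt_int.
    rewrite lerD2r ler_pdivrMl//; lra.
have : C * (e1 + e1 * I) = e1 * (C * (1 + I)) by ring.
move=> CE; rewrite CE in b1.
have cb : fourier_cst * Normc.normc (cintegral (fun x => un n x * ft g x) -
  cintegral (fun x => u x * ft g x)) <= fourier_cst * e1.
  by rewrite ler_wpM2l// ltW.
rewrite -e1K /K.
have Z : 0 <= C * (1 + I) by rewrite mulr_ge0// addr_ge0.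
nra.
Unshelve. all: by end_near. Qed.

End fourier.

(** * Derivatives and the Fourier transform *)

Section ft_derivatives.
Context {R : realType} {d : nat}.
Local Notation mu := (@lebesgue_rV R d).
Local Notation T := 'rV[R]_d.
Implicit Types (u v : T -> R[i]) (f : T -> R).

(** By translation invariance the integral of [u (x + t y) - u x] vanishes; as
    [M] dominates the quadratic remainder uniformly in the base point, it is
    also [t] times the integral of [Du] up to [O(t^2)]. *)
Lemma cintegral_derivative u Du (M : T -> R) (y : T) : cintegrable u ->
  cintegrable Du -> rintegrable M ->
  (forall t x, 0 < t -> t <= 1 ->
     Normc.normc (u (x + t *: y) - u x - t%:C * Du x) <= t ^+ 2 * M x) ->
  cintegral Du = 0.
Proof.
move=> iu iDu iM H; apply: Normc.eq0_normc; apply/eqP.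
rewrite eq_le normc_ge0 andbT; apply/ler_addgt0Pl => e e0; rewrite addr0.
pose I := \int[mu]_x M x.
have key t : 0 < t -> t <= 1 -> Normc.normc (cintegral Du) <= t * (2 * `|I|).
  move=> t0 t1.
  have iS : cintegrable (fun x => u (x + t *: y) - u x - t%:C * Du x).
    apply: cintegrableB; last exact: cintegrableZ.
    by apply: cintegrableB => //; exact: cintegrable_shift.
  have E : cintegral (fun x => u (x + t *: y) - u x - t%:C * Du x) = - (t%:C *
    cintegral Du).
    rewrite cintegralB; [|by apply: cintegrableB => //; exact:
      cintegrable_shift|exact: cintegrableZ].
    rewrite cintegralB//; last exact: cintegrable_shift.
    by rewrite (cintegral_shift _ iu) subrr cintegralZ// sub0r.
  have := normc_cintegral_le (cintegrable_meas iS) (rintegrableZ (t ^+ 2) iM)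
    (fun x => H t x t0 t1).
  rewrite E normcN Normc.normcM normc_real (gtr0_norm t0) RintegralZl//.
  move=> h; rewrite -(ler_pM2l t0); apply: (le_trans h).
  rewrite -/I (_ : t * (t * _) = t ^+ 2 * (2 * `|I|)); last by ring.
  by rewrite mulrCA ler_wpM2l ?sqr_ge0// ler_pM2l// ler_norm.
have J : 0 < 2 * `|I| + 1 by have := normr_ge0 I; lra.
pose t := Num.min 1 (e / (2 * `|I| + 1)).
have t0 : 0 < t by rewrite lt_min ltr01 divr_gt0.
rewrite (le_trans (key t t0 _)) ?ge_min ?lexx//.
have : t <= e / (2 * `|I| + 1) by rewrite ge_min lexx orbT.
rewrite ler_pdivlMr//; have := normr_ge0 I; nra.
Qed.

Lemma wt_le (t : R) (y : T) : `|t| <= 1 -> wt (t *: y) <= wt y.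
Proof.
by move=> t1; rewrite /wt norm1Z lerD2l ler_piMl// norm1_ge0.
Qed.

(** Required at every point of the line, and not only at [t = 0], so that the
    one-variable estimates apply along the whole line. *)
Definition line_derivative (y : T) f Df :=
  forall x (t : R), is_derive (t : R) (1 : R) (fun s : R => f (x + s *: y)) (Df
    (x + t *: y)).

Lemma line_taylor y f Df DDf (C : R) :
  line_derivative y f Df -> line_derivative y Df DDf ->
  (forall x, `|DDf x| <= C * wt_int x) ->
  forall t x, `|t| <= 1 ->
  `|f (x + t *: y) - f x - t * Df x| <= t ^+ 2 * (C * wt y ^+ (2 * d) * wt_int x).
Proof.
move=> h1 h2 DDfC t x t1.
have C0 : 0 <= C := wt_int_coef_ge0 (normr_ge0 _) (DDfC 0).
have := taylor2_le (h1 x) (h2 x) (M := C * wt y ^+ (2 * d) * wt_int x) (t := t).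
rewrite scale0r addr0 => h; rewrite [leRHS]mulrC; apply: h => s st.
rewrite (le_trans (DDfC _))// -mulrA ler_wpM2l//.
rewrite (le_trans (wt_int_shift _ _))// ler_wpM2r ?wt_int_ge0//.
rewrite lerXn2r ?nnegrE ?(ltW (wt_gt0 _))//.
by apply: wt_le; exact: le_trans t1.
Qed.

Lemma rapid_cintegrable f (C : R) : measurable_fun setT f -> (forall x, `|f x|
  <= C * wt_int x) ->
  cintegrable (fun x => (f x)%:C).
Proof.
move=> mf fC; apply: (cintegrable_le (cmeasurable_real mf) (rintegrableZ C
  (@rintegrable_wt_int R d))) => x.
by rewrite normc_real.
Qed.

(** [cintegral_derivative] applied to [f x * echar (dotp x xi)], whose
    derivative along [y] integrates to the difference of the two sides. *)
Lemma ft_line_derivative y f Df DDf (C : R) :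
  measurable_fun setT f -> measurable_fun setT Df ->
  line_derivative y f Df -> line_derivative y Df DDf ->
  (forall x, `|f x| <= C * wt_int x) -> (forall x, `|Df x| <= C * wt_int x) ->
  (forall x, `|DDf x| <= C * wt_int x) ->
  forall xi, ft (fun x => (Df x)%:C) xi = 'i%C * (dotp y xi)%:C * ft (fun x =>
    (f x)%:C) xi.
Proof.
move=> mf mDf h1 h2 fC DfC DDfC xi.
have C0 : 0 <= C := wt_int_coef_ge0 (normr_ge0 _) (DDfC 0).
have iF := rapid_cintegrable mf fC; have iDF := rapid_cintegrable mDf DfC.
have iF' := cintegrable_char xi iF; have iDF' := cintegrable_char xi iDF.
set th := dotp y xi.
pose u x := (f x)%:C * echar (dotp x xi).
pose Du x := (Df x)%:C * echar (dotp x xi) - 'i%C * th%:C * u x.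
suff : cintegral Du = 0.
  rewrite cintegralB//; last exact: cintegrableZ.
  by rewrite cintegralZ// => /eqP; rewrite subr_eq0 => /eqP.
pose K := C * wt y ^+ (2 * d) + 2 * C * th ^+ 2 + 2 * C * `|th|.
apply: (@cintegral_derivative u Du (fun x => K * wt_int x) y) => //.
- by apply: cintegrableB => //; exact: cintegrableZ.
- by apply: rintegrableZ; exact: rintegrable_wt_int.
move=> t x t0 t1.
have -> : u (x + t *: y) - u x - t%:C * Du x =
  (f (x + t *: y) - f x - t * Df x)%:C * echar (dotp x xi + t * th) +
  ((f x)%:C * echar (dotp x xi) * (echar (t * th) - 1 + 'i%C * (t * th)%:C) +
   (t * Df x)%:C * echar (dotp x xi) * (echar (t * th) - 1)).
  rewrite /u /Du /u dotpDl dotpZl -/th echarD !rmorphB !rmorphM /=; ring.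
rewrite (le_trans (le_normcD _ _))//.
have -> : t ^+ 2 * (K * wt_int x) = t ^+ 2 * (C * wt y ^+ (2 * d) * wt_int x) +
  (C * wt_int x * (2 * (t * th) ^+ 2) + t * (C * wt_int x) * (2 * (t * `|th|)))
    by rewrite /K; ring.
apply: lerD.
  by rewrite normcM_echar normc_real; apply: (line_taylor h1 h2) => //; rewrite
    gtr0_norm.
rewrite (le_trans (le_normcD _ _))//; apply: lerD.
  rewrite Normc.normcM normcM_echar normc_real; apply: ler_pM => //; first
    exact: normc_ge0.
  exact: echar_taylor2.
rewrite Normc.normcM normcM_echar normc_real normrM gtr0_norm//; apply: ler_pM => //.
- by rewrite mulr_ge0// ltW.
- exact: normc_ge0.
- by rewrite ler_wpM2l// ltW.
- by rewrite (le_trans (echar_taylor1 _))// normrM gtr0_norm.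
Qed.

(** The second-order Taylor estimate for [echar], integrated against [u]. *)
Lemma ft_taylor u (y : T) : cmeasurable u ->
  rintegrable (fun x => wt x ^+ 2 * Normc.normc (u x)) ->
  exists C, forall xi (t : R),
  Normc.normc (ft u (xi + t *: y) - ft u xi -
    t%:C * ft (fun x => - 'i%C * (dotp x y)%:C * u x) xi) <= C * t ^+ 2.
Proof.
move=> mu' i2.
pose M x := 2 * norm1 y ^+ 2 * (wt x ^+ 2 * Normc.normc (u x)).
have iu : cintegrable u.
  apply: (cintegrable_le mu' i2) => x; by rewrite ler_peMl ?normc_ge0//
    exprn_ege1// wt_ge1.
have iv : cintegrable (fun x => - 'i%C * (dotp x y)%:C * u x).
  apply: (cintegrable_le _ (rintegrableZ (norm1 y) i2)) => [|x].
    apply: cmeasurableM => //; apply: cmeasurableM; first exact: cmeasurable_cst.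
    by apply: cmeasurable_real; exact: measurable_dotpl.
  rewrite !Normc.normcM normcN normc_real.
  rewrite normc_i mul1r mulrA ler_wpM2r ?normc_ge0//.
  rewrite (le_trans (abs_dotp_le _ _))// mulrC ler_wpM2l ?norm1_ge0//.
  by rewrite expr2 ler_peMl ?(ltW (wt_gt0 _))// wt_ge1.
exists (2 * \int[mu]_x M x) => xi t.
have iv' := cintegrable_char xi iv.
have iu1 := cintegrable_char xi iu.
have iu2 := cintegrable_char (xi + t *: y) iu.
rewrite /ft -cintegralZ// -cintegralB// -cintegralB//; [|exact:
  cintegrableB|exact: cintegrableZ].
rewrite -mulrA [X in _ * X]mulrC -RintegralZl//; last exact: rintegrableZ.
apply: normc_cintegral_le.
- by apply: cintegrable_meas; apply: cintegrableB; [exact: cintegrableB|exact: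
  cintegrableZ].
- by apply: rintegrableZ; exact: rintegrableZ.
move=> x.
have -> : u x * echar (dotp x (xi + t *: y)) - u x * echar (dotp x xi) -
   t%:C * (- 'i%C * (dotp x y)%:C * u x * echar (dotp x xi)) =
  (u x * (echar (t * dotp x y) - 1 + 'i%C * (t * dotp x y)%:C)) * echar (dotp x xi).
  by rewrite dotpDr dotpZr echarD rmorphM /=; ring.
rewrite normcM_echar Normc.normcM.
rewrite (le_trans (ler_wpM2l (normc_ge0 _) (echar_taylor2 _)))//.
have : `|dotp x y| ^+ 2 <= (wt x * norm1 y) ^+ 2.
  by rewrite lerXn2r ?nnegrE ?mulr_ge0 ?norm1_ge0 ?(ltW (wt_gt0 _))// abs_dotp_le.
rewrite real_normK ?num_real// => h.
rewrite /M exprMn.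
have -> : t ^+ 2 * (2 * norm1 y ^+ 2 * (wt x ^+ 2 * Normc.normc (u x))) =
  Normc.normc (u x) * (2 * (t ^+ 2 * (wt x * norm1 y) ^+ 2)) by ring.
by rewrite ler_wpM2l ?normc_ge0// ler_wpM2l// ler_wpM2l// sqr_ge0.
Qed.

End ft_derivatives.

(** * Gaussians and their transforms *)

Section gaussian.
Context {R : realType}.

(** Raise [t <= expR t] at [t = u / N.+1] to the power [N]. *)
Lemma exprn_le_expR (N : nat) (u : R) : 0 <= u -> u ^+ N <= N.+1%:R ^+ N * expR u.
Proof.
move=> u0; have N0 : 0 < N.+1%:R :> R by rewrite ltr0n.
have h : u / N.+1%:R <= expR (u / N.+1%:R).
  by rewrite (le_trans _ (expR_ge1Dx _))// lerDr.
have h2 : u <= N.+1%:R * expR (u / N.+1%:R) by rewrite mulrC -ler_pdivrMr.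
rewrite (le_trans (lerXn2r N _ _ h2)) ?nnegrE ?mulr_ge0 ?expR_ge0//.
rewrite exprMn ler_wpM2l ?exprn_ge0//.
rewrite -expRM_natl ler_expR mulrCA ler_piMr// ler_pdivrMr// mul1r ler_nat.
exact: leqnSn.
Qed.

Variable d : nat.
Local Notation mu := (@lebesgue_rV R d).
Local Notation T := 'rV[R]_d.
Implicit Types (x y z : T) (s r : R).

Definition gauss s x : R := expR (- (s / 2 * dotp x x)).

Lemma gauss_gt0 s x : 0 < gauss s x.
Proof. exact: expR_gt0. Qed.

Lemma measurable_gauss s : measurable_fun setT (gauss s).
Proof.
apply: measurableT_comp => //; apply: measurable_funN.
by apply: measurable_funM => //; exact: measurable_dotpp.
Qed.

Lemma wt_le_dotp x : wt x <= d.+1%:R * (1 + dotp x x).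
Proof.
rewrite -sqr_enorm /wt.
have := norm1_le_enorm x; have := sqr_ge0 (enorm x - 1).
have D0 : 0 <= d%:R :> R by [].
rewrite -[d.+1]addn1 natrD; set D := d%:R in D0 *; have e0 := enorm_ge0 x.
set r := enorm x in e0 *; move=> h1 h2.
have : D * r <= D * (1 + r ^+ 2) by rewrite ler_wpM2l//; nra.
nra.
Qed.

(** [wt x] is at most a multiple of [1 + |x| ^ 2], and powers of the latter are
    beaten by [exprn_le_expR]. *)
Lemma gauss_rapid N s : 0 < s -> exists C, forall x, wt x ^+ N * gauss s x <= C.
Proof.
move=> s0.
exists ((d.+1%:R * (2 / s)) ^+ N * (N.+1%:R ^+ N * expR (s / 2))) => x.
have v0 : 0 <= s / 2 * (1 + dotp x x) by rewrite mulr_ge0 ?addr_ge0 ?dotp_ge0//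
  divr_ge0// ltW.
have := exprn_le_expR N v0.
rewrite [X in expR X]mulrDr mulr1 expRD => h.
have hw : wt x <= d.+1%:R * (2 / s) * (s / 2 * (1 + dotp x x)).
  rewrite (le_trans (wt_le_dotp x))// -mulrA ler_wpM2l// mulrA.
  by rewrite [2 / s * _](_ : _ = 1) ?mul1r// mulrACA mulrC; field; rewrite gt_eqF.
have := lerXn2r N _ _ hw; rewrite !nnegrE (ltW (wt_gt0 _)) => /(_ isT).
rewrite mulr_ge0 ?mulr_ge0 ?invr_ge0 ?addr_ge0 ?dotp_ge0 ?(ltW s0)// => /(_ isT) hN.
rewrite /gauss expRN ler_pdivrMr ?expR_gt0// (le_trans hN)//.
rewrite [leLHS]exprMn -[leRHS]mulrA ler_wpM2l//.
  by rewrite exprn_ge0// mulr_ge0// divr_ge0// ltW.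
by rewrite -[leRHS]mulrA.
Qed.

Lemma gauss_le_wt N s : 0 < s -> exists C, forall x, wt x ^+ N * gauss s x <= C
  * wt_int x.
Proof.
move=> s0; have [C hC] := gauss_rapid (N + 2 * d) s0; exists C => x.
by rewrite /wt_int ler_pdivlMr ?exprn_gt0 ?wt_gt0// mulrAC -exprD hC.
Qed.

Lemma rintegrable_gauss N s : 0 < s -> rintegrable (fun x => wt x ^+ N * gauss s x).
Proof.
move=> s0; have [C hC] := gauss_le_wt N s0.
apply: (rintegrable_le _ (rintegrableZ C (@rintegrable_wt_int R d))) => [|x].
  apply: measurable_funM; last exact: measurable_gauss.
  by apply: measurable_funX; exact: measurable_wt.
by rewrite ger0_norm ?hC// mulr_ge0 ?exprn_ge0 ?(ltW (wt_gt0 _))// ltW// gauss_gt0.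
Qed.

Lemma line_derivative_gauss s y :
  line_derivative y (gauss s) (fun x => - s * dotp x y * gauss s x).
Proof.
move=> x t.
have -> : (fun r : R => gauss s (x + r *: y)) =
  (fun r : R => expR (- (s / 2 * (dotp x x + 2 * (r * dotp x y) + r ^+ 2 * dotp y y)))).
  apply/funext => r; rewrite /gauss; congr (expR (- (_ * _))).
  by rewrite dotpDl !dotpDr !dotpZl !dotpZr (dotpC y x); ring.
apply: is_derive_eq; rewrite /gauss.
set E1 := expR _; set E2 := expR _.
have -> : E2 = E1.
  rewrite /E1 /E2; congr (expR (- (_ * _))).
  by rewrite !dotpDl !dotpDr !dotpZl !dotpZr (dotpC y x); ring.
by rewrite dotpDl dotpZl /GRing.scale /=; field.
Qed.

Lemma line_derivative_dotp y z : line_derivative z (dotp^~ y) (fun=> dotp z y).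
Proof.
move=> x t; under eq_fun do rewrite dotpDl dotpZl.
by apply: is_derive_eq; rewrite /GRing.scale /=; ring.
Qed.

Lemma line_derivativeM y f Df g Dg : line_derivative y f Df -> line_derivative y g Dg ->
  line_derivative y (fun x : T => f x * g x : R) (fun x => Df x * g x + f x * Dg x).
Proof.
move=> hf hg x t; have h1 := hf x t; have h2 := hg x t.
apply: is_derive_eq; rewrite /GRing.scale/=; ring.
Qed.

Lemma line_derivativeZ y (c : R) f Df : line_derivative y f Df ->
  line_derivative y (fun x : T => c * f x : R) (fun x => c * Df x).
Proof.
move=> hf x t; have h1 := hf x t.
apply: is_derive_eq; rewrite /GRing.scale/=; ring.
Qed.

(** [f t * expR (t ^+ 2 * k / 2)] is constant. *)
Lemma linear_ode (f : R -> R) (k : R) :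
  (forall t : R, is_derive t (1 : R) f (- (t * k) * f t)) -> f 1 = f 0 * expR
    (- (k / 2)).
Proof.
move=> hf.
pose h t := f t * expR (t ^+ 2 * (k / 2)).
have hh (t : R) : is_derive t (1 : R) h 0.
  have h1 := hf t.
  by apply: is_derive_eq; rewrite /GRing.scale/=; field.
have [c _] := MVT_from0 1 hh; rewrite mulr0 /h expr1n mul1r expr0n/= mul0r expR0 mulr1.
move=> /eqP; rewrite subr_eq0 => /eqP <-.
by rewrite -mulrA -expRD subrr expR0 mulr1.
Qed.

Definition gauss_mass s : R := \int[mu]_x gauss s x.

Lemma cintegrable_gauss s : 0 < s -> cintegrable (fun x => (gauss s x)%:C).
Proof.
move=> s0; have [C hC] := gauss_le_wt 0 s0.
apply: (rapid_cintegrable (measurable_gauss s) (C := C)) => x.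
by have := hC x; rewrite expr0 mul1r gtr0_norm// gauss_gt0.
Qed.

(** On each line [t |-> t xi] the transform of a Gaussian solves a linear
    differential equation: differentiation under the integral sign multiplies
    the Gaussian by [x . xi], which up to a constant is its derivative along
    [xi], and the transform turns that derivative into a product. *)
Lemma ft_gauss s xi : 0 < s ->
  ft (fun x => (gauss s x)%:C) xi = (gauss_mass s * gauss s^-1 xi)%:C.
Proof.
move=> s0; set G := fun x => (gauss s x)%:C.
have s1 : s != 0 by rewrite gt_eqF.
pose Z (t : R) := ft G (t *: xi).
have iG : cintegrable G := cintegrable_gauss s0.
have hD : forall eta, ft (fun x => (- s * dotp x xi * gauss s x)%:C) eta =
    'i%C * (dotp xi eta)%:C * ft G eta.
  move=> eta.
  have l1 := line_derivative_gauss s xi.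
  have l2 := line_derivativeM (line_derivativeZ (- s) (line_derivative_dotp xi xi)) l1.
  have [C0 hC0] := gauss_le_wt 0 s0.
  have [C1 hC1] := gauss_le_wt 1 s0.
  have [C2 hC2] := gauss_le_wt 2 s0.
  pose N := norm1 xi.
  have N0 : 0 <= N := norm1_ge0 xi.
  pose C := `|C0| + s * N * `|C1| + (s * `|dotp xi xi| * `|C0| + (s * N) ^+ 2 * `|C2|).
  have W0 := @wt_int_ge0 R d.
  have b0 x : gauss s x <= `|C0| * wt_int x.
    by rewrite (le_trans _ (ler_wpM2r (W0 x) (ler_norm C0)))//; have := hC0 x;
      rewrite expr0 mul1r.
  have b1 x : `|dotp x xi| * gauss s x <= N * (`|C1| * wt_int x).
    rewrite (le_trans (ler_wpM2r (ltW (gauss_gt0 s x)) (abs_dotp_le x xi)))//.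
    rewrite (mulrC (wt x)) -mulrA ler_wpM2l//.
    by rewrite (le_trans _ (ler_wpM2r (W0 x) (ler_norm C1)))//; have := hC1 x;
      rewrite expr1.
  have b2 x : `|dotp x xi| ^+ 2 * gauss s x <= N ^+ 2 * (`|C2| * wt_int x).
    have h : `|dotp x xi| ^+ 2 <= (wt x * N) ^+ 2.
      by rewrite lerXn2r ?nnegrE ?mulr_ge0 ?(ltW (wt_gt0 _))// abs_dotp_le.
    rewrite (le_trans (ler_wpM2r (ltW (gauss_gt0 s x)) h))//.
    rewrite exprMn (mulrC (wt x ^+ 2)) -mulrA ler_wpM2l ?exprn_ge0//.
    by rewrite (le_trans _ (ler_wpM2r (W0 x) (ler_norm C2))).
  pose E0 x := `|C0| * @wt_int R d x.
  pose E1 x := s * (N * (`|C1| * @wt_int R d x)).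
  pose E2 x := s ^+ 2 * (N ^+ 2 * (`|C2| * @wt_int R d x)).
  pose E3 x := s * `|dotp xi xi| * E0 x.
  have E00 x : 0 <= E0 x by rewrite mulr_ge0.
  have E10 x : 0 <= E1 x by rewrite mulr_ge0 ?(ltW s0)// mulr_ge0// mulr_ge0.
  have E20 x : 0 <= E2 x by rewrite mulr_ge0 ?exprn_ge0 ?(ltW s0)// mulr_ge0
    ?exprn_ge0// mulr_ge0.
  have E30 x : 0 <= E3 x by rewrite mulr_ge0// mulr_ge0// ltW.
  have CE x : C * wt_int x = E0 x + E1 x + (E3 x + E2 x).
    by rewrite /C /E0 /E1 /E2 /E3 /E0; ring.
  apply: (ft_line_derivative (C := C) _ _ l1 l2).
  - exact: measurable_gauss.
  - apply: measurable_funM; last exact: measurable_gauss.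
    by apply: measurable_funM => //; exact: measurable_dotpl.
  - move=> x; rewrite gtr0_norm ?gauss_gt0// (le_trans (b0 x))// CE -/(E0 x).
    have := E10 x; have := E20 x; have := E30 x; lra.
  - move=> x; rewrite normrM normrM normrN (gtr0_norm s0) (gtr0_norm (gauss_gt0 _ _)).
    rewrite -mulrA (le_trans (ler_wpM2l (ltW s0) (b1 x)))// CE -/(E1 x).
    have := E00 x; have := E20 x; have := E30 x; lra.
  - move=> x; rewrite (le_trans (ler_normD _ _))// !normrM normrN (gtr0_norm
    s0) (gtr0_norm (gauss_gt0 _ _)) CE.
    have h3 : s * `|dotp xi xi| * gauss s x <= E3 x by rewrite ler_wpM2l//
      mulr_ge0// ltW.
    have h2 : s * `|dotp x xi| * (s * `|dotp x xi| * gauss s x) <= E2 x.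
      have -> : s * `|dotp x xi| * (s * `|dotp x xi| * gauss s x) = s ^+ 2 *
        (`|dotp x xi| ^+ 2 * gauss s x) by ring.
      by rewrite ler_wpM2l ?exprn_ge0// ltW.
    have := E00 x; have := E10 x; lra.
pose q := dotp xi xi / s.
have dZ t : ft (fun x => - 'i%C * (dotp x xi)%:C * G x) (t *: xi) = - (t * q)%:C * Z t.
  have := hD (t *: xi); rewrite dotpZr -/(Z t).
  have -> : (fun x => (- s * dotp x xi * gauss s x)%:C) =
    (fun x => (- s%:C * 'i%C) * (- 'i%C * (dotp x xi)%:C * G x)).
    apply/funext => x; rewrite !rmorphM rmorphN /= /G.
    have ii : 'i%C * 'i%C = -1 :> R[i] by apply/eqP; rewrite eq_complex /=;
      apply/andP; split; apply/eqP; ring.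
    transitivity (s%:C * ('i%C * 'i%C) * (dotp x xi)%:C * (gauss s x)%:C);
      first by rewrite ii; ring.
    by ring.
  have iv : cintegrable (fun x => - 'i%C * (dotp x xi)%:C * G x).
    have -> : (fun x => - 'i%C * (dotp x xi)%:C * G x) = (fun x => - 'i%C *
      (dotp x xi * gauss s x)%:C).
      by apply/funext => x; rewrite rmorphM mulrA.
    apply: cintegrableZ; apply: (cintegrable_le _ (rintegrableZ (norm1 xi)
      (rintegrable_gauss 1 s0))) => [|x].
      by apply: cmeasurable_real; apply: measurable_funM; [exact:
        measurable_dotpl|exact: measurable_gauss].
    rewrite normc_real normrM (gtr0_norm (gauss_gt0 _ _)) expr1 mulrA ler_wpM2r
      ?(ltW (gauss_gt0 _ _))//.
    by rewrite mulrC abs_dotp_le.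
  rewrite ftZ// => h.
  have si : - s%:C * 'i%C != 0 :> R[i].
    by rewrite mulf_neq0 ?oppr_eq0// eq_complex /= ?(negbTE s1)// oner_eq0 andbF.
  apply: (mulfI si); rewrite h /q.
  have -> : (t * (dotp xi xi / s))%:C = (t * dotp xi xi)%:C / s%:C :> R[i].
    by rewrite mulrA rmorphM /= fmorphV.
  have s1C : s%:C != 0 :> R[i] by rewrite eq_complex /= eqxx andbT.
  by field.
have rint2 : rintegrable (fun x => wt x ^+ 2 * Normc.normc (G x)).
  by have := rintegrable_gauss 2 s0; apply: eq_integrable => // x _ /=; rewrite
    normc_real gtr0_norm// gauss_gt0.
have [C hC] := @ft_taylor R d G xi (cintegrable_meas iG) rint2.
have hZ t h : Normc.normc (Z (t + h) - Z t - h%:C * (- (t * q)%:C * Z t)) <= C * h ^+ 2.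
  by have := hC (t *: xi) h; rewrite -scalerDl dZ.
have hre : complex.Re (Z 1) = complex.Re (Z 0) * expR (- (q / 2)).
  apply: (@linear_ode (fun t => complex.Re (Z t))) => t.
  apply: (is_derive_quadratic (C := C)) => h _.
  rewrite (le_trans _ (hZ t h))//.
  rewrite (le_trans _ (normc_ge_absRe _))// !cReD !cReN !cReM /=.
  by rewrite le_eqVlt; apply/orP; left; apply/eqP; congr `| _ |; ring.
have him : complex.Im (Z 1) = complex.Im (Z 0) * expR (- (q / 2)).
  apply: (@linear_ode (fun t => complex.Im (Z t))) => t.
  apply: (is_derive_quadratic (C := C)) => h _.
  rewrite (le_trans _ (hZ t h))//.
  rewrite (le_trans _ (normc_ge_absIm _))// !cImD !cImN !cImM /=.
  by rewrite le_eqVlt; apply/orP; left; apply/eqP; congr `| _ |; ring.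
have Z0 : Z 0 = (gauss_mass s)%:C.
  rewrite /Z scale0r /ft; under eq_fun do rewrite dotpC dotp0l echar0 mulr1.
  by rewrite /cintegral /G /=; congr Complex; rewrite /Rintegral integral0.
have -> : ft G xi = Z 1 by rewrite /Z scale1r.
apply/eqP; rewrite eq_complex hre him Z0 /= mul0r eqxx andbT; apply/eqP.
by congr (_ * expR (- _)); rewrite /q; field.
Qed.

End gaussian.

(** * Gaussian approximation of the identity *)

Section inversion.
Context {R : realType} {d : nat}.
Local Notation mu := (@lebesgue_rV R d).
Local Notation T := 'rV[R]_d.
Implicit Types (x y z : T) (s r : R).

Lemma gauss_massE s : 0 < s -> gauss_mass d s = Num.sqrt (2 * pi / s) ^+ d.
Proof.
move=> s0; set k := Num.sqrt (2 * pi / s).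
have sn : Num.sqrt s^-1 != 0 by rewrite gt_eqF// sqrtr_gt0 invr_gt0.
have k0 : 0 < k by rewrite sqrtr_gt0 divr_gt0// mulr_gt0// pi_gt0.
pose f t : R := expR (- (s / 2 * t ^+ 2)).
have fE : f = (fun t => k * normal_pdf 0 (Num.sqrt s^-1) t).
  apply/funext => t; rewrite normal_pdfE// /normal_peak /normal_fun sqr_sqrtr
    ?invr_ge0 ?ltW//.
  have -> : s^-1 * pi *+ 2 = 2 * pi / s by rewrite -mulr_natl; ring.
  rewrite -/k mulrA mulfV ?gt_eqF// mul1r /f; congr expR.
  by rewrite subr0 -mulr_natl; field; rewrite gt_eqF.
have mf : measurable_fun setT f.
  by rewrite fE; apply: measurable_funM => //; exact: measurable_normal_pdf.
have hf : (\int[lebesgue_measure]_t (f t)%:E = k%:E)%E.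
  rewrite fE; under eq_integral do rewrite EFinM.
  rewrite ge0_integralZl_EFin ?ltW//; last 2 first.
  - by move=> t _; rewrite lee_fin normal_pdf_ge0.
  - by apply/measurable_EFinP; exact: measurable_normal_pdf.
  by rewrite integral_normal_pdf ?mule1.
have := ge0_integral_prod d mf (fun t => expR_ge0 _) hf.
have -> : (fun x : T => (\prod_(i < d) f (x ord0 i))%:E) = (fun x => (gauss s x)%:E).
  apply/funext => x; rewrite /f -expR_sum /gauss /dotp mulr_sumr -sumrN.
  by congr (expR _)%:E; apply: eq_bigr => i _; rewrite expr2.
by rewrite /gauss_mass /Rintegral => ->.
Qed.

Lemma gauss_mass_gt0 s : 0 < s -> 0 < gauss_mass d s.
Proof.
by move=> s0; rewrite gauss_massE// exprn_gt0// sqrtr_gt0 divr_gt0// mulr_gt0// pi_gt0.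
Qed.

(** The product of the masses of a Gaussian and of the dual one does not depend
    on the width: this is what makes the constant in the inversion formula the
    right one. *)
Lemma gauss_mass_inv s : 0 < s ->
  (@fourier_cst R d) ^+ 2 * (gauss_mass d s * gauss_mass d s^-1) = 1.
Proof.
move=> s0; have p0 : 0 < 2 * pi :> R by rewrite mulr_gt0// pi_gt0.
rewrite !gauss_massE ?invr_gt0// -exprMn -sqrtrM; last by rewrite divr_ge0// ltW.
have -> : 2 * pi / s * (2 * pi / s^-1) = (2 * pi) ^+ 2.
  by rewrite invrK expr2; field; rewrite gt_eqF.
rewrite sqrtr_sqr gtr0_norm// /fourier_cst -powR_mulrn ?powR_ge0// -powRrM.
rewrite mulNr divfK// powRN powR_mulrn ?ltW// mulVf// gt_eqF// exprn_gt0//.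
Qed.

Lemma gauss_shift_le r (x0 : T) : 0 < r ->
  exists C, forall x, gauss r (x - x0) <= C * wt_int x.
Proof.
move=> r0; have [C hC] := gauss_le_wt d 0 r0.
have C0 : 0 <= C.
  have := hC (0 : T); rewrite expr0 mul1r => /(le_trans (ltW (gauss_gt0 _ _))).
  by rewrite pmulr_lge0// wt_int_gt0.
exists (C * wt (- x0) ^+ (2 * d)) => x.
have := hC (x - x0); rewrite expr0 mul1r => /le_trans; apply.
by rewrite -mulrA ler_wpM2l// wt_int_shift.
Qed.

Lemma mx_norm_le_enorm x : `|x| <= enorm x.
Proof.
rewrite [leLHS]/Num.norm /= mx_normrE.
by apply: bigmax_le => [|[i j] _]; [exact: enorm_ge0|rewrite ord1; exact:
  coord_le_enorm].
Qed.

(** Half of the exponent supplies the factor [expR (- r e^2 / 4)], which beats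
    the normalisation [r ^ (d / 2)]; the other half is kept as a fixed Gaussian,
    to be integrated against a function that is only square-integrable. *)
Lemma gauss_tail (e : R) : 0 < e -> exists A, forall r x, 1 <= r -> e <= enorm x ->
  (gauss_mass d r)^-1 * gauss r x <= A / r * gauss (2^-1) x.
Proof.
move=> e0.
pose A := d.+2%:R ^+ d.+1 * (4 / e ^+ 2) ^+ d.+1.
exists A => r x r1 ex.
have r0 : 0 < r by exact: lt_le_trans r1.
have q1 : e ^+ 2 <= dotp x x by rewrite -sqr_enorm lerXn2r// ?nnegrE ?enorm_ge0// ltW.
have p2 : 1 <= 2 * pi :> R by have := pi_ge2 R; lra.
have h1 : (gauss_mass d r)^-1 <= r ^+ d.
  rewrite gauss_massE// -exprVn lerXn2r ?nnegrE ?invr_ge0 ?(ltW r0)//.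
  rewrite -[leRHS]invrK lef_pV2 ?posrE ?invr_gt0 ?sqrtr_gt0 ?divr_gt0//; last by lra.
  rewrite -[leLHS]ger0_norm ?invr_ge0 ?(ltW r0)// -sqrtr_sqr ler_wsqrtr//.
  rewrite expr2 ler_wpM2r ?invr_ge0 ?(ltW r0)// (le_trans _ p2)// invf_le1//.
pose u := r * e ^+ 2 / 4.
have u0 : 0 < u by rewrite divr_gt0// mulr_gt0// exprn_gt0.
have h2 : gauss r x <= expR (- u) * gauss (2^-1) x.
  rewrite /gauss -expRD ler_expR /u.
  set q := dotp x x in q1 *; have := mulr_ge0 (ltW r0) (exprn_ge0 2 (ltW e0)).
  have : r * e ^+ 2 <= r * q by rewrite ler_wpM2l// ltW.
  have : q <= r * q by rewrite ler_peMl// dotp_ge0.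
  lra.
have h3 : r ^+ d * expR (- u) <= A / r.
  rewrite ler_pdivlMr// mulrAC -exprSr expRN.
  rewrite ler_pdivrMr ?expR_gt0//.
  have := exprn_le_expR d.+1 (ltW u0).
  have -> : r ^+ d.+1 = (4 / e ^+ 2) ^+ d.+1 * u ^+ d.+1.
    by rewrite -exprMn /u; congr (_ ^+ _); field; rewrite gt_eqF.
  move=> h; rewrite /A (mulrC (d.+2%:R ^+ _)) -[leRHS]mulrA.
  by rewrite ler_wpM2l// exprn_ge0// divr_ge0// exprn_ge0// ltW.
rewrite (le_trans (ler_wpM2r (ltW (gauss_gt0 _ _)) h1))//.
rewrite (le_trans (ler_wpM2l (exprn_ge0 _ (ltW r0)) h2))// mulrA.
by rewrite ler_wpM2r// ltW// gauss_gt0.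
Qed.

(** Near [x0] continuity is used, away from it [gauss_tail]. *)
Lemma gauss_approx (u : T -> R) (x0 : T) : measurable_fun setT u ->
  rintegrable (fun x => u x ^+ 2) -> {for x0, continuous u} ->
  (gauss_mass d n.+1%:R)^-1 * \int[mu]_x (u x * gauss n.+1%:R (x - x0))
    @[n --> \oo] --> u x0.
Proof.
move=> mu' iu2 cu.
have mg r : measurable_fun setT (fun x : T => gauss r (x - x0)).
  by apply: measurableT_comp; [exact: measurable_gauss|exact: measurable_shift].
have ig r : 0 < r -> rintegrable (fun x : T => gauss r (x - x0)).
  move=> r0; have [C hC] := gauss_shift_le x0 r0.
  by apply: (rintegrable_le (mg r) (rintegrableZ C (@rintegrable_wt_int R d)))
    => x; rewrite gtr0_norm ?gauss_gt0.
have iug r : 0 < r -> rintegrable (fun x : T => `|u x| * gauss r (x - x0)).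
  move=> r0; have [C hC] := gauss_shift_le x0 r0.
  apply: (rintegrable_le _ (rintegrableD iu2 (ig r r0))) => [|x].
    by apply: measurable_funM => //; exact: measurableT_comp.
  have g0 := ltW (gauss_gt0 r (x - x0)).
  have g1 : gauss r (x - x0) <= 1.
    by rewrite /gauss -[leRHS]expR0 ler_expR oppr_le0 mulr_ge0 ?dotp_ge0//
      divr_ge0// ltW.
  rewrite ger0_norm ?mulr_ge0//.
  have := normr_ge0 (u x); have := real_normK (num_real (u x)); set a := `|u x|
    => <- a0.
  nra.
have iug' r : 0 < r -> rintegrable (fun x : T => u x * gauss r (x - x0)).
  move=> r0; apply: (rintegrable_le _ (iug r r0)) => [|x]; first exact: measurable_funM.
  by rewrite normrM (gtr0_norm (gauss_gt0 _ _)).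
apply/cvgrPdist_le => e e0.
have e2 : 0 < e / 2 by rewrite divr_gt0.
have [del del0 hdel] : exists2 del : R, 0 < del & forall x, enorm (x - x0) <
  del -> `|u x - u x0| <= e / 2.
  have /cvgrPdist_le /(_ _ e2) := cu.
  move=> /nbhs_ballP[del /= del0 hd]; exists del => // x xd.
  rewrite distrC; apply: hd; rewrite -ball_normE /ball_ /= distrC.
  exact: le_lt_trans (mx_norm_le_enorm _) xd.
have [A hA] := gauss_tail del0.
pose B := \int[mu]_x (`|u x| * gauss 2^-1 (x - x0) + `|u x0| * gauss 2^-1 (x - x0)).
have i12 : 0 < 2^-1 :> R by [].
have iB : rintegrable (fun x => `|u x| * gauss 2^-1 (x - x0) + `|u x0| * gauss
  2^-1 (x - x0)).
  by apply: rintegrableD; [exact: iug|apply: rintegrableZ; exact: ig].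
have key r : 1 <= r ->
  `|u x0 - (gauss_mass d r)^-1 * \int[mu]_x (u x * gauss r (x - x0))| <= e / 2
    + `|A| * B / r.
  move=> r1; have r0 : 0 < r by exact: lt_le_trans r1.
  have m0 := gauss_mass_gt0 r0.
  have m1 : (gauss_mass d r)^-1 * \int[mu]_x gauss r (x - x0) = 1.
    rewrite (Rintegral_shift (- x0) (f := gauss r)); first by rewrite mulVf// gt_eqF.
    by have := rintegrable_gauss d 0 r0; apply: eq_integrable => // x _ /=;
      rewrite expr0 mul1r.
  have -> : u x0 - (gauss_mass d r)^-1 * \int[mu]_x (u x * gauss r (x - x0)) =
    \int[mu]_x ((gauss_mass d r)^-1 * (u x0 * gauss r (x - x0) - u x * gauss r
      (x - x0))).
    rewrite RintegralZl//; last by apply: rintegrableD; [apply: rintegrableZ;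
      exact: ig|apply: rintegrableN; exact: iug'].
    rewrite RintegralB//; [|by apply: rintegrableZ; exact: ig|exact: iug'].
    rewrite RintegralZl//; last exact: ig.
    by rewrite mulrBr mulrCA m1 mulr1.
  have iM : rintegrable (fun x => e / 2 * ((gauss_mass d r)^-1 * gauss r (x - x0)) +
     `|A| / r * (`|u x| * gauss 2^-1 (x - x0) + `|u x0| * gauss 2^-1 (x - x0))).
    by apply: rintegrableD; [do 2 apply: rintegrableZ; exact: ig|exact: rintegrableZ].
  apply: (le_trans (abs_Rintegral_le _ iM _)).
  - apply: measurable_funM => //; apply: measurable_funB.
      by apply: measurable_funM.
    by apply: measurable_funM.
  - move=> x; rewrite -mulrBl normrM (ger0_norm (ltW _)) ?invr_gt0//.
    rewrite normrM (gtr0_norm (gauss_gt0 _ _)) distrC mulrCA.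
    have g0 := gauss_gt0 r (x - x0); have g1 := gauss_gt0 2^-1 (x - x0).
    have k0 : 0 < (gauss_mass d r)^-1 * gauss r (x - x0) by rewrite mulr_gt0// invr_gt0.
    have t0 : 0 <= `|A| / r * (`|u x| * gauss 2^-1 (x - x0) + `|u x0| * gauss
      2^-1 (x - x0)).
      by rewrite mulr_ge0 ?divr_ge0 ?addr_ge0 ?mulr_ge0 ?(ltW g1) ?(ltW r0).
    have [xd|xd] := ltP (enorm (x - x0)) del.
      by rewrite (le_trans (ler_wpM2r (ltW k0) (hdel x xd)))// lerDl.
    have s0 : 0 <= e / 2 * ((gauss_mass d r)^-1 * gauss r (x - x0)) by rewrite
      mulr_ge0// ltW.
    apply: (@le_trans _ _ (`|A| / r * (`|u x| * gauss 2^-1 (x - x0) + `|u x0| *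
      gauss 2^-1 (x - x0)))); last by rewrite lerDr.
    rewrite -mulrDl [leRHS]mulrCA ler_pM ?ler_normB ?(ltW k0)//.
    rewrite (le_trans (hA r (x - x0) r1 xd))// ler_wpM2r ?(ltW g1)// ler_wpM2r
      ?invr_ge0 ?(ltW r0)//.
    exact: ler_norm.
  - rewrite RintegralD//; [|by do 2 apply: rintegrableZ; exact: ig|exact: rintegrableZ].
    rewrite RintegralZl//; last by apply: rintegrableZ; exact: ig.
    rewrite RintegralZl//; last exact: ig.
    rewrite m1 mulr1 lerD2l RintegralZl// -/B.
    by rewrite (_ : `|A| / r * B = `|A| * B / r)//; ring.
have B0 : 0 <= B.
  apply: Rintegral_ge0 => x _; by rewrite addr_ge0// mulr_ge0// ltW// gauss_gt0.
near=> n.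
have n1 : 1 <= n.+1%:R :> R by rewrite ler1n.
rewrite (le_trans (key _ n1))// [leRHS](splitr e) lerD2l.
rewrite ler_pdivrMr//.
have : `|A| * B / (e / 2) <= n.+1%:R.
  rewrite ltW//; near: n.
  exists (Num.truncn (`|A| * B / (e / 2))) => // m /= hm.
  by rewrite (lt_le_trans (truncnS_gt _))// ler_nat.
by rewrite ler_pdivrMr// (mulrC (e / 2)).
Unshelve. all: by end_near. Qed.

End inversion.

(** * Fourier inversion *)

Section inversion.
Context {R : realType} {d : nat}.
Local Notation mu := (@lebesgue_rV R d).
Local Notation T := 'rV[R]_d.
Local Notation c := (@fourier_cst R d).

(** Fourier inversion at a point of continuity, by pairing with a Gaussian
    that spreads to the constant 1 while its transform concentrates. *)
Lemma fourier2_inversion (u : T -> R) (U : T -> R[i]) (x0 : T) :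
  fourier2 (fun x => (u x)%:C) U -> cintegrable U -> {for x0, continuous u} ->
  (u x0)%:C = c%:C * cintegral (fun xi => U xi * echar (- dotp xi x0)).
Proof.
move=> uU iU cu.
have [u2 _ _] := uU.
have mu' : measurable_fun setT u by have [] := L2_cmeasurable u2.
have iu2 : rintegrable (fun x => u x ^+ 2).
  have := L2_rintegrable u2; apply: eq_integrable => // x _ /=.
  by rewrite normc_real real_normK// num_real.
have c0 := @fourier_cst_gt0 R d.
(* Width going to infinity for the Gaussian paired with U; by duality the one
   paired with u concentrates at x0. *)
pose s (n : nat) : R := n.+1%:R^-1.
have s0 n : 0 < s n by rewrite invr_gt0.
pose g n xi := (gauss (s n) xi)%:C * echar (dotp xi (- x0)).
have mg n : cmeasurable (g n).
  apply: cmeasurableM; first by apply: cmeasurable_real; exact: measurable_gauss.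
  by apply: cmeasurable_echar; exact: measurable_dotpl.
have fg n x : ft (g n) x = (gauss_mass d (s n) * gauss n.+1%:R (x - x0))%:C.
  by rewrite /g ft_modulate ft_gauss// invrK.
pose A n := (gauss_mass d n.+1%:R)^-1 * \int[mu]_x (u x * gauss n.+1%:R (x - x0)).
have Acvg : A n @[n --> \oo] --> u x0 by exact: gauss_approx.
have pair n : cintegral (fun xi => U xi * g n xi) = (c^-1 * A n)%:C.
  have [C1 h1] := gauss_le_wt d 0 (s0 n).
  have [C2 h2] := gauss_shift_le x0 (ltr0Sn R n).
  have m0 := gauss_mass_gt0 (d := d) (s0 n).
  pose C := Num.max C1 (gauss_mass d (s n) * C2).
  rewrite (@fourier2_pairing _ _ _ _ _ C uU (mg n)).
  - have -> : (fun x => (u x)%:C * ft (g n) x) =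
        (fun x => (gauss_mass d (s n))%:C * (u x * gauss n.+1%:R (x - x0))%:C).
      by apply/funext => x; rewrite fg !rmorphM /=; ring.
    have iug : cintegrable (fun x => (u x * gauss n.+1%:R (x - x0))%:C).
      apply: (cintegrable_le _ (rintegrableZ C2 (rintegrable_normc_wt u2))) => [|x].
        apply: cmeasurable_real; apply: measurable_funM => //.
        by apply: measurableT_comp; [exact: measurable_gauss|exact: measurable_shift].
      rewrite !normc_real normrM (gtr0_norm (gauss_gt0 _ _)) mulrCA ler_wpM2l//.
    rewrite cintegralZ//.
    have -> : cintegral (fun x => (u x * gauss n.+1%:R (x - x0))%:C) =
        (gauss_mass d n.+1%:R * A n)%:C.
      rewrite /cintegral /=; congr Complex; last by rewrite /Rintegral integral0.
      by rewrite /A mulrA mulfV ?mul1r// gt_eqF// gauss_mass_gt0.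
    rewrite -!rmorphM /=; congr (_ %:C); move: (A n) => An; rewrite !mulrA;
      congr (_ * _).
    have E : c ^+ 2 * (gauss_mass d (s n) * gauss_mass d n.+1%:R) = 1.
      by have := gauss_mass_inv (d := d) (s0 n); rewrite /s invrK.
    have cn : c != 0 by rewrite gt_eqF.
    by apply: (mulfI cn); rewrite mulfV// -[RHS]E; ring.
  - move=> x; rewrite normcM_echar normc_real gtr0_norm ?gauss_gt0//.
    have := h1 x; rewrite expr0 mul1r => /le_trans; apply.
    by rewrite ler_wpM2r ?wt_int_ge0// le_max lexx.
  - move=> x; rewrite fg normc_real gtr0_norm ?mulr_gt0 ?gauss_gt0//.
    rewrite (le_trans (ler_wpM2l (ltW m0) (h2 x)))// mulrA.
    by rewrite ler_wpM2r ?wt_int_ge0// le_max lexx orbT.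
have iUe : cintegrable (fun xi => U xi * echar (- dotp xi x0)).
  by have := cintegrable_char (- x0) iU; under eq_fun do rewrite dotpNr.
have lim1 : Normc.normc (cintegral (fun xi => U xi * g n xi) -
     cintegral (fun xi => U xi * echar (- dotp xi x0))) @[n --> \oo] --> 0.
  apply: (cintegral_cvg _ _ (rintegrable_normc iU)).
  - by move=> n; apply: cmeasurableM => //; exact: cintegrable_meas.
  - exact: cintegrable_meas iUe.
  - move=> n x; rewrite /g mulrA normcM_echar Normc.normcM normc_real gtr0_norm
    ?gauss_gt0//.
    rewrite ler_piMr ?normc_ge0// /gauss -[leRHS]expR0 ler_expR oppr_le0.
    by rewrite mulr_ge0 ?dotp_ge0// divr_ge0// ltW.
  - by move=> x; rewrite normcM_echar.
  move=> x.
  have -> : (fun n => Normc.normc (U x * g n x - U x * echar (- dotp x x0))) =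
    (fun n => Normc.normc (U x) * `|expR (- (s n / 2 * dotp x x)) - 1|).
    apply/funext => n; rewrite /g dotpNr.
    rewrite -mulrBr -[X in _ - X]mul1r -mulrBl mulrA normcM_echar Normc.normcM.
    by rewrite -(rmorph1 (real_complex R)) -rmorphB normc_real.
  rewrite -(mulr0 (Normc.normc (U x))); apply: cvgM; first exact: cvg_cst.
  have -> : 0 = `|expR (- (0 / 2 * dotp x x)) - 1| :> R.
    by rewrite mul0r mul0r oppr0 expR0 subrr normr0.
  apply: cvg_norm; apply: cvgB; last exact: cvg_cst.
  apply: (cvg_comp _ expR); last exact: continuous_expR.
  apply: cvgN; apply: cvgM; last exact: cvg_cst.
  apply: cvgM; last exact: cvg_cst.
  exact: cvg_harmonic.
set L := cintegral (fun xi => U xi * echar (- dotp xi x0)) in lim1 *.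
have lim2 : Normc.normc ((c^-1 * A n)%:C - L) @[n --> \oo] --> 0.
  by move: lim1; under eq_fun do rewrite pair.
suff LE : L = (c^-1 * u x0)%:C.
  by rewrite LE -rmorphM /= mulrA mulfV ?gt_eqF// mul1r.
have lim3 : `|c^-1 * A n - c^-1 * u x0| @[n --> \oo] --> 0.
  rewrite -(normr0 R) -(subrr (c^-1 * u x0)).
  apply: cvg_norm; apply: cvgB; last exact: cvg_cst.
  by apply: cvgM => //; exact: cvg_cst.
have lim4 : (Normc.normc ((c^-1 * A n)%:C - L) + `|c^-1 * A n - c^-1 * u x0|)
  @[n --> \oo] --> 0.
  by rewrite -(addr0 0); apply: cvgD.
apply/eqP; rewrite -subr_eq0; apply/eqP/Normc.eq0_normc/eqP.
rewrite eq_le normc_ge0 andbT.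
apply: (@cvgr_to_ge _ _ _ _ _ _ _ lim4).
apply: nearW => n.
have -> : L - (c^-1 * u x0)%:C = - ((c^-1 * A n)%:C - L) + (c^-1 * A n - c^-1 *
  u x0)%:C.
  by rewrite rmorphB /=; ring.
by rewrite (le_trans (le_normcD _ _))// normcN normc_real.
Qed.

End inversion.

(** * Bump functions and the decay of their transforms *)

Section flat_function.
Context {R : realType}.

(** The derivative of [t^-j exp (- 1 / t)] is a combination of functions of the
    same form; this family replaces the successive derivatives of the profile
    of the bump. *)
Definition flat (j : nat) (t : R) : R :=
  if 0 < t then t^-1 ^+ j * expR (- t^-1) else 0.

Lemma flat_ge0 j t : 0 <= flat j t.
Proof.
rewrite /flat; case: ifP => // t0.
by rewrite mulr_ge0 ?expR_ge0// exprn_ge0// invr_ge0 ltW.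
Qed.

Lemma flat_le j N t : flat j t <= (j + N).+1%:R ^+ (j + N) * `|t| ^+ N.
Proof.
rewrite /flat; case: ifPn => [t0|_]; last by rewrite mulr_ge0 ?exprn_ge0.
rewrite gtr0_norm// -ler_pdivrMr ?exprn_gt0// mulrAC -exprVn -exprD.
rewrite expRN ler_pdivrMr ?expR_gt0// exprn_le_expR// invr_ge0 ltW//.
Qed.

(** At the origin [flat_le] with [N = 2] gives a quadratic bound, hence a
    vanishing derivative. *)
Lemma is_derive_flat j (t : R) :
  is_derive t (1 : R) (flat j) (- j%:R * flat j.+1 t + flat j.+2 t).
Proof.
have [t0|t0|->] := ltgtP t 0.
- rewrite {2 3}/flat !ltNge !(ltW t0)/= mulr0 addr0.
  apply: (@near_eq_is_derive _ _ _ (cst 0)) => //.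
  have : \forall x \near t, x < 0 by exact: lt_nbhsl.
  by apply: filterS => x x0; rewrite /flat ltNge ltW.
- have tn : t != 0 by rewrite gt_eqF.
  apply: (@near_eq_is_derive _ _ _ (fun x : R => x^-1 ^+ j * expR (- x^-1) : R)) => //.
    have : \forall x \near t, 0 < x by exact: lt_nbhsr.
    by apply: filterS => x x0; rewrite /flat x0.
  have hV : is_derive t (1 : R) (fun t : R => t^-1) (- t^-1 ^+ 2).
    rewrite exprVn -[X in is_derive _ _ _ X]mulr1.
    exact: (@is_deriveV R id t 1 1 tn (is_derive_id _ _)).
  have hX : is_derive t (1 : R) (fun x : R => x^-1 ^+ j : R) (- j%:R * t^-1 ^+ j.+1).
    have := @is_deriveX _ _ (fun x : R => x^-1 : R) j t 1 _ hV; rewrite exprfctE.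
    rewrite (_ : _ *: _ = - j%:R * t^-1 ^+ j.+1)//= /GRing.scale /=.
    case: (j) => [|i] /=; first by rewrite mulr0n oppr0 !mul0r.
    by rewrite !exprS; ring.
  have hE : is_derive t (1 : R) (fun x : R => expR (- x^-1)) (t^-1 ^+ 2 * expR
    (- t^-1)).
    have hN := is_deriveN hV.
    have := @is_derive1_comp R expR (fun x : R => - x^-1) t _ _ (is_derive_expR _) hN.
    by move=> h; apply: is_derive_eq; rewrite /GRing.scale /=; ring.
  have hM := is_deriveM hX hE.
  by apply: is_derive_eq; rewrite /flat t0 /GRing.scale /= !exprS; ring.
have f0 i : flat i 0 = 0 :> R by rewrite /flat ltxx.
rewrite !f0 mulr0 addr0.
apply: (is_derive_quadratic (C := (j + 2).+1%:R ^+ (j + 2))) => h _.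
rewrite add0r f0 subr0 mulr0 subr0 ger0_norm ?flat_ge0//.
by rewrite (le_trans (flat_le j 2 h))// real_normK ?num_real.
Qed.

Lemma continuous_flat j : continuous (flat j).
Proof.
move=> t; apply/differentiable_continuous/derivable1_diffP.
by have [] := is_derive_flat j t.
Qed.

End flat_function.

Section bump.
Context {R : realType} {d : nat}.
Local Notation T := 'rV[R]_d.
Variable delta : R.
Hypothesis delta_gt0 : 0 < delta.
Implicit Types (f g : T -> R) (x y z xi : T).

Let prof x : R := 1 - delta ^- 2 * dotp x x.

(** The linear span of the functions [flat j (prof x)] over the polynomials.
    Polynomials have to be allowed since the derivative of [prof] is linear. *)
Inductive bump_class : (T -> R) -> Prop :=
| bump_flat j : bump_class (fun x => flat j (prof x))
| bump_dotp y f : bump_class f -> bump_class (fun x => dotp x y * f x)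
| bump_add f g : bump_class f -> bump_class g -> bump_class (fun x => f x + g x)
| bump_scale (k : R) f : bump_class f -> bump_class (fun x => k * f x).

Let enorm_lt x : (0 < prof x) = (enorm x < delta).
Proof.
rewrite /prof subr_gt0 -sqr_enorm -exprVn -exprMn mulrC.
rewrite expr_lt1// ?mulr_ge0 ?enorm_ge0 ?invr_ge0 ?ltW//.
by rewrite ltr_pdivrMr// mul1r.
Qed.

Let measurable_prof : measurable_fun setT prof.
Proof.
by apply: measurable_funB => //; apply: measurable_funM => //; exact: measurable_dotpp.
Qed.

Lemma bump_class_le f : bump_class f ->
  measurable_fun setT f /\ exists C, forall x, `|f x| <= C * \1_(eball delta) x.
Proof.
elim=> {f} [j|y f _ [mf [C hC]]|f g _ [mf [C hC]] _ [mg [C' hC']]|k f _ [mf [C hC]]].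
- split.
    apply: measurableT_comp => //.
    by apply: continuous_measurable_fun; exact: continuous_flat.
  exists (j.+1%:R ^+ j) => x; rewrite ger0_norm ?flat_ge0// indicE.
  case: (boolP (x \in _)) => [_|]; first by have := flat_le j 0 (prof x);
    rewrite addn0 expr0.
  by rewrite notin_setE /eball /= -enorm_lt /flat => /negP/negbTE ->; rewrite mulr0.
- split; first by apply: measurable_funM => //; exact: measurable_dotpl.
  exists ((1 + d%:R * delta) * norm1 y * C) => x.
  rewrite normrM -[leRHS]mulrA; have := hC x; rewrite indicE.
  case: (boolP (x \in _)) => [|_]; last first.
    by rewrite !mulr0 => h; rewrite (le_trans (ler_wpM2l (normr_ge0 _) h)) ?mulr0.
  rewrite inE /eball /= => xd h; apply: ler_pM => //.
  rewrite (le_trans (abs_dotp_le _ _))// ler_wpM2r ?norm1_ge0//.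
  by rewrite lerD2l (le_trans (norm1_le_enorm x))// ler_wpM2l// ltW.
- split; first exact: measurable_funD.
  exists (C + C') => x; rewrite (le_trans (ler_normD _ _))// mulrDl.
  by rewrite lerD.
- split; first exact: measurable_funM.
  by exists (`|k| * C) => x; rewrite normrM -mulrA ler_wpM2l.
Qed.

Lemma bump_class_rapid f : bump_class f ->
  measurable_fun setT f /\ exists C, forall x, `|f x| <= C * wt_int x.
Proof.
move=> /bump_class_le[mf [C hC]]; split => //.
exists (`|C| * (1 + d%:R * delta) ^+ (2 * d)) => x.
apply: (le_trans (hC x)); apply: (@le_trans _ _ (`|C| * \1_(eball delta) x)).
  by rewrite ler_wpM2r ?ler_norm.
by rewrite -mulrA ler_wpM2l// indic_eball_le// ltW.
Qed.

Lemma bump_class_derivative f y : bump_class f ->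
  exists2 Df, bump_class Df & line_derivative y f Df.
Proof.
elim=> {f} [j|z f bf [Df bDf lf]|f g bf [Df bDf lf] bg [Dg bDg lg]|k f bf [Df bDf lf]].
- exists (fun x => (- 2 * delta ^- 2) * (dotp x y * (- j%:R * flat j.+1 (prof
  x) + flat j.+2 (prof x)))).
    apply: bump_scale; apply: bump_dotp; apply: bump_add; last exact: bump_flat.
    by apply: bump_scale; exact: bump_flat.
  move=> x t.
  have hp : is_derive t (1 : R) (fun s : R => prof (x + s *: y)) (- 2 * delta
    ^- 2 * dotp (x + t *: y) y).
    have -> : (fun s : R => prof (x + s *: y)) =
      (fun s : R => 1 - delta ^- 2 * (dotp x x + 2 * (s * dotp x y) + s ^+ 2 *
        dotp y y)).
      apply/funext => s; rewrite /prof; congr (1 - _ * _).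
      by rewrite dotpDl !dotpDr !dotpZl !dotpZr (dotpC y x); ring.
    by apply: is_derive_eq; rewrite dotpDl dotpZl /GRing.scale /=; ring.
  have hf := is_derive_flat j (prof (x + t *: y)).
  have := @is_derive1_comp R (flat j) (fun s : R => prof (x + s *: y)) t _ _ hf hp.
  by move=> H; apply: is_derive_eq; rewrite /GRing.scale /=; ring.
- exists (fun x => dotp y z * f x + dotp x z * Df x).
    by apply: bump_add; [exact: bump_scale|exact: bump_dotp].
  exact: (line_derivativeM (line_derivative_dotp z y) lf).
- exists (fun x => Df x + Dg x); first exact: bump_add.
  by move=> x t; have h1 := lf x t; have h2 := lg x t; exact: is_deriveD.
- exists (fun x => k * Df x); first exact: bump_scale.
  exact: line_derivativeZ.
Qed.

Lemma bump_class_cintegrable f : bump_class f -> cintegrable (fun x => (f x)%:C).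
Proof. by move=> /bump_class_rapid[mf [C hC]]; exact: rapid_cintegrable hC. Qed.

(** One more power of [wt xi = 1 + \sum_i |xi_i|] is gained by applying the
    induction hypothesis to [f] and to its derivatives along the axes, whose
    transforms are those of [f] multiplied by [i xi_i]. *)
Lemma bump_class_ft_decay N f : bump_class f ->
  exists C, forall xi, wt xi ^+ N * Normc.normc (ft (fun x => (f x)%:C) xi) <= C.
Proof.
elim: N f => [|N ih] f bf.
  exists (2 * \int[@lebesgue_rV R d]_x Normc.normc (f x)%:C) => xi; rewrite expr0 mul1r.
  by apply: ft_bounded; exact: bump_class_cintegrable.
have hi (i : 'I_d) : exists C, forall xi,
    wt xi ^+ N * (`|xi ord0 i| * Normc.normc (ft (fun x => (f x)%:C) xi)) <= C.
  have [Df bDf lf] := bump_class_derivative (delta_mx ord0 i) bf.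
  have [DDf bDDf lDf] := bump_class_derivative (delta_mx ord0 i) bDf.
  have [C hC] := ih _ bDf; exists C => xi.
  have [mf [C1 h1]] := bump_class_rapid bf.
  have [mDf [C2 h2]] := bump_class_rapid bDf.
  have [mDDf [C3 h3]] := bump_class_rapid bDDf.
  pose K := `|C1| + `|C2| + `|C3|.
  have hK C' x : C' <= K -> C' * wt_int x <= K * @wt_int R d x.
    by move=> h; rewrite ler_wpM2r// wt_int_ge0.
  have n1 := normr_ge0 C1; have n2 := normr_ge0 C2; have n3 := normr_ge0 C3.
  have m1 := ler_norm C1; have m2 := ler_norm C2; have m3 := ler_norm C3.
  have k1 : C1 <= K by rewrite /K; lra.
  have k2 : C2 <= K by rewrite /K; lra.
  have k3 : C3 <= K by rewrite /K; lra.
  have E := ft_line_derivative (C := K) mf mDf lf lDf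
    (fun x => le_trans (h1 x) (hK C1 x k1)) (fun x => le_trans (h2 x) (hK C2 x k2))
    (fun x => le_trans (h3 x) (hK C3 x k3)) xi.
  have := hC xi; rewrite E.
  rewrite !Normc.normcM normc_real dotpC dotp_delta.
  by rewrite normc_i mul1r.
have [Ci hCi] := choice hi.
have [C0 hC0] := ih _ bf.
exists (C0 + \sum_(i < d) Ci i) => xi.
rewrite exprS -mulrA {1}/wt mulrDl mul1r lerD//.
by rewrite /norm1 mulr_suml ler_sum// => i _; rewrite mulrCA.
Qed.

End bump.

(** * Localisation by translates of a bump *)

Section cutoff.
Context {R : realType} {d : nat}.
Local Notation mu := (@lebesgue_rV R d).
Local Notation T := 'rV[R]_d.
Local Notation c := (@fourier_cst R d).
Variable delta : R.
Hypothesis delta_gt0 : 0 < delta.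

Lemma continuous_sum_ord n (F : 'I_n -> T -> R) : (forall i, continuous (F i)) ->
  continuous (fun x => \sum_i F i x).
Proof.
move=> cF.
suff H (r : seq 'I_n) : continuous (fun x => \sum_(i <- r) F i x) by exact: H.
elim: r => [|i r ih].
  rewrite (_ : (fun x => _) = cst 0); first exact: cst_continuous.
  by apply/funext => x; rewrite big_nil.
rewrite (_ : (fun x => _) = (fun x => F i x + \sum_(j <- r) F j x)).
  by move=> x; exact: (cvgD (cF i x) (ih x)).
by apply/funext => x; rewrite big_cons.
Qed.

Lemma continuous_dotpl (y : T) : continuous (fun x : T => dotp x y).
Proof.
have cc (i : 'I_d) : continuous (fun x : T => x ord0 i) by exact: coord_continuous.
apply: continuous_sum_ord => i x.
exact: (cvgM (cc i x) (cvg_cst _)).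
Qed.

Lemma continuous_dotpp : continuous (fun x : T => dotp x x).
Proof.
have cc (i : 'I_d) : continuous (fun x : T => x ord0 i) by exact: coord_continuous.
apply: continuous_sum_ord => i x.
exact: (cvgM (cc i x) (cc i x)).
Qed.

Lemma bump_class_continuous f : bump_class delta f -> continuous (f : T -> R).
Proof.
have cp : continuous (fun x : T => 1 - delta ^- 2 * dotp x x).
  have c1 : continuous (fun _ : T => 1 : R) by exact: cst_continuous.
  have c2 : continuous (fun _ : T => delta ^- 2 : R) by exact: cst_continuous.
  by move=> x; exact: (cvgB (c1 x) (cvgM (c2 x) (@continuous_dotpp x))).
elim=> {f} [j|y f _ cf|f g _ cf _ cg|k f _ cf] x.
- exact: (cvg_comp _ _ (cp x) (@continuous_flat R j _)).
- exact: (cvgM (@continuous_dotpl y x) (cf x)).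
- exact: (cvgD (cf x) (cg x)).
- have ck : continuous (fun _ : T => k : R) by exact: cst_continuous.
  exact: (cvgM (ck x) (cf x)).
Qed.

Lemma eq_L2norm (u v : T -> R[i]) : u =1 v -> L2norm u = L2norm v.
Proof. by move=> /funext ->. Qed.

Lemma L2norm0 : L2norm (fun _ : T => 0 : R[i]) = 0%E.
Proof.
rewrite /L2norm; under eq_Lnorm do rewrite Normc.normc0.
by rewrite Lnorm0.
Qed.

Lemma rapid_L2 (u : T -> R[i]) (C : R) : cmeasurable u ->
  (forall x, Normc.normc (u x) <= C * wt_int x) -> L2 u.
Proof.
move=> mu' uC; apply: L2_of_rintegrableegrable => //.
have C0 : 0 <= C := wt_int_coef_ge0 (normc_ge0 _) (uC 0).
apply: (rintegrable_le _ (rintegrableZ (C * C) (@rintegrable_wt_int R d))) => [|x].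
  exact: measurable_sqr_normc.
rewrite ger0_norm ?sqr_ge0// expr2.
rewrite (le_trans (ler_pM (normc_ge0 _) (normc_ge0 _) (uC x) (uC x)))//.
rewrite mulrACA ler_wpM2l ?mulr_ge0// ler_piMr ?wt_int_ge0// wt_int_le1//.
Qed.

Lemma bump_class_ft_rapid f : bump_class delta f ->
  exists C, forall xi : T, Normc.normc (ft (fun x => (f x)%:C) xi) <= C * wt_int xi.
Proof.
move=> bf; have [C hC] := bump_class_ft_decay delta_gt0 (2 * d) bf; exists C => xi.
by rewrite /wt_int ler_pdivlMr ?exprn_gt0 ?wt_gt0// mulrC hC.
Qed.

(** The truncations of a compactly supported function are eventually the
    function itself. *)
Lemma bump_class_fourier2 f : bump_class delta f ->
  fourier2 (fun x : T => (f x)%:C) (fourier1 (fun x : T => (f x)%:C)).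
Proof.
move=> bf; have [mf [C hC]] := bump_class_rapid delta_gt0 bf.
have [C' hC'] := bump_class_ft_rapid bf.
have [_ [B hB]] := bump_class_le delta_gt0 bf.
have iF := bump_class_cintegrable delta_gt0 bf.
split.
- by apply: (rapid_L2 (C := C)) => [|x]; [exact: cmeasurable_real|rewrite normc_real].
- apply: (rapid_L2 (C := c * C')) => [|x].
    by apply: cmeasurableM; [exact: cmeasurable_cst|exact: cmeasurable_ft].
  rewrite fourier1E Normc.normcM normc_real gtr0_norm ?fourier_cst_gt0//.
  by rewrite -mulrA ler_wpM2l// ltW// fourier_cst_gt0.
apply: cvg_near_cst; exists (Num.truncn delta).+1 => // n /= dn.
have dn' : delta < n%:R by rewrite (lt_le_trans (truncnS_gt _))// ler_nat.
rewrite -[RHS]L2norm0; apply: eq_L2norm => xi; apply/eqP; rewrite subr_eq0; apply/eqP.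
suff -> : (fun x => (f x)%:C * (\1_(eball n%:R) x)%:C) = (fun x => (f x)%:C) by [].
apply/funext => x; rewrite indicE.
case: (boolP (x \in _)) => [_|]; first by rewrite mulr1.
rewrite notin_setE /eball /= => /negP; rewrite -leNgt => nx.
have := hB x; rewrite indicE memNset ?mulr0; last first.
  by rewrite /eball /= => /lt_trans => /(_ _ dn'); rewrite ltNge nx.
by rewrite normr_le0 => /eqP ->.
Qed.

Lemma bump_class_inversion f (x : T) : bump_class delta f ->
  (f x)%:C = (c ^+ 2)%:C *
    cintegral (fun xi => ft (fun x => (f x)%:C) xi * echar (- dotp xi x)).
Proof.
move=> bf; have F2 := bump_class_fourier2 bf.
have [C' hC'] := bump_class_ft_rapid bf.
have iF := bump_class_cintegrable delta_gt0 bf.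
have iK : cintegrable (ft (fun x => (f x)%:C)).
  exact: (cintegrable_le (cmeasurable_ft iF) (rintegrableZ C'
    (@rintegrable_wt_int R d))).
have iU : cintegrable (fourier1 (fun x : T => (f x)%:C)) by exact: cintegrableZ.
rewrite (fourier2_inversion F2 iU); last exact: (bump_class_continuous bf).
rewrite expr2 rmorphM /= -mulrA; congr (_ * _); rewrite -cintegralZ.
  by apply: eq_cintegral => xi; rewrite fourier1E mulrA.
by have := cintegrable_char (- x) iK; under eq_fun do rewrite dotpNr.
Qed.

Variables (phi : T -> R) (U : T -> R[i]).
Hypothesis phiU : fourier2 (fun x => (phi x)%:C) U.

(** The transform of the product is, up to a phase under the integral, the
    convolution of [U] with the transform of the bump.  To see it, pair [phi]
    with the modulated translate [f (x - y) * echar (dotp x xi)], which by the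
    inversion formula for [f] is the transform of a translate of the conjugate
    of the transform of [f]. *)
Lemma ft_localised f (y xi : T) : bump_class delta f ->
  Normc.normc (ft (fun x => (phi x * f (x - y))%:C) xi) <=
  2 * c * \int[mu]_z (Normc.normc (U z) * Normc.normc (ft (fun x => (f x)%:C)
    (z - xi))).
Proof.
move=> bf; set K := ft (fun x => (f x)%:C).
have [u2 U2 _] := phiU.
have [C hC] := bump_class_ft_rapid bf.
have [mf [B hB]] := bump_class_rapid delta_gt0 bf.
have iF := bump_class_cintegrable delta_gt0 bf.
have c0 := @fourier_cst_gt0 R d.
have mK : cmeasurable K by exact: cmeasurable_ft.
have iK : cintegrable K by exact: (cintegrable_le mK (rintegrableZ C
  (@rintegrable_wt_int R d))).
pose g z := (K (z - xi))^*%C * echar (dotp (z - xi) (- y)).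
have msh : measurable_fun setT (fun z : T => z - xi) := measurable_shift (- xi).
have mg : cmeasurable g.
  apply: cmeasurableM; first by apply: cmeasurable_conj; exact: (cmeasurable_comp mK).
  by apply: cmeasurable_echar; apply: (measurableT_comp (measurable_dotpl (- y))).
have ng z : Normc.normc (g z) = Normc.normc (K (z - xi)) by rewrite
  normcM_echar normc_conj.
have C0 : 0 <= C := wt_int_coef_ge0 (normc_ge0 _) (hC 0).
have B0 : 0 <= B := wt_int_coef_ge0 (normr_ge0 _) (hB 0).
have Kb z : Normc.normc (K (z - xi)) <= C * wt (- xi) ^+ (2 * d) * wt_int z.
  by rewrite (le_trans (hC _))// -mulrA ler_wpM2l// wt_int_shift.
have fb x : `|f (x - y)| <= B * wt (- y) ^+ (2 * d) * wt_int x.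
  by rewrite (le_trans (hB _))// -mulrA ler_wpM2l// wt_int_shift.
have ig : cintegrable g.
  by apply: (cintegrable_le mg (rintegrableZ (C * wt (- xi) ^+ (2 * d))
    (@rintegrable_wt_int R d))) => z; rewrite ng.
have ftg x : ft g x = (c ^- 2 * f (x - y))%:C * echar (dotp x xi).
  have iKe : cintegrable (fun z => K z * echar (- dotp z (x - y))).
    by have := cintegrable_char (- (x - y)) iK; under eq_fun do rewrite dotpNr.
  rewrite /ft -(cintegral_shift xi); last exact: cintegrable_char.
  have -> : (fun z => g (z + xi) * echar (dotp (z + xi) x)) =
     (fun z => echar (dotp x xi) * ((K z * echar (- dotp z (x - y)))^*)%C).
    apply/funext => z; rewrite /g addrK conjcM -echarN opprK.
    rewrite mulrCA -mulrA -!echarD; congr (_ * echar _).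
    by rewrite dotpDl dotpDr (dotpC xi) !dotpNr; ring.
  rewrite cintegralZ; last first.
    by apply: (cintegrable_le _ (rintegrable_normc iKe)) => [|z]; [apply:
      cmeasurable_conj; exact: cintegrable_meas|rewrite normc_conj].
  rewrite mulrC cintegral_conj//; congr (_ * _).
  have := bump_class_inversion (x - y) bf; rewrite -/K => E.
  set I := cintegral _ in E *.
  have -> : I = (c ^- 2 * f (x - y))%:C.
    by rewrite rmorphM /= E mulrA -rmorphM /= mulVf ?mul1r// gt_eqF// exprn_gt0.
  by apply/eqP; rewrite eq_complex /= oppr0 !eqxx.
have key := @fourier2_pairing _ _ _ _ g
  (Num.max (C * wt (- xi) ^+ (2 * d)) (c ^- 2 * (B * wt (- y) ^+ (2 * d)))) phiU mg.
have {}key : cintegral (fun z => U z * g z) = c%:C * cintegral (fun x => (phi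
  x)%:C * ft g x).
  apply: key => x.
    by rewrite ng (le_trans (Kb x))// ler_wpM2r ?wt_int_ge0// le_max lexx.
  rewrite ftg normcM_echar normc_real normrM ger0_norm ?invr_ge0 ?exprn_ge0 ?(ltW c0)//.
  rewrite (le_trans (ler_wpM2l _ (fb x))) ?invr_ge0 ?exprn_ge0 ?(ltW c0)// mulrA.
  by rewrite ler_wpM2r ?wt_int_ge0// le_max lexx orbT.
have -> : ft (fun x => (phi x * f (x - y))%:C) xi = c%:C * cintegral (fun z =>
  U z * g z).
  rewrite key mulrA -rmorphM /= -cintegralZ.
    apply: eq_cintegral => x; rewrite ftg mulrA mulrA -!rmorphM /=.
    by congr (_%:C * _); field; rewrite gt_eqF.
  have iH := rintegrableZ (c ^- 2 * (B * wt (- y) ^+ (2 * d)))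
    (rintegrable_normc_wt u2).
  apply: (cintegrable_le _ iH) => [|x].
    by apply: cmeasurableM; [exact: L2_cmeasurable|exact: cmeasurable_ft].
  rewrite Normc.normcM ftg normcM_echar [X in _ * X]normc_real normrM ger0_norm
    ?invr_ge0 ?exprn_ge0 ?(ltW c0)//.
  rewrite [leRHS]mulrCA ler_wpM2l ?normc_ge0// -mulrA ler_wpM2l//.
  by rewrite invr_ge0 exprn_ge0// ltW.
rewrite Normc.normcM normc_real gtr0_norm// (mulrC 2) -mulrA ler_wpM2l ?(ltW c0)//.
apply: normc_cintegral_le.
- by apply: cmeasurableM => //; exact: L2_cmeasurable.
- have iH := rintegrableZ (C * wt (- xi) ^+ (2 * d)) (rintegrable_normc_wt U2).
  apply: (rintegrable_le _ iH) => [|z].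
    apply: measurable_funM; apply: measurable_normc; first exact: L2_cmeasurable.
    exact: (cmeasurable_comp mK).
  rewrite ger0_norm ?mulr_ge0 ?normc_ge0//.
  by rewrite [leRHS]mulrCA ler_wpM2l ?normc_ge0.
- by move=> z; rewrite Normc.normcM ng.
Qed.

End cutoff.

(** * Mollified indicators of balls *)

Section mollified_cutoff.
Context {R : realType} {d : nat}.
Local Notation mu := (@lebesgue_rV R d).
Local Notation T := 'rV[R]_d.
Local Notation c := (@fourier_cst R d).

Lemma rho_scaled_bump_class (delta : R) : 0 < delta ->
  bump_class delta (rho_scaled delta : T -> R).
Proof.
move=> d0.
have -> : (rho_scaled delta : T -> R) = (fun x => (delta^-1 ^+ d * (\int[mu]_y
  Defs.bump y)^-1) *
    flat 0 (1 - delta ^- 2 * dotp x x)).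
  apply/funext => x; rewrite /rho_scaled /rho -mulrA; congr (_ * (_ * _)).
  rewrite /Defs.bump /flat sqr_enorm dotpZl dotpZr expr0 mul1r.
  have -> : delta^-1 * (delta^-1 * dotp x x) = delta ^- 2 * dotp x x by rewrite
    mulrA -expr2 exprVn.
  have -> : (enorm (delta^-1 *: x) < 1) = (0 < 1 - delta ^- 2 * dotp x x).
    rewrite subr_gt0 -[in RHS]sqr_enorm.
    have -> : enorm (delta^-1 *: x) = delta^-1 * enorm x.
      by rewrite /enorm dotpZl dotpZr mulrA -expr2 sqrtrM ?sqr_ge0// sqrtr_sqr
        ger0_norm// invr_ge0 ltW.
    rewrite -exprVn -exprMn expr_lt1// mulr_ge0 ?enorm_ge0// invr_ge0 ltW//.
  by [].
by apply: bump_scale; exact: bump_flat.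
Qed.

Variables (delta b : R) (k : T -> R).
Hypotheses (delta_gt0 : 0 < delta) (b_ge0 : 0 <= b) (bk : bump_class delta k).

(** The cutoff [eta a eps] is the instance [k := rho_scaled (eps / 2)],
    [b := a + eps / 2]. *)
Definition mollified (x : T) : R := \int[mu]_y (k (x - y) * \1_(eball b) y).

Let mk2 : measurable_fun setT (fun p : T * T => k (p.1 - p.2)).
Proof.
have [mk _] := bump_class_rapid delta_gt0 bk.
apply: (measurableT_comp mk); apply: measurable_fun_rV => i.
under eq_fun do rewrite !mxE.
by apply: measurable_funB; apply: (measurableT_comp (measurable_coord i)).
Qed.

Let mslice2 : measurable_fun setT (fun p : T * T => k (p.1 - p.2) * \1_(eball b) p.2).
Proof.
apply: measurable_funM => //.
by apply: (measurableT_comp (measurable_indic_eball b)).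
Qed.

Lemma mollified_slice : exists B, 0 <= B /\ forall x,
  (rintegrable (fun y : T => k (x - y) * \1_(eball b) y) /\ `|mollified x| <= B).
Proof.
have [mk [C hC]] := bump_class_rapid delta_gt0 bk.
have C0 : 0 <= C := wt_int_coef_ge0 (normr_ge0 _) (hC 0).
have h (x y : T) : `|k (x - y) * \1_(eball b) y| <= C * \1_(eball b) y.
  rewrite normrM (ger0_norm (_ : 0 <= \1_(eball b) y))// ler_wpM2r//.
  by rewrite (le_trans (hC _))// ler_piMr// wt_int_le1.
have iB := rintegrableZ C (@rintegrable_indic_eball R d b b_ge0).
have mx (x : T) : measurable_fun setT (fun y : T => k (x - y) * \1_(eball b) y).
  exact: (measurableT_comp mslice2 (measurable_pair1 x)).
exists (C * \int[mu]_y (\1_(eball b) y)); split.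
  by rewrite mulr_ge0// Rintegral_ge0.
move=> x; split; first exact: (rintegrable_le (mx x) iB).
rewrite -RintegralZl//; last exact: rintegrable_indic_eball.
exact: abs_Rintegral_le.
Qed.

Lemma measurable_mollified : measurable_fun setT mollified.
Proof.
have [B [_ hB]] := mollified_slice.
exact: (measurable_partial mslice2 (fun x => (hB x).1)).
Qed.

Lemma mollified_support : exists r : R, 0 <= r /\ forall x : T, r <= enorm x ->
  mollified x = 0.
Proof.
have [_ [C hC]] := bump_class_le delta_gt0 bk.
exists (d%:R * delta + d%:R * b + 1); split.
  by rewrite !addr_ge0 ?mulr_ge0// ltW.
move=> x rx; rewrite /mollified.
rewrite (_ : (fun y => _) = cst 0); first by rewrite /Rintegral integral0.
apply/funext => y; rewrite [in LHS]indicE; case: (boolP (y \in _)) => [|_];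
  last by rewrite mulr0.
rewrite inE /eball /= => yb; rewrite mulr1; apply/eqP; rewrite -normr_le0.
rewrite (le_trans (hC _))// indicE memNset ?mulr0// /eball /= => xy.
have : norm1 x <= d%:R * delta + d%:R * b.
  have := norm1D (x - y) y; rewrite subrK => /le_trans; apply.
  by apply: lerD; rewrite (le_trans (norm1_le_enorm _))// ler_wpM2l// ltW.
have := enorm_le_norm1 x; lra.
Qed.

Variables (phi : T -> R) (U : T -> R[i]).
Hypothesis phiU : fourier2 (fun x => (phi x)%:C) U.

Lemma cintegrable_mollified : cintegrable (fun x => (phi x * mollified x)%:C).
Proof.
have [u2 _ _] := phiU.
have mphi : measurable_fun setT phi by have [] := L2_cmeasurable u2.
have [B [B0 hB]] := mollified_slice.
have [r [r0 hr]] := mollified_support.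
have iH := rintegrableZ B (rintegrableD (L2_rintegrable u2)
  (@rintegrable_indic_eball R d r r0)).
apply: (cintegrable_le _ iH) => [|x].
  by apply: cmeasurable_real; apply: measurable_funM => //; exact: measurable_mollified.
rewrite !normc_real normrM indicE.
have n0 := normr_ge0 (phi x).
case: (boolP (x \in _)) => [_|].
  by rewrite mulrC ler_pM ?(hB x).2//; exact: le_sqrD1.
rewrite notin_setE /eball /= => /negP; rewrite -leNgt => /hr ->.
by rewrite normr0 mulr0 addr0 mulr_ge0// sqr_ge0.
Qed.

Lemma cintegrable_localised y : cintegrable (fun x => (phi x * k (x - y))%:C).
Proof.
have [u2 _ _] := phiU.
have mphi : measurable_fun setT phi by have [] := L2_cmeasurable u2.
have [mk [C hC]] := bump_class_rapid delta_gt0 bk.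
have C0 : 0 <= C := wt_int_coef_ge0 (normr_ge0 _) (hC 0).
apply: (cintegrable_le _ (rintegrableZ (C * wt (- y) ^+ (2 * d))
  (rintegrable_normc_wt u2))) => [|x].
  apply: cmeasurable_real; apply: measurable_funM => //.
  by apply: measurableT_comp => //; exact: (measurable_shift (- y)).
rewrite !normc_real normrM [leRHS]mulrCA ler_wpM2l//.
by rewrite (le_trans (hC _))// -mulrA ler_wpM2l// wt_int_shift.
Qed.

Lemma ft_mollified xi : ft (fun x => (phi x * mollified x)%:C) xi =
  cintegral (fun y => (\1_(eball b) y)%:C * ft (fun x => (phi x * k (x - y))%:C) xi).
Proof.
have [u2 _ _] := phiU.
have mphi : measurable_fun setT phi by have [] := L2_cmeasurable u2.
have [B [B0 hB]] := mollified_slice.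
have [mk [C hC]] := bump_class_rapid delta_gt0 bk.
have C0 : 0 <= C := wt_int_coef_ge0 (normr_ge0 _) (hC 0).
pose h (p : T * T) := (phi p.1 * (k (p.1 - p.2) * \1_(eball b) p.2))%:C * echar
  (dotp p.1 xi).
have mh : cmeasurable h.
  apply: cmeasurableM.
    apply: cmeasurable_real; apply: measurable_funM => //.
    by apply: (measurableT_comp mphi).
  by apply: cmeasurable_echar; apply: (measurableT_comp (measurable_dotpl xi)).
pose D := (1 + d%:R * b) ^+ (2 * d).
have if_ := rintegrableZ C (rintegrable_normc_wt u2).
have ig_ := rintegrableZ D (@rintegrable_indic_eball R d b b_ge0).
have hfg x y : Normc.normc (h (x, y)) <= (C * (Normc.normc (phi x)%:C * wt_int
  x)) * (D * \1_(eball b) y).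
  rewrite /h normcM_echar !normc_real /= !normrM.
  rewrite (ger0_norm (_ : 0 <= \1_(eball b) y))//.
  rewrite [leRHS](_ : _ = `|phi x| * (C * (D * wt_int x) * \1_(eball b) y));
    last by ring.
  rewrite ler_wpM2l// indicE.
  case: (boolP (y \in _)) => [|_]; last by rewrite !mulr0.
  rewrite inE /eball /= => yb; rewrite !mulr1.
  rewrite (le_trans (hC _))// ler_wpM2l// (le_trans (wt_int_shift _ _))//.
  rewrite ler_wpM2r ?wt_int_ge0// /D wtN lerXn2r ?nnegrE ?(ltW (wt_gt0 _))//.
    by rewrite addr_ge0// mulr_ge0.
  by rewrite lerD2l (le_trans (norm1_le_enorm _))// ler_wpM2l// ltW.
have FU := cintegrable_Fubini mh if_ ig_ hfg.
transitivity (cintegral (fun x => cintegral (fun y => h (x, y)))).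
  apply: eq_cintegral => x.
  have -> : (fun y => h (x, y)) = (fun y => ((phi x)%:C * echar (dotp x xi)) *
    (k (x - y) * \1_(eball b) y)%:C).
    by apply/funext => y; rewrite /h /= rmorphM /= mulrAC.
  rewrite cintegralZ.
    rewrite rmorphM /= mulrAC; congr (_ * _).
    by rewrite /cintegral /=; congr Complex; rewrite /Rintegral integral0.
  exact: (cintegrable_real (hB x).1).
rewrite FU; apply: eq_cintegral => y; rewrite /ft.
have iy := cintegrable_localised y.
rewrite -cintegralZ; last exact: cintegrable_char.
by apply: eq_cintegral => x; rewrite /h /= !rmorphM /=; ring.
Qed.

(** [phi * mollified] is a superposition of the products treated in
    [ft_localised], whose bound does not depend on [y], with [y] in a ball. *)
Lemma ft_mollified_le : exists C, 0 <= C /\ forall xi,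
  Normc.normc (ft (fun x => (phi x * mollified x)%:C) xi) <=
  C * \int[mu]_z (Normc.normc (U z) * Normc.normc (ft (fun x => (k x)%:C) (z - xi))).
Proof.
have [u2 U2 _] := phiU.
have c0 := @fourier_cst_gt0 R d.
have mphi : measurable_fun setT phi by have [] := L2_cmeasurable u2.
pose I := \int[mu]_y (\1_(eball b) y : R).
have I0 : 0 <= I by apply: Rintegral_ge0.
exists (2 * (2 * c * I)); split; first by rewrite !mulr_ge0// ltW.
move=> xi; rewrite ft_mollified.
set J := \int[mu]_z _.
have J0 : 0 <= J by apply: Rintegral_ge0 => z _; rewrite mulr_ge0 ?normc_ge0.
have -> : 2 * (2 * c * I) * J = 2 * \int[mu]_y (2 * c * J * \1_(eball b) y).
  by rewrite RintegralZl//; [rewrite -/I; ring|exact: rintegrable_indic_eball].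
apply: normc_cintegral_le.
- apply: cmeasurableM; first by apply: cmeasurable_real; exact: measurable_indic_eball.
  apply: (cmeasurable_partial (h := fun p : T * T => (phi p.2 * k (p.2 -
    p.1))%:C * echar (dotp p.2 xi))).
    apply: cmeasurableM.
      apply: cmeasurable_real; apply: measurable_funM; first by apply:
        (measurableT_comp mphi).
      exact: (measurableT_comp mk2 (measurable_fun_pair measurable_snd measurable_fst)).
    by apply: cmeasurable_echar; apply: (measurableT_comp (measurable_dotpl xi)).
  by move=> y /=; apply: cintegrable_char; exact: cintegrable_localised.
- by apply: rintegrableZ; exact: rintegrable_indic_eball.
- move=> y; rewrite Normc.normcM normc_real ger0_norm// mulrC ler_wpM2r//.
  exact: (ft_localised delta_gt0 phiU y xi bk).
Qed.

End mollified_cutoff.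

(** * Linear relations between transforms *)

Section relation.
Context {R : realType} {d : nat}.
Local Notation mu := (@lebesgue_rV R d).
Local Notation T := 'rV[R]_d.
Local Notation c := (@fourier_cst R d).

Lemma ae_eqC_sqr (u v : T -> R[i]) : cmeasurable u -> cmeasurable v ->
  rintegrable (fun x => Normc.normc (u x - v x) ^+ 2) ->
  \int[mu]_x (Normc.normc (u x - v x) ^+ 2) <= 0 -> ae_eqC u v.
Proof.
move=> mu' mv i2 le0.
have m2 : measurable_fun setT (fun x => (Normc.normc (u x - v x) ^+ 2)%:E).
  by apply/measurable_EFinP; apply: measurable_sqr_normc; exact: cmeasurableB.
have : (\int[mu]_x `|(Normc.normc (u x - v x) ^+ 2)%:E| = 0)%E.
  under eq_integral => x _ do rewrite gee0_abs ?lee_fin ?sqr_ge0//.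
  rewrite -[LHS]fineK; last exact: integrable_fin_num.
  congr EFin; apply/eqP; rewrite eq_le le0 /=.
  by apply: Rintegral_ge0 => x _; exact: sqr_ge0.
move/(ae_eq_integral_abs mu measurableT m2); apply: filterS => x /= /(_ I) /eqP.
rewrite eqe sqrf_eq0 => /eqP /Normc.eq0_normc /eqP.
by rewrite subr_eq0 => /eqP.
Qed.

Lemma sqr_le_double (p q s : R) : 0 <= p -> 0 <= q -> 0 <= s -> p <= q + s ->
  p ^+ 2 <= 2 * q ^+ 2 + 2 * s ^+ 2.
Proof.
move=> p0 q0 s0 h.
have h2 : p ^+ 2 <= (q + s) ^+ 2 by rewrite lerXn2r ?nnegrE ?addr_ge0.
have := sqr_ge0 (q - s); lra.
Qed.

(** Once the truncation radius exceeds [r], the combination of the transforms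
    of the truncations of [w] and [u] is the fixed function [- fourier1 f];
    it also converges in [L^2] to [W - z U]. *)
Lemma fourier2_lincomb (u w f : T -> R[i]) U W (z : R[i]) (r : R) :
  fourier2 u U -> fourier2 w W -> cintegrable f ->
  ae_eqC (fun x => z * u x) (fun x => w x + f x) ->
  (forall x, r <= enorm x -> f x = 0) ->
  ae_eqC (fun xi => W xi - z * U xi) (fun xi => - fourier1 f xi).
Proof.
move=> [u2 U2 uU] [w2 W2 wW] iF zuwf fr.
have mf1 : cmeasurable (fourier1 f) by apply: cmeasurableM; [exact:
  cmeasurable_cst|exact: cmeasurable_ft].
have [mU mW] := (L2_cmeasurable U2, L2_cmeasurable W2).
have [mu' mw] := (L2_cmeasurable u2, L2_cmeasurable w2).
pose A n xi := W xi - fourier1 (fun x => w x * (\1_(eball n%:R) x)%:C) xi.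
pose B n xi := U xi - fourier1 (fun x => u x * (\1_(eball n%:R) x)%:C) xi.
have mA n : cmeasurable (A n).
  by apply: cmeasurableB => //; apply: cmeasurableM; [exact:
    cmeasurable_cst|apply: cmeasurable_ft; exact: cintegrable_trunc].
have mB n : cmeasurable (B n).
  by apply: cmeasurableB => //; apply: cmeasurableM; [exact:
    cmeasurable_cst|apply: cmeasurable_ft; exact: cintegrable_trunc].
have mD : cmeasurable (fun xi => W xi - z * U xi).
  by apply: cmeasurableB => //; apply: cmeasurableM => //; exact: cmeasurable_cst.
have mE : cmeasurable (fun xi => - fourier1 f xi) by exact: cmeasurableN.
have DE n : r <= n%:R -> (fun xi => W xi - z * U xi - - fourier1 f xi) = (fun
  xi => A n xi - z * B n xi).
  move=> rn; apply/funext => xi; rewrite /A /B !fourier1E.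
  have iw : cintegrable (fun x => w x * (\1_(eball n%:R) x)%:C) by exact:
    cintegrable_trunc.
  have iu : cintegrable (fun x => u x * (\1_(eball n%:R) x)%:C) by exact:
    cintegrable_trunc.
  have E : ft f xi = z * ft (fun x => u x * (\1_(eball n%:R) x)%:C) xi - ft
    (fun x => w x * (\1_(eball n%:R) x)%:C) xi.
    rewrite -ftZ// /ft -cintegralB; [|exact: (cintegrable_char xi (cintegrableZ
      z iu))|exact: cintegrable_char].
    have me : cmeasurable (fun x => echar (dotp x xi)) by apply:
      cmeasurable_echar; exact: measurable_dotpl.
    apply: cintegral_ae.
    - by apply: cmeasurableM => //; exact: cintegrable_meas.
    - apply: cmeasurableB; apply: cmeasurableM => //; first by apply:
      cintegrable_meas; exact: cintegrableZ.
      exact: cintegrable_meas.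
    move: zuwf; apply: filterS => x /= e.
    rewrite -mulrBl; congr (_ * _); rewrite mulrA e indicE.
    case: (boolP (x \in _)) => [_|]; first by rewrite !mulr1; ring.
    rewrite notin_setE /eball /= => /negP; rewrite -leNgt => nx.
    by rewrite fr ?(le_trans rn)// !mulr0 subrr.
  by rewrite E; ring.
have M n : r <= n%:R -> forall e, 0 <= e -> (L2norm (A n) <= e%:E)%E -> (L2norm
  (B n) <= e%:E)%E ->
  rintegrable (fun x => Normc.normc (W x - z * U x - - fourier1 f x) ^+ 2) /\
  \int[mu]_x (Normc.normc (W x - z * U x - - fourier1 f x) ^+ 2) <= 2 * (1 +
    Normc.normc z ^+ 2) * e ^+ 2.
  move=> rn e e0 Ae Be.
  have [iA2 A2] := L2norm_le (mA n) e0 Ae.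
  have [iB2 B2] := L2norm_le (mB n) e0 Be.
  have pt x : Normc.normc (W x - z * U x - - fourier1 f x) ^+ 2 <=
     2 * Normc.normc (A n x) ^+ 2 + 2 * Normc.normc z ^+ 2 * Normc.normc (B n x) ^+ 2.
    have -> : W x - z * U x - - fourier1 f x = A n x - z * B n x by exact:
      (congr1 (@^~ x) (DE n rn)).
    have h : Normc.normc (A n x - z * B n x) <= Normc.normc (A n x) +
      Normc.normc z * Normc.normc (B n x).
      by rewrite (le_trans (normcB_le _ _))// Normc.normcM.
    have a0 := normc_ge0 (A n x); have b0 : 0 <= Normc.normc z * Normc.normc (B
      n x) by rewrite mulr_ge0 ?normc_ge0.
    rewrite -mulrA -exprMn; move: (normc_ge0 (A n x - z * B n x)) a0 b0 h.
    move: (Normc.normc (A n x - _)) (Normc.normc (A n x)) (Normc.normc z *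
      Normc.normc (B n x)) => p q s p0 q0 s0 h.
    exact: sqr_le_double.
  have iS := rintegrableD (rintegrableZ 2 iA2) (rintegrableZ (2 * Normc.normc z
    ^+ 2) iB2).
  have iN : rintegrable (fun x => Normc.normc (W x - z * U x - - fourier1 f x) ^+ 2).
    apply: (rintegrable_le _ iS) => [|x]; last by rewrite ger0_norm ?sqr_ge0.
    by apply: measurable_sqr_normc; exact: cmeasurableB.
  split => //; rewrite (le_trans (Rintegral_le iN iS pt))//.
  rewrite RintegralD//; [|exact: rintegrableZ|exact: rintegrableZ].
  by rewrite !RintegralZl// mulrDr mulr1 mulrDl lerD// ler_wpM2l// mulr_ge0// sqr_ge0.
have nearAB e : 0 < e -> exists n : nat, [/\ r <= n%:R, (L2norm (A n) <=
  e%:E)%E & (L2norm (B n) <= e%:E)%E].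
  move=> e0.
  have nA : \forall n \near \oo, (L2norm (A n) < e%:E)%E.
    by apply: (wW [set y | (y < e%:E)%E]); apply: open_ereal_lt'; rewrite lte_fin.
  have nB : \forall n \near \oo, (L2norm (B n) < e%:E)%E.
    by apply: (uU [set y | (y < e%:E)%E]); apply: open_ereal_lt'; rewrite lte_fin.
  near \oo => n; exists n; split.
  - near: n; exists (Num.truncn r).+1 => // n /= rn.
    by rewrite ltW// (lt_le_trans (truncnS_gt _))// ler_nat.
  - by apply: ltW; near: n.
  - by apply: ltW; near: n.
have [n0 [rn0 An0 Bn0]] := nearAB 1 ltr01.
have [i2 _] := M n0 rn0 1 ler01 An0 Bn0.
apply: ae_eqC_sqr => //.
apply/ler_addgt0Pl => e e0; rewrite addr0.
pose K := 2 * (1 + Normc.normc z ^+ 2).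
have K0 : 0 < K.
  have := sqr_ge0 (Normc.normc z); rewrite /K; lra.
pose e1 := Num.min 1 (e / K).
have e10 : 0 < e1 by rewrite lt_min ltr01 divr_gt0.
have [n [rn An Bn]] := nearAB e1 e10.
have [_] := M n rn e1 (ltW e10) An Bn.
move=> /le_trans; apply; rewrite -/K.
have h1 : e1 <= 1 by rewrite ge_min lexx.
have h2 : K * e1 <= e by rewrite mulrC -ler_pdivlMr// ge_min lexx orbT.
rewrite expr2 mulrA; have : 0 <= K * e1 by rewrite mulr_ge0// ltW.
nra.
Unshelve. all: by end_near. Qed.

(** Setting [U] to 0 on a null set turns estimates valid almost everywhere into
    pointwise ones, as the bootstrap needs. *)
Lemma ae_repair (U : T -> R[i]) (P : T -> Prop) : cmeasurable U -> {ae mu,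
  forall x, P x} ->
  exists U', [/\ cmeasurable U', ae_eqC U U' & forall x, U' x = 0 \/ (P x /\ U'
    x = U x)].
Proof.
move=> mU [N [mN N0 PN]].
exists (fun x => U x * (\1_(~` N) x)%:C); split.
- apply: cmeasurableM => //; apply: cmeasurable_real; apply: measurable_indic;
  exact: measurableC.
- exists N; split => // x /=; rewrite indicE => h.
  apply: contrapT => Nx; apply: h; rewrite mem_set ?mulr1//.
- move=> x; rewrite indicE; case: (boolP (x \in _)) => [|_]; last by left;
  rewrite mulr0.
  rewrite inE /= => Nx; right; split; last by rewrite mulr1.
  by apply: contrapT => nP; apply: Nx; exact: PN.
Qed.

End relation.

(** * Elliptic bootstrap *)

Section bootstrap.
Context {R : realType} {d : nat}.
Local Notation mu := (@lebesgue_rV R d).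
Local Notation T := 'rV[R]_d.
Variable alpha : R.
Hypotheses (alpha_gt0 : 0 < alpha) (alpha_lt2 : alpha < 2).

(** Powers of this weight count the steps of the bootstrap, each of which gains
    [alpha] derivatives. *)
Definition wta (x : T) : R := wt x `^ alpha.

Lemma wta_ge1 x : 1 <= wta x.
Proof.
have := @ge0_ler_powR _ alpha (ltW alpha_gt0) 1 (wt x).
by rewrite powR1 !nnegrE ler01 (ltW (wt_gt0 _)) wt_ge1 => ->.
Qed.

Lemma wta_gt0 x : 0 < wta x.
Proof. exact: lt_le_trans (wta_ge1 x). Qed.

Lemma wta_shift x y : wta x <= wta y * wta (y - x).
Proof.
rewrite /wta -powRM ?(ltW (wt_gt0 _))//.
apply: ge0_ler_powR; rewrite ?nnegrE ?mulr_ge0 ?(ltW alpha_gt0) ?(ltW (wt_gt0 _))//.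
by have := wtD y (- (y - x)); rewrite wtN opprB addrC subrK.
Qed.

Lemma wta_le_sqr x : wta x <= wt x ^+ 2.
Proof. by rewrite /wta -powR_mulrn ?(ltW (wt_gt0 _))// ler_powR ?wt_ge1// ltW. Qed.

Lemma exists_wta_ge N : exists n, forall x, wt x ^+ N <= wta x ^+ n.
Proof.
exists (Num.truncn (N%:R / alpha)).+1 => x.
rewrite /wta -!powR_mulrn ?(ltW (wt_gt0 _)) ?powR_ge0// -powRrM ler_powR ?wt_ge1//.
by rewrite mulrC -ler_pdivrMr// ltW// truncnS_gt.
Qed.

(** The low-frequency region is bounded, hence controlled by an integrable
    function. *)
Lemma wta_low Q0 : exists A, 0 <= A /\ forall x, wta x < Q0 -> 1 <= A * wt_int x.
Proof.
have [n hn] := exists_wta_ge (2 * d).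
exists (`|Q0| ^+ n); split; first exact: exprn_ge0.
move=> x xQ; rewrite /wt_int ler_pdivlMr ?exprn_gt0 ?wt_gt0// mul1r.
rewrite (le_trans (hn x))// lerXn2r ?nnegrE ?(ltW (wta_gt0 _))//.
by rewrite (le_trans (ltW xQ))// ler_norm.
Qed.

Variables (U Psi K : T -> R[i]) (Q0 D C1 M : R).
Hypotheses (mU : cmeasurable U) (iU2 : rintegrable (fun x => Normc.normc (U x) ^+ 2)).
Hypotheses (D0 : 0 <= D) (Q00 : 0 <= Q0) (C10 : 0 <= C1).
Hypothesis low : forall x, Q0 <= wta x -> Normc.normc (U x) * wta x <= D *
  Normc.normc (Psi x).
Hypothesis PsiM : forall x, Normc.normc (Psi x) <= M.
Hypothesis conv : forall x, Normc.normc (Psi x) <=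
  C1 * \int[mu]_z (Normc.normc (U z) * Normc.normc (K (z - x))).
Hypothesis mK : cmeasurable K.
Hypothesis Kdecay : forall N, exists C, forall x, wt x ^+ N * Normc.normc (K x) <= C.

(** At high frequency the gain of one power comes from [low]; at low frequency
    nothing is known but [U] in [L^2], and [F] collects that part. *)
Let domination n C : (forall x, Normc.normc (Psi x) * wta x ^+ n <= C) ->
  exists C' (F : T -> R), [/\ 0 <= C', rintegrable F, forall x, 0 <= F x &
    forall x, Normc.normc (U x) * wta x ^+ n.+1 <= C' + F x].
Proof.
move=> hC; have [A [A0 hA]] := wta_low Q0.
have C0 : 0 <= C.
  by rewrite (le_trans _ (hC 0))// mulr_ge0 ?normc_ge0// exprn_ge0// ltW// wta_gt0.
exists (D * C), (fun x => Q0 ^+ n.+1 * (Normc.normc (U x) ^+ 2 + A * wt_int x)); split.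
- exact: mulr_ge0.
- by apply: rintegrableZ; apply: rintegrableD => //; apply: rintegrableZ;
  exact: rintegrable_wt_int.
- by move=> x; rewrite mulr_ge0 ?exprn_ge0// addr_ge0 ?sqr_ge0// mulr_ge0// wt_int_ge0.
move=> x; have q0 := wta_gt0 x.
have n0 := normc_ge0 (U x).
have F0 : 0 <= Q0 ^+ n.+1 * (Normc.normc (U x) ^+ 2 + A * wt_int x).
  by rewrite mulr_ge0 ?exprn_ge0// addr_ge0 ?sqr_ge0// mulr_ge0// wt_int_ge0.
have [lo|hi] := leP Q0 (wta x).
  rewrite exprS mulrA (le_trans (ler_wpM2r (exprn_ge0 n (ltW q0)) (low lo)))//.
  by rewrite -mulrA (le_trans (ler_wpM2l D0 (hC x)))// lerDl.
rewrite (@le_trans _ _ (Q0 ^+ n.+1 * (Normc.normc (U x) ^+ 2 + A * wt_int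
  x)))//; last first.
  by rewrite lerDr mulr_ge0.
rewrite mulrC ler_pM ?exprn_ge0 ?(ltW q0)//.
  by rewrite lerXn2r ?nnegrE ?(ltW q0)// ltW.
rewrite (le_trans (le_sqrD1 n0))// lerD2l; exact: hA.
Qed.

(** [conv] transfers the decay of [U] to [Psi] because the weight is
    submultiplicative and [K] decays rapidly, while by [domination] [U] decays
    one power of the weight better than [Psi]. *)
Lemma bootstrap n : exists C, forall x, Normc.normc (Psi x) * wta x ^+ n <= C.
Proof.
elim: n => [|n [C hC]]; first by exists M => x; rewrite expr0 mulr1.
have [C' [F [C'0 iF F0 hF]]] := domination hC.
(* wta <= wt ^ 2, so 2 n.+1 powers of wt pay for n.+1 powers of wta; the other
   2 d leave an integrable factor. *)
have [CK hK] := Kdecay (2 * n.+1 + 2 * d).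
have CK0 : 0 <= CK.
  by rewrite (le_trans _ (hK 0))// mulr_ge0 ?normc_ge0// exprn_ge0// ltW// wt_gt0.
have iW := @rintegrable_wt_int R d.
pose B := C' * \int[mu]_z wt_int z + \int[mu]_z F z.
exists (C1 * (CK * B)) => x.
have q0 y : 0 < wta y ^+ n.+1 by rewrite exprn_gt0// wta_gt0.
rewrite -ler_pdivlMr// (le_trans (conv x))// -mulrA ler_wpM2l//.
have K1 z : Normc.normc (K z) <= CK * wt_int z / wta z ^+ n.+1.
  rewrite ler_pdivlMr// /wt_int ler_pdivlMr ?exprn_gt0 ?wt_gt0//.
  rewrite (le_trans _ (hK z))// -mulrA mulrC ler_wpM2r ?normc_ge0// exprD.
  by rewrite ler_wpM2r ?exprn_ge0 ?(ltW (wt_gt0 _))// exprM lerXn2r ?nnegrE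
    ?exprn_ge0 ?(ltW (wt_gt0 _)) ?(ltW (wta_gt0 _))// wta_le_sqr.
have iWx : rintegrable (fun z => @wt_int R d (z - x)) by exact: rintegrable_shift.
have iG : rintegrable (fun z => CK / wta x ^+ n.+1 * (C' * wt_int (z - x) + F z)).
  by apply: rintegrableZ; apply: rintegrableD => //; exact: rintegrableZ.
have pt z : Normc.normc (U z) * Normc.normc (K (z - x)) <=
    CK / wta x ^+ n.+1 * (C' * wt_int (z - x) + F z).
  have w0 := @wt_int_ge0 R d (z - x); have w1 := @wt_int_le1 R d (z - x).
  have h1 : Normc.normc (U z) <= (C' + F z) / wta z ^+ n.+1 by rewrite ler_pdivlMr.
  rewrite (le_trans (ler_pM (normc_ge0 _) (normc_ge0 _) h1 (K1 (z - x))))//.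
  have h2 : (wta z ^+ n.+1)^-1 * (wta (z - x) ^+ n.+1)^-1 <= (wta x ^+ n.+1)^-1.
    rewrite -invfM lef_pV2 ?posrE ?mulr_gt0// -exprMn lerXn2r ?nnegrE ?mulr_ge0
      ?(ltW (wta_gt0 _))//.
    exact: wta_shift.
  have -> : (C' + F z) / wta z ^+ n.+1 * (CK * wt_int (z - x) / wta (z - x) ^+ n.+1) =
     (CK * (C' * wt_int (z - x) + F z * wt_int (z - x))) * ((wta z ^+ n.+1)^-1
       * (wta (z - x) ^+ n.+1)^-1) by ring.
  have -> : CK / wta x ^+ n.+1 * (C' * wt_int (z - x) + F z) = (CK * (C' *
    wt_int (z - x) + F z)) * (wta x ^+ n.+1)^-1 by ring.
  apply: ler_pM => //.
  - by rewrite mulr_ge0// addr_ge0 ?mulr_ge0.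
  - by rewrite mulr_ge0// invr_ge0 ltW.
  - by rewrite ler_wpM2l// lerD2l ler_piMr.
have mUK : measurable_fun setT (fun z => Normc.normc (U z) * Normc.normc (K (z - x))).
  apply: measurable_funM; first exact: measurable_normc.
  by apply: measurable_normc; apply: (cmeasurable_comp mK); exact:
    (measurable_shift (- x)).
have iUK : rintegrable (fun z => Normc.normc (U z) * Normc.normc (K (z - x))).
  by apply: (rintegrable_le mUK iG) => z; rewrite ger0_norm// mulr_ge0 ?normc_ge0.
rewrite (le_trans (Rintegral_le iUK iG pt))//.
rewrite RintegralZl//; last by apply: rintegrableD => //; exact: rintegrableZ.
rewrite RintegralD//; last exact: rintegrableZ.
rewrite RintegralZl// (Rintegral_shift (- x) iW) -/B.
by rewrite (_ : CK / _ * B = CK * B / wta x ^+ n.+1)//; ring.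
Qed.

Lemma bootstrap_moments N : rintegrable (fun x => wt x ^+ N * Normc.normc (U x)).
Proof.
have [n hn] := exists_wta_ge (N + 2 * d).
have [C hC] := bootstrap n.
have [C' [F [C'0 iF F0 hF]]] := domination hC.
apply: (rintegrable_le _ (rintegrableD (rintegrableZ C' (@rintegrable_wt_int R
  d)) iF)) => [|x].
  apply: measurable_funM; last exact: measurable_normc.
  by apply: measurable_funX; exact: measurable_wt.
have w0 := @wt_int_ge0 R d x; have w1 := @wt_int_le1 R d x.
rewrite ger0_norm ?mulr_ge0 ?exprn_ge0 ?normc_ge0 ?(ltW (wt_gt0 _))//.
rewrite (@le_trans _ _ ((C' + F x) * wt_int x))//; last first.
  by rewrite mulrDl lerD2l ler_piMr.
rewrite /wt_int ler_pdivlMr ?exprn_gt0 ?wt_gt0// mulrAC -exprD mulrC.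
rewrite (le_trans _ (hF x))// ler_wpM2l ?normc_ge0// (le_trans (hn x))//.
by rewrite exprS ler_peMl ?wta_ge1// exprn_ge0// ltW// wta_gt0.
Qed.

End bootstrap.

Section symbol.
Context {R : realType} {d : nat}.
Local Notation T := 'rV[R]_d.
Variables (alpha m : R).
Hypotheses (d_gt0 : (0 < d)%N) (alpha_gt0 : 0 < alpha) (alpha_lt2 : alpha < 2)
  (m_ge0 : 0 <= m).

(** The symbol grows like [|xi| ^ alpha], so that subtracting any spectral
    parameter does not matter at high frequency. *)
Lemma Phi_elliptic (z : R[i]) : exists Q0 D, [/\ 0 <= Q0, 0 <= D &
  forall xi : T, Q0 <= wta alpha xi ->
    wta alpha xi <= D * Normc.normc ((Phi m alpha (enorm xi ^+ 2))%:C - z)].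
Proof.
pose k := (2 * d%:R) `^ alpha : R.
have k0 : 0 < k by rewrite powR_gt0// mulr_gt0// ltr0n.
have z0 := normc_ge0 z.
exists (2 `^ alpha + 2 * k * (m + Normc.normc z)), (2 * k); split.
- by rewrite addr_ge0 ?powR_ge0// !mulr_ge0 ?addr_ge0// ltW.
- by rewrite mulr_ge0// ltW.
move=> xi hQ.
have h2 : 2 <= wt xi.
  rewrite leNgt; apply/negP => w2.
  have : wta alpha xi < 2 `^ alpha.
    by rewrite /wta gt0_ltr_powR ?nnegrE ?(ltW (wt_gt0 _)).
  apply/negP; rewrite -leNgt (le_trans _ hQ)// lerDl !mulr_ge0 ?addr_ge0//; exact: ltW.
have he : wt xi <= 2 * d%:R * enorm xi.
  by have := norm1_le_enorm xi; move: h2; rewrite /wt; lra.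
have hk : wta alpha xi <= k * enorm xi `^ alpha.
  rewrite /wta /k -powRM ?mulr_ge0 ?enorm_ge0//.
  by apply: ge0_ler_powR; rewrite ?nnegrE ?mulr_ge0 ?enorm_ge0 ?(ltW alpha_gt0)
    ?(ltW (wt_gt0 _)).
have hP : enorm xi `^ alpha - m <= Phi m alpha (enorm xi ^+ 2).
  rewrite /Phi lerD2r.
  have -> : enorm xi `^ alpha = (enorm xi ^+ 2) `^ (alpha / 2).
    by rewrite -powR_mulrn ?enorm_ge0// -powRrM; congr (_ `^ _); field.
  apply: ge0_ler_powR; rewrite ?nnegrE ?divr_ge0 ?addr_ge0 ?sqr_ge0 ?powR_ge0
    ?(ltW alpha_gt0)//.
  by rewrite lerDl powR_ge0.
have hN : Phi m alpha (enorm xi ^+ 2) - Normc.normc z <= Normc.normc ((Phi m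
  alpha (enorm xi ^+ 2))%:C - z).
  rewrite (le_trans _ (normc_ge_absRe _))// cReD cReN /= (le_trans _ (ler_norm _))//.
  by rewrite lerD2l lerN2 (le_trans (ler_norm _))// normc_ge_absRe.
set w := wta alpha xi in hQ hk *; set P := Phi _ _ _ in hP hN *; set e := enorm
  xi `^ alpha in hk hP.
set n := Normc.normc (_ - _) in hN *.
have h3 : e - m - Normc.normc z <= n by lra.
have h4 : k * (e - m - Normc.normc z) <= k * n by rewrite ler_wpM2l// ltW.
have p0 : 0 <= 2 `^ alpha :> R by exact: powR_ge0.
lra.
Qed.

End symbol.

(** * Smoothness from moments *)

Section smoothness.
Context {R : realType} {d : nat}.
Local Notation mu := (@lebesgue_rV R d).
Local Notation T := 'rV[R]_d.
Implicit Types u V : T -> R[i].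

Definition all_moments V :=
  cmeasurable V /\ forall N, rintegrable (fun x => wt x ^+ N * Normc.normc (V x)).

Lemma all_moments_cintegrable V : all_moments V -> cintegrable V.
Proof.
move=> [mV iV]; apply: (cintegrable_le mV (iV 0%N)) => x.
by rewrite expr0 mul1r.
Qed.

Lemma all_moments_dotp V y : all_moments V ->
  all_moments (fun x => - 'i%C * (dotp x y)%:C * V x).
Proof.
move=> [mV iV]; have mV' : cmeasurable (fun x => - 'i%C * (dotp x y)%:C * V x).
  apply: cmeasurableM => //; apply: cmeasurableM; first exact: cmeasurable_cst.
  by apply: cmeasurable_real; exact: measurable_dotpl.
split => // N.
apply: (rintegrable_le _ (rintegrableZ (norm1 y) (iV N.+1))) => [|x].
  apply: measurable_funM; last exact: measurable_normc.
  by apply: measurable_funX; exact: measurable_wt.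
have w0 := ltW (wt_gt0 x).
rewrite ger0_norm ?mulr_ge0 ?exprn_ge0 ?normc_ge0//.
rewrite !Normc.normcM normcN normc_real.
rewrite normc_i mul1r exprSr.
have -> : norm1 y * (wt x ^+ N * wt x * Normc.normc (V x)) =
  wt x ^+ N * (wt x * norm1 y * Normc.normc (V x)) by ring.
by rewrite ler_wpM2l ?exprn_ge0// ler_wpM2r ?normc_ge0// abs_dotp_le.
Qed.

Lemma ft_lipschitz V : all_moments V ->
  exists C, forall x y, Normc.normc (ft V (x + y) - ft V x) <= C * norm1 y.
Proof.
move=> aV; have iV := all_moments_cintegrable aV; have [mV hV] := aV.
pose I := \int[mu]_x (wt x ^+ 1 * Normc.normc (V x)).
exists (2 * (2 * I)) => x y.
have i1 := cintegrable_char (x + y) iV; have i2 := cintegrable_char x iV.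
rewrite /ft -cintegralB//.
have -> : 2 * (2 * I) * norm1 y = 2 * \int[mu]_x (2 * norm1 y * (wt x ^+ 1 *
  Normc.normc (V x))).
  by rewrite RintegralZl//; [rewrite -/I; ring|exact: (hV 1%N)].
apply: normc_cintegral_le; [exact: cintegrable_meas (cintegrableB i1 i2)|exact:
  rintegrableZ (hV 1%N)|move=> z].
have -> : V z * echar (dotp z (x + y)) - V z * echar (dotp z x) =
   V z * (echar (dotp z y) - 1) * echar (dotp z x) by rewrite dotpDr echarD; ring.
rewrite normcM_echar Normc.normcM expr1.
have -> : 2 * norm1 y * (wt z * Normc.normc (V z)) = Normc.normc (V z) * (2 *
  (wt z * norm1 y)) by ring.
by rewrite ler_wpM2l ?normc_ge0// (le_trans (echar_taylor1 _))// ler_wpM2l//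
  abs_dotp_le.
Qed.

Lemma continuous_ft V (r : R) : all_moments V -> continuous (fun x => r *
  complex.Re (ft V x)).
Proof.
move=> aV x; have [C hC] := ft_lipschitz aV.
have FF : Filter (nbhs x) by exact: nbhs_filter.
apply/(@cvgrPdist_le _ _ _ _ FF) => e e0.
pose K := `|r| * `|C| * d%:R + 1.
have K0 : 0 < K by rewrite ltr_wpDl// !mulr_ge0.
apply/nbhs_ballP; exists (e / K); first by rewrite /= divr_gt0.
move=> y; rewrite -ball_normE /ball_ /= => xy.
rewrite -mulrBr normrM.
have h : `|complex.Re (ft V x) - complex.Re (ft V y)| <= `|C| * (d%:R * `|x - y|).
  rewrite distrC -cReN -cReD (le_trans (normc_ge_absRe _))//.
  have := hC x (y - x); rewrite (addrC x) subrK => /le_trans; apply.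
  apply: (@le_trans _ _ (`|C| * norm1 (y - x))).
    by rewrite ler_wpM2r ?norm1_ge0// ler_norm.
  by rewrite ler_wpM2l// distrC norm1_le_norm.
rewrite (le_trans (ler_wpM2l (normr_ge0 r) h))// !mulrA.
apply: (@le_trans _ _ (K * `|x - y|)); first by rewrite ler_wpM2r// lerDl.
by rewrite mulrC -ler_pdivlMr// ltW.
Qed.

Lemma is_derive_ft V (r : R) x y : all_moments V ->
  is_derive x y (fun x => r * complex.Re (ft V x))
    (r * complex.Re (ft (fun z => - 'i%C * (dotp z y)%:C * V z) x)).
Proof.
move=> [mV iV]; have [C hC] := ft_taylor y mV (iV 2%N).
apply: (is_derive_quadratic_dir (C := `|r| * C)) => h _.
have := hC x h; set A := ft V (x + _); set B := ft V x; set D := ft _ x => H.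
have -> : r * complex.Re A - r * complex.Re B - h * (r * complex.Re D) =
   r * complex.Re (A - B - h%:C * D).
  by rewrite !cReD !cReN cReM /=; ring.
by rewrite normrM -mulrA ler_wpM2l// (le_trans (normc_ge_absRe _)).
Qed.

(** Differentiation multiplies the density by a linear function, which
    preserves the finiteness of all moments. *)
Lemma Ck_ft k V (r : R) : all_moments V -> Ck k (fun x => r * complex.Re (ft V x)).
Proof.
elim: k V => [|k ih] V aV /=; (split; first exact: continuous_ft) => // i.
split; first by move=> x; have [] := is_derive_ft r x (delta_mx ord0 i) aV.
rewrite (_ : (fun x => 'D_(delta_mx ord0 i) _ x) = (fun x => r * complex.Re
   (ft (fun z => - 'i%C * (dotp z (delta_mx ord0 i))%:C * V z) x))).
  by apply: ih; exact: all_moments_dotp.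
by apply/funext => x; have [_ ->] := is_derive_ft r x (delta_mx ord0 i) aV.
Qed.

Lemma bounded_Lfun (f : T -> R) (B : R) : measurable_fun setT f ->
  (forall x, `|f x| <= B) -> f \in Lfun mu +oo%E.
Proof.
move=> mf fB; rewrite inE; apply/andP; split; rewrite inE//=.
rewrite /finite_norm unlock /=; case: ifPn => // _.
apply: (@le_lt_trans _ _ B%:E); last exact: ltry.
by apply/ess_supP; apply: aeW => x /=; rewrite lee_fin.
Qed.

End smoothness.

(** * Regularity of the ground state *)

Local Close Scope complex_scope.

Theorem proposition4p1 (R : realType) (d : nat) (alpha m v a : R)
    (d_gt0 : (0 < d)%N) (alpha_gt0 : 0 < alpha) (alpha_lt2 : alpha < 2)
    (m_ge0 : 0 <= m) (v_gt0 : 0 < v) (a_gt0 : 0 < a)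
    (gs0 : has_ground_state
       (schrodinger m alpha (fun x : 'rV[R]_d => - (v * \1_(eball a) x))))
    (gs : forall eps : R, 0 < eps -> has_ground_state
       (schrodinger m alpha (fun x : 'rV[R]_d => - (v * eta a eps x)))) :
  forall (eps : R) (phi : 'rV[R]_d -> R), 0 < eps ->
    is_ground_state
      (schrodinger m alpha (fun x : 'rV[R]_d => - (v * eta a eps x))) phi ->
    Cinfty phi /\ phi \in Lfun (@lebesgue_rV R d) +oo%E.
Proof.
move=> eps phi eps_gt0 [[z _ [_ [w0 [U phiU w0U] zphi]]] _ _ cphi].
pose c := @fourier_cst R d.
have c0 : 0 < c := fourier_cst_gt0.
pose delta := eps / 2; pose b := a + eps / 2.
have delta0 : 0 < delta by exact: divr_gt0.
have b0 : 0 <= b by rewrite addr_ge0 ?ltW.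
have bk := rho_scaled_bump_class (d := d) delta0.
have etaE : eta a eps = mollified b (rho_scaled delta) :> ('rV[R]_d -> R) by [].
rewrite etaE in zphi.
set k := rho_scaled delta in bk zphi.
have [phi2 U2 _] := phiU.
have mU := L2_cmeasurable U2.
have mphi : measurable_fun setT phi by have [] := L2_cmeasurable phi2.
have iF := cintegrable_mollified delta0 b0 bk phiU.
set F := fun x : 'rV[R]_d => _ in iF.
pose Psi := ft F.
have [r [_ hr]] := mollified_support delta0 b0 bk.
have rel : {ae @lebesgue_rV R d, forall xi,
   Normc.normc ((Phi m alpha (enorm xi ^+ 2))%:C%C - z) * Normc.normc (U xi) =
   c * v * Normc.normc (Psi xi)}.
  have iG : cintegrable (fun x => (- v)%:C%C * F x) by exact: cintegrableZ.
  have zE : ae_eqC (fun x => z * (phi x)%:C%C) (fun x => w0 x + (- v)%:C%C * F x).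
    move: zphi; apply: filterS => x /= ->; congr (_ + _).
    by rewrite /F -!rmorphM /=; congr (_%:C%C); ring.
  have G0 x : r <= enorm x -> (- v)%:C%C * F x = 0.
    by move=> /hr e; rewrite /F e mulr0 rmorph0 mulr0.
  have := fourier2_lincomb phiU w0U iG zE G0; apply: filterS => xi /= E.
  rewrite -Normc.normcM mulrBl E normcN fourier1E ftZ// !Normc.normcM !normc_real.
  by rewrite normrN (gtr0_norm v_gt0) (gtr0_norm fourier_cst_gt0) mulrA.
have [U' [mU' UU' hU']] := ae_repair mU rel.
have U'le x : Normc.normc (U' x) <= Normc.normc (U x).
  by case: (hU' x) => [->|[_ ->]//]; rewrite Normc.normc0 normc_ge0.
have [Q0 [D [Q00 D0 hQ]]] := @Phi_elliptic R d alpha m d_gt0 alpha_gt0 m_ge0 z.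
have [C1 [C10 hconv]] := ft_mollified_le delta0 b0 bk phiU.
have mom N : rintegrable (fun x => wt x ^+ N * Normc.normc (U' x)).
  apply: (@bootstrap_moments R d alpha alpha_gt0 alpha_lt2 U' Psi (ft (fun x =>
    (k x)%:C%C)) Q0 (D * (c * v)) C1
     (2 * \int[@lebesgue_rV R d]_x Normc.normc (F x))) => //.
  - apply: (rintegrable_le (measurable_sqr_normc mU') (L2_rintegrable U2)) => x.
    by rewrite ger0_norm ?sqr_ge0// lerXn2r ?nnegrE ?normc_ge0.
  - by rewrite !mulr_ge0// ltW.
  - move=> x hx; case: (hU' x) => [->|[e ->]].
      by rewrite Normc.normc0 mul0r !mulr_ge0 ?normc_ge0// ltW.
    rewrite -mulrA -e mulrA mulrC ler_wpM2r ?normc_ge0//; exact: hQ.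
  - by move=> x; exact: ft_bounded.
  - move=> x; rewrite (le_trans (hconv x))// ler_wpM2l// le_eqVlt; apply/orP;
    left; apply/eqP.
    have mK : measurable_fun setT (fun y : 'rV[R]_d => Normc.normc (ft (fun x
      => (k x)%:C%C) (y - x))).
      apply: measurable_normc; apply: (cmeasurable_comp (cmeasurable_ft
        (bump_class_cintegrable delta0 bk))).
      exact: (measurable_shift (- x)).
    apply: Rintegral_ae; [apply: measurable_funM => //; exact:
      measurable_normc|apply: measurable_funM => //; exact: measurable_normc|].
    by move: UU'; apply: filterS => y /= ->.
  - exact: cmeasurable_ft (bump_class_cintegrable delta0 bk).
  - by move=> N'; exact: (bump_class_ft_decay delta0 N' bk).
(* phi being real, conjugating the inversion formula presents it as a transform
   with the kernel of ft. *)
pose V x := ((U' x)^*)%C.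
have aV : all_moments V.
  split; first exact: cmeasurable_conj.
  by move=> N; have := mom N; apply: eq_integrable => // x _ /=; rewrite normc_conj.
have iU' : cintegrable U' by apply: (cintegrable_le mU' (mom 0%N)) => x;
  rewrite expr0 mul1r.
have iU : cintegrable U := cintegrable_ae mU iU' UU'.
have phiE : phi = (fun x => c * complex.Re (ft V x)).
  apply/funext => x.
  have := fourier2_inversion phiU iU (cphi x).
  have iUe : cintegrable (fun xi => U' xi * echar (- dotp xi x)).
    by have := cintegrable_char (- x) iU'; under eq_fun do rewrite dotpNr.
  have -> : cintegral (fun xi => U xi * echar (- dotp xi x)) =
      cintegral (fun xi => U' xi * echar (- dotp xi x)).
    apply: cintegral_ae.
    - apply: cmeasurableM => //; apply: cmeasurable_echar; apply:
      measurable_funN; exact: measurable_dotpl.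
    - exact: cintegrable_meas.
    by move: UU'; apply: filterS => y /= ->.
  have -> : ft V x = (cintegral (fun xi => U' xi * echar (- dotp xi x)))^*%C.
    rewrite -cintegral_conj//; apply: eq_cintegral => y.
    by rewrite conjcM -echarN opprK.
  move=> /(congr1 (@complex.Re R)); rewrite cReM cReJ /= mul0r subr0.
  by [].
have bphi x : `|phi x| <= c * (2 * \int[@lebesgue_rV R d]_y Normc.normc (V y)).
  rewrite phiE normrM (gtr0_norm c0) ler_wpM2l ?(ltW c0)//.
  rewrite (le_trans (normc_ge_absRe _))//.
  by apply: ft_bounded; exact: all_moments_cintegrable.
split; last exact: bounded_Lfun bphi.
by move=> n; rewrite phiE; exact: Ck_ft.
Qed.
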